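(* There exists a constant $C>0$ such that for every compact metric graph $\Gamma$ (not reduced to a single point) with total length $\mu(\Gamma)$, first non-trivial eigenvalue $\lambda_1(\Gamma)$ of the Laplacian $\Delta$ of $\Gamma$, and maximum valence $d_{\max}$ of points of $\Gamma$, the divisorial gonality $\gamma_{\mathrm{div}}(\Gamma)$ satisfies $$\gamma_{\mathrm{div}}(\Gamma)\ \geq\ C\,\frac{\lambda_1(\Gamma)\,\ell_{\min}(\Gamma)\,\mu(\Gamma)}{d_{\max}}.$$
   Context: Metric graphs. A metric graph $\Gamma$ is a compact connected metric space such that every point $p\in\Gamma$ has a neighbourhood isometric to a star $\{t e^{2\pi i m/n} : 0\le t<r,\ 1\le m\le n\}\subset\mathbb{C}$ with its path metric, for some $r>0$ and some integer $n\ge 0$ (for $n=0$ the star is a point); $n=\mathrm{val}(p)$ is the valence of $p$. Equivalently, $\Gamma$ is a finite connected graph whose edges are realized as segments of positive real lengths, with the path metric. $T_p(\Gamma)$ denotes the set of the $\mathrm{val}(p)$ unit tangent directions at $p$, and for $w\in T_p(\Gamma)$, $d_wf(p)=\lim_{t\downarrow 0}\frac{f(p+tw)-f(p)}{t}$ is the outgoing slope of $f$ at $p$ along $w$. Models. A vertex set of $\Gamma$ is a finite non-empty set $V\subset\Gamma$ containing all points of valence different from $2$; the edges are the closures of the connected components of $\Gamma\setminus V$, each with a length $\ell(e)>0$. The resulting graph $G=(V,E)$ is a model of $\Gamma$; it is simple if it has no loops and no multiple edges. For a simple graph model $G$ of $\Gamma$, $\ell_{\min}(G)$ is the minimum length of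 the edges of $G$, and $\ell_{\min}(\Gamma)$ is the maximum of $\ell_{\min}(G)$ over all simple graph models $G$ of $\Gamma$. The volume (total length) $\mu(\Gamma)$ is the sum of edge lengths in any model, and $d_{\max}=\max_{p\in\Gamma}\mathrm{val}(p)$. Divisorial gonality. $\mathrm{Div}(\Gamma)$ is the free abelian group on the points of $\Gamma$; the degree of $D=\sum_v a_v (v)$ is $\sum_v a_v$, and $D$ is effective ($D\ge 0$) if all $a_v\ge 0$. A rational function on $\Gamma$ is a continuous piecewise linear function $f:\Gamma\to\mathbb{R}$ with integer slopes; $\mathrm{ord}_p(f)$ is the sum of the outgoing slopes of $f$ at $p$, and $\mathrm{div}(f)=\sum_p\mathrm{ord}_p(f)(p)$. Divisors $D,D'$ are linearly equivalent, $D\sim D'$, if $D-D'=\mathrm{div}(f)$ for some rational function $f$. Set $|D|=\{E\ge 0: E\sim D\}$. The rank of $D$ is $r(D)=\min\{\deg(E): E\geq 0,\ |D-E|=\emptyset\}-1$. The divisorial gonality $\gamma_{\mathrm{div}}(\Gamma)$ is the smallest integer $d$ for which there is a divisor $D$ on $\Gamma$ with $\deg(D)=d$ and $r(D)=1$. Laplacian. $dx$ is the Lebesgue measure on $\Gamma$. $\mathrm{Zh}(\Gamma)$ is the space of continuous, piecewise $C^2$ functions $f:\Gamma\to\mathbb{R}$ with $f''\in L^1(\Gamma)$, and $\mathrm{Zh}_0(\Gamma)=\{f\in\mathrm{Zh}(\Gamma):\int_\Gamma f\,dx=0\}$. The Laplacian is the measure-valued operator $\Delta(f)=-f''(x)\,dx-\sum_{p\in\Gamma}\bigl(\sum_{w\in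 T_p(\Gamma)}d_wf(p)\bigr)\delta_p$; $\lambda$ is an eigenvalue if $\Delta(f)=\lambda f\,dx$ for some non-zero $f\in\mathrm{Zh}(\Gamma)$. The smallest non-zero eigenvalue is $\lambda_1(\Gamma)$; equivalently $$\lambda_1(\Gamma)=\inf_{0\ne f\in\mathrm{Zh}_0(\Gamma)}\frac{\int_\Gamma|f'|^2dx}{\int_\Gamma f^2dx}.$$ *)

(* Defs.v *)
From HB Require Import structures.
From mathcomp Require Import all_boot all_order all_algebra finmap.
From mathcomp Require Import all_classical all_reals all_analysis.
From mathcomp.multinomials Require Import freeg.
From mathcomp Require Import lra.

Set Implicit Arguments.
Unset Strict Implicit.
Unset Printing Implicit Defensive.

Import Order.TTheory GRing.Theory Num.Theory.
Import numFieldNormedType.Exports.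

Local Open Scope classical_set_scope.
Local Open Scope ring_scope.

(** Metric graphs: finite connected graphs (loops and multiple edges allowed),
    each edge [e] being realized as a segment of length [len e].  This
    graph is only one model among others: it serves to describe the metric
    space of points [gpoint G], whose other models are considered below. *)

Record metric_graph (R : realType) := MetricGraph {
  vert : finType;
  edge : finType;
  src : edge -> vert;
  tgt : edge -> vert;
  len : edge -> R;
  len_gt0 : forall e, 0 < len e;
  vert_neq0 : (0 < #|vert|)%N;
  vert_connected : forall u v : vert,
    connect [rel u v | [exists e, ((src e == u) && (tgt e == v))
                               || ((src e == v) && (tgt e == u))]] u v }.

(** Points: the vertices, and the pairs [(e, t)] with [0 < t < len e]. *)
Definition gpoint (R : realType) (G : metric_graph R) : Type :=
  (vert G + {x : edge G * R | 0 < x.2 < len x.1})%type.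

HB.instance Definition _ (R : realType) (G : metric_graph R) :=
  Choice.copy (gpoint G)
    (vert G + {x : edge G * R | (0 < x.2 < len x.1)%R})%type.

Section MetricGraph.
Variables (R : realType) (G : metric_graph R).
Implicit Types (e : edge G) (p q : gpoint G) (f g : gpoint G -> R).

(** [pt e] is the arc-length parametrization of [e] on [0, len e], extended by
    constants outside of this interval. *)
Definition pt e (s : R) : gpoint G :=
  if insub (e, s) is Some x then inr x
  else if s <= 0 then inl (src e) else inl (tgt e).

(** A path from [p] to [q] is given as a list of pieces [(e, (s, t))], each one
    running along the edge [e] from parameter [s] to parameter [t]. *)
Fixpoint is_path p q (c : seq (edge G * (R * R))) : Prop :=
  if c is (e, (s, t)) :: c' then
    [/\ 0 <= s <= len e, 0 <= t <= len e, pt e s = p & is_path (pt e t) q c']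
  else p = q.

Definition path_length (c : seq (edge G * (R * R))) : R :=
  \sum_(x <- c) `|x.2.2 - x.2.1|.

Definition path_dist p q : R :=
  inf [set path_length c | c in [set c | is_path p q c]].

Lemma pt0 e : pt e 0 = inl (src e).
Proof. by rewrite /pt insubF ?lexx//= ltxx. Qed.

Lemma pt_len e : pt e (len e) = inl (tgt e).
Proof. by rewrite /pt insubF /= ?leNgt ?len_gt0// ltxx andbF. Qed.

Lemma pt_val (x : {x : edge G * R | 0 < x.2 < len x.1}) :
  pt (val x).1 (val x).2 = inr x.
Proof. by rewrite /pt -surjective_pairing valK. Qed.

Lemma is_path_cat p q r c c' :
  is_path p q c -> is_path q r c' -> is_path p r (c ++ c').
Proof.
elim: c p => [p ->//|[e [s t]] c IH p /= [? ? ? H] H']; split => //.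
exact: IH.
Qed.

Lemma path_length_cat c c' : path_length (c ++ c') = path_length c + path_length c'.
Proof. by rewrite /path_length big_cat. Qed.

Lemma is_path_sym p q c : is_path p q c ->
  exists2 c', is_path q p c' & path_length c' = path_length c.
Proof.
elim: c p => [p ->|[e [s t]] c IH p /= [hs ht pe /IH[c' c'P c'l]]].
  by exists [::].
exists (c' ++ [:: (e, (t, s))]); first by apply: is_path_cat c'P _; split.
by rewrite path_length_cat c'l /path_length big_seq1 big_cons distrC addrC.
Qed.

Lemma path_length_ge0 c : 0 <= path_length c.
Proof. by apply: sumr_ge0 => x _. Qed.

Lemma has_path p q : exists c, is_path p q c.
Proof.
have toV r : exists v c, is_path r (inl v) c.
  case: r => [v|x]; first by exists v, [::].
  exists (src (val x).1), [:: ((val x).1, ((val x).2, 0))].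
  have := len_gt0 (val x).1; case/andP: (valP x) => x0 xl l0.
  split; rewrite ?lexx ?ltW //; first exact: pt_val.
  exact: pt0.
have VV u v : exists c, is_path (inl u) (inl v) c.
  have /connectP[s] := vert_connected u v.
  elim: s u => [|w s IH] u /=; first by move=> _ ->; exists [::].
  case/andP => /existsP[e uw] ws vl; have [c cP] := IH _ ws vl.
  have l0 := ltW (len_gt0 e).
  case/orP: uw => /andP[/eqP es /eqP et].
    exists ((e, (0, len e)) :: c) => /=.
    by rewrite pt0 pt_len es et !lexx l0.
  exists ((e, (len e, 0)) :: c) => /=.
  by rewrite pt0 pt_len es et !lexx l0.
have [u [c pc]] := toV p; have [v [c' qc']] := toV q.
have [c1 uv] := VV u v; have [c2 vq _] := is_path_sym qc'.
by exists (c ++ (c1 ++ c2)); apply: is_path_cat pc (is_path_cat uv vq).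
Qed.

Let lengths p q := [set path_length c | c in [set c | is_path p q c]].

Let lengths_inf p q : has_inf (lengths p q).
Proof.
have [c cP] := has_path p q.
split; first by exists (path_length c), c.
by exists 0 => _ [d _ <-]; exact: path_length_ge0.
Qed.

Lemma path_dist_le p q c : is_path p q c -> path_dist p q <= path_length c.
Proof. by move=> cP; apply: ge_inf; [case: (lengths_inf p q)|exists c]. Qed.

Lemma path_dist_ge0 p q : 0 <= path_dist p q.
Proof.
apply: lb_le_inf; first by case: (lengths_inf p q).
by move=> _ [d _ <-]; exact: path_length_ge0.
Qed.

Lemma path_distxx p : path_dist p p = 0.
Proof.
apply/eqP; rewrite eq_le path_dist_ge0 andbT.
by have := @path_dist_le p p [::] erefl; rewrite /path_length big_nil.
Qed.

Lemma path_dist_sym p q : path_dist p q = path_dist q p.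
Proof.
congr inf; apply/seteqP; split=> _ [c /is_path_sym[c' c'P c'l] <-];
  by exists c'.
Qed.

Lemma path_dist_triangle q p r :
  path_dist p r <= path_dist p q + path_dist q r.
Proof.
apply/ler_addgt0Pr => eps eps0; have e20 : 0 < eps / 2 by lra.
have [_ [c cP <-] cl] := inf_adherent e20 (lengths_inf p q).
have [_ [d dP <-] dl] := inf_adherent e20 (lengths_inf q r).
have := path_dist_le (is_path_cat cP dP); rewrite path_length_cat.
rewrite /path_dist in cl dl *; rewrite -/(lengths p r) -/(lengths p q).
rewrite -/(lengths q r); lra.
Qed.

Lemma path_dist_lip g :
  (forall e s t, 0 <= s <= len e -> 0 <= t <= len e ->
    `|g (pt e t) - g (pt e s)| <= `|t - s|) ->
  forall p q, `|g q - g p| <= path_dist p q.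
Proof.
move=> gl p q; apply: lb_le_inf; first by case: (lengths_inf p q).
move=> _ [c cP <-]; elim: c p cP => [p <-|[e [s t]] c IH p /= [hs ht <- /IH H]].
  by rewrite subrr normr0 path_length_ge0.
rewrite /path_length big_cons -/(path_length c) [leRHS]addrC.
by rewrite (le_trans (ler_distD (g (pt e t)) _ _))// lerD// gl.
Qed.

Lemma path_dist_positivity p q : path_dist p q = 0 -> p = q.
Proof.
have int (x : {x : edge G * R | 0 < x.2 < len x.1}) r :
    path_dist (inr x) r = 0 -> inr x = r.
  case/andP: (valP x); set e0 := (val x).1; set t0 := (val x).2 => x0 xl.
  set h := Num.min t0 (len e0 - t0).
  have h0 : 0 < h by rewrite lt_min x0 subr_gt0.
  have ht : h <= t0 by rewrite ge_min lexx.
  have hl : h <= len e0 - t0 by rewrite ge_min lexx orbT.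
  pose k t := Num.max 0 (h - `|t - t0|).
  pose g (y : gpoint G) : R := if y is inr z then
    if (val z).1 == e0 then k (val z).2 else 0 else 0.
  have gE e s : 0 <= s <= len e -> g (pt e s) = if e == e0 then k s else 0.
    rewrite /pt => /andP[s0 sl]; case: insubP => [z _ zE|].
      by rewrite /g zE.
    rewrite /= negb_and -!leNgt => Hs.
    have -> : (if e == e0 then k s else 0) = 0.
      case: eqP => // ee; rewrite /k; apply/max_idPl.
      rewrite ee in sl Hs; rewrite subr_le0.
      case/orP: Hs => Hs; first by rewrite ler0_norm; lra.
      by rewrite ger0_norm; lra.
    by case: ifP.
  have kl s t : `|k t - k s| <= `|t - s|.
    have : `|t - t0| <= `|t - s| + `|s - t0|.
      exact: ler_distD.
    have : `|s - t0| <= `|t - s| + `|t - t0|.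
      by rewrite (distrC t s); exact: ler_distD.
    have : 0 <= `|t - s| by [].
    rewrite /k; move: `|t - s| `|t - t0| `|s - t0| => a b c a0 H1 H2.
    rewrite ler_norml.
    by case: (leP 0 (h - c)) => ?; case: (leP 0 (h - b)) => ?; lra.
  have gl e s t : 0 <= s <= len e -> 0 <= t <= len e ->
      `|g (pt e t) - g (pt e s)| <= `|t - s|.
    move=> hs ht'; rewrite !gE//; case: ifP => _; first exact: kl.
    by rewrite subrr normr0.
  move=> d0; have := path_dist_lip gl (inr x) r; rewrite d0 normr_le0 subr_eq0.
  have -> : g (inr x) = h.
    by rewrite /= eqxx /k subrr normr0 subr0; apply/max_idPr/ltW.
  case: r d0 => [v|y] _ /=; first by rewrite lt_eqF.
  case: ((val y).1 =P e0) => [ye|_]; last by rewrite lt_eqF.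
  rewrite /k; case: leP => [_|_]; last by rewrite lt_eqF.
  move=> /eqP H; have /eqP : `|(val y).2 - t0| = 0 by lra.
  rewrite normr_eq0 subr_eq0 => /eqP yt; congr inr; apply: val_inj.
  by rewrite [LHS]surjective_pairing [RHS]surjective_pairing ye yt.
case: p => [u|x]; last exact: int.
case: q => [v|y]; last by rewrite path_dist_sym => /int.
pose h := \big[Order.min/(1 : R)]_(e : edge G) len e.
have h0 : 0 < h by apply: lt_bigmin => // e _; exact: len_gt0.
have hl e : h <= len e by exact: bigmin_le_cond.
pose a w : R := if w == u then h else 0.
have a0 w : 0 <= a w <= h by rewrite /a; case: ifP => _; rewrite ?lexx ltW.
pose k e t := a (src e) + (a (tgt e) - a (src e)) / len e * t.
pose g (y : gpoint G) : R := match y with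
  | inl w => a w | inr z => k (val z).1 (val z).2 end.
have gE e s : 0 <= s <= len e -> g (pt e s) = k e s.
  rewrite /pt => /andP[s0 sl]; case: insubP => [z _ zE|].
    by rewrite /g zE.
  rewrite /= negb_and -!leNgt => Hs; case: ifP => s0'.
    have -> : s = 0 by lra.
    by rewrite /k mulr0 addr0.
  have -> : s = len e by move: Hs; rewrite s0' /=; lra.
  by rewrite /k divfK ?gt_eqF ?len_gt0// addrC subrK.
have gl e s t : 0 <= s <= len e -> 0 <= t <= len e ->
    `|g (pt e t) - g (pt e s)| <= `|t - s|.
  move=> hs ht; rewrite !gE// /k opprD addrACA subrr add0r -mulrBr normrM ler_piMl//.
  rewrite normrM normfV ler_pdivrMr ?normr_gt0 ?gt_eqF ?len_gt0// mul1r.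
  rewrite (gtr0_norm (len_gt0 e)) (le_trans _ (hl e))// ler_norml.
  by have /andP[? ?] := a0 (src e); have /andP[? ?] := a0 (tgt e); lra.
move=> d0; have := path_dist_lip gl (inl u) (inl v).
rewrite d0 normr_le0 subr_eq0 /= /a eqxx.
by case: (v =P u) => [->//|_]; rewrite lt_eqF.
Qed.

End MetricGraph.

HB.instance Definition _ (R : realType) (G : metric_graph R) :=
  isMetric.Build R (gpoint G) (@path_distxx R G) (@path_dist_positivity R G)
    (@path_dist_sym R G) (@path_dist_triangle R G).

Section Invariants.
Variables (R : realType) (G : metric_graph R).
Implicit Types (e : edge G) (p q : gpoint G) (f g : gpoint G -> R).
Implicit Types (V A : set (gpoint G)).

(** A direction is a pair [(e, b)]: along [e], positively if [b = true] and
    negatively otherwise.  A loop gives two directions at its base point. *)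
Definition tangents p : {set edge G * bool} :=
  match p with
  | inl v => [set w | (if w.2 then src w.1 else tgt w.1) == v]
  | inr x => [set w | w.1 == (val x).1]
  end.

Definition valence p : nat := #|tangents p|.

(** The point [p + s w], for small [s >= 0] and [w] a direction at [p]. *)
Definition walk p (w : edge G * bool) (s : R) : gpoint G :=
  let t0 := match p with
            | inl _ => if w.2 then 0 else len w.1
            | inr x => (val x).2
            end in
  pt w.1 (if w.2 then t0 + s else t0 - s).

Definition slope f p (w : edge G * bool) : R :=
  lim ((fun s => (f (walk p w s) - f p) / s) @ 0^'+).

Definition sum_slopes f p : R := \sum_(w in tangents p) slope f p w.

(** The maximum of the valences, written as a supremum over all points. *)
Definition max_valence : R := sup [set (valence p)%:R | p in [set: gpoint G]].

(** The integral over [A]; the finitely many vertices are negligible. *)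
Definition gint A g : R :=
  \sum_(e : edge G)
    \int[lebesgue_measure]_(t in `]0, len e[ `&` pt e @^-1` A) g (pt e t).

Definition volume : R := \sum_(e : edge G) len e.

Definition vertex_set V : Prop :=
  [/\ finite_set V, V !=set0 & forall p, valence p <> 2%N -> V p].

Definition model_edges V : set (set (gpoint G)) :=
  [set closure (connected_component (~` V) x) | x in ~` V].

Definition edge_length (c : set (gpoint G)) : R := gint c (fun=> 1).

(** The end points of an edge [c] of the model are the points of [c `&` V]:
    there is only one of them exactly when [c] is a loop. *)
Definition simple_model V : Prop :=
  [/\ vertex_set V,
      forall c, model_edges V c -> ~ exists v, c `&` V = [set v]
    & forall c c', model_edges V c -> model_edges V c' ->
        c `&` V = c' `&` V -> c = c'].

Definition model_lmin V : R := inf [set edge_length c | c in model_edges V].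

Definition lmin : R := sup [set model_lmin V | V in simple_model].

(** Second derivative with respect to arc length; irrelevant at vertices. *)
Definition second_derivative f p : R :=
  if p is inr x then derive1n 2 (fun s => f (pt (val x).1 s)) (val x).2 else 0.

Definition piecewise_C2 f : Prop :=
  exists2 S : set (gpoint G), finite_set S &
    forall e t, 0 < t < len e -> ~ S (pt e t) ->
      let h := fun s => f (pt e s) in
      [/\ derivable h t 1, derivable (derive1 h) t 1
        & {for t, continuous (derive1n 2 h)}].

Definition Zh f : Prop :=
  [/\ continuous f, piecewise_C2 f &
      forall e, lebesgue_measure.-integrable `]0, len e[
        (fun t => (second_derivative f (pt e t))%:E)].

(** The measure [Delta(f)], as a function of sets.  For [f] in [Zh], only
    finitely many points have a non-zero sum of outgoing slopes. *)
Definition laplacian f A : R :=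
  - gint A (second_derivative f) - \sum_(p \in A) sum_slopes f p.

Definition borel A : Prop := <<s [set U : set (gpoint G) | open U] >> A.

Definition eigenvalue (l : R) : Prop :=
  exists f, [/\ Zh f, exists p, f p != 0
              & forall A, borel A -> laplacian f A = l * gint A f].

Definition lambda1 : R := inf [set l | eigenvalue l /\ l != 0].

Definition divisor := {freeg (gpoint G)}.
Implicit Types D E : divisor.

Definition effective D : Prop := forall p, 0 <= coeff p D.

Definition rational_function f : Prop :=
  continuous f /\
  exists2 S : set (gpoint G), finite_set S &
    forall e t, 0 < t < len e -> ~ S (pt e t) ->
      exists m : int, \forall s \near t,
        f (pt e s) = f (pt e t) + m%:~R * (s - t).

(** [D] is the divisor of [f]; the order of [f] at [p] is [sum_slopes f p]. *)
Definition is_div f D : Prop := forall p, (coeff p D)%:~R = sum_slopes f p.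

Definition lin_equiv D D' : Prop :=
  exists2 f, rational_function f & is_div f (D - D').

Definition linear_system D : set divisor :=
  [set E | effective E /\ lin_equiv E D].

(** By convention 0 if [P] is empty. *)
Definition least (P : set nat) : nat :=
  if pselect (exists n, `[< P n >]) is left exP then ex_minn exP else 0%N.

Definition rank D : int :=
  (least [set n | exists E,
     [/\ effective E, deg E = n%:Z & linear_system (D - E) = set0]])%:Z - 1.

(** A divisor of rank 1 is equivalent to an effective one, so its degree is a
    natural number. *)
Definition gonality : nat :=
  least [set d | exists D, deg D = d%:Z /\ rank D = 1].

End Invariants.

Arguments volume {R} G.
Arguments lmin {R} G.
Arguments lambda1 {R} G.
Arguments max_valence {R} G.
Arguments gonality {R} G.

(* Main.v *)
Require Import Defs.
From mathcomp Require Import all_boot all_order all_algebra.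
From mathcomp Require Import all_classical all_reals all_analysis.
From mathcomp.multinomials Require Import freeg.
From mathcomp Require Import measurable_realfun zify ring lra.
Set Implicit Arguments.
Unset Strict Implicit.
Unset Printing Implicit Defensive.
Import Order.TTheory GRing.Theory Num.Theory.
Import numFieldNormedType.Exports.
Local Open Scope classical_set_scope.
Local Open Scope ring_scope.

(** Let [d] be the gonality, [mu] the volume, [m] the largest valence and [l] the
    smallest length of the edges of a simple model with vertex set [V].  It is enough
    to bound [lambda1 * l * mu] by a constant times [d * m] for every [V], since
    [lmin] is the supremum of the lengths [l].

    A divisor of rank one and degree [d] can be moved, inside its class of effective
    divisors, until its support [S] cuts the metric graph into components that all
    have at most half of the total length, measured by finitely many weighted points
    ([balanced_divisor]): if each effective
    divisor left a large component, one could move a chip into it, and between the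
    two divisors, at a balanced level of the maximum of the two rational functions,
    the large component would be strictly smaller.  The components are grouped
    into two sides of length at least [mu / 4], up to the points close to [S]
    ([balanced_union]).  The distance to [S], truncated at a multiple [r] of [l], is
    taken on one side and on the other; these two functions have disjoint supports
    and their energy is at most the volume of the points at distance at most [r] of
    [S].  Two points of [V] are at distance at least [l], because a geodesic between
    neighbouring points of [V] contains an edge of the model ([model_lmin_geodesic]).
    Hence each of the at most [d] points of [S] is close to at most one point of [V],
    and the volume of the points close to [S] is of order [d * m * r] ([near_volume]).
    This bounds [lambda1] by a multiple of [d * m / (l * mu)]
    ([lambda1_le_gonality]), as long as [d * m * l] is small with respect to [mu].
    In the opposite case, the bound of [lambda1] by a multiple of [l ^- 2], given by
    two disjoint segments of length proportional to [l], suffices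
    ([lambda1_le_lmin]).

    Two test functions with disjoint supports and Rayleigh quotients at most [K ^+ 2]
    have to be turned into an eigenvalue at most a multiple of [K ^+ 2].  The metric
    graph is subdivided into edges shorter than [K^-1].  For [0 <= k <= K], the
    functions [f] with [f'' = - k ^+ 2 f] on the edges are determined by their values
    at the vertices, and their energy minus [k ^+ 2] times their mass is a quadratic
    form in these values, continuous in [k].  For [k = 0], it is positive outside of
    the constants; for [k = K], it is nonpositive on the plane of the test functions.
    It is therefore singular for some [k] with [0 < k <= K] ([kernel_crossing]), and
    the vectors of its kernel are eigenfunctions ([sinusoidal_rayleigh],
    [sinusoidal_eigenvalue]). *)

(** * Induction principles *)

Section RealInduction.
Variable R : realType.
Implicit Types (a b x y : R).

(** The least upper bound of the points up to which [P] holds is [b]: [P] holds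
    there, and can be extended further to the right otherwise. *)
Lemma real_induction (a b : R) (P : R -> Prop) :
  P a ->
  (forall x, a <= x < b -> (forall y, a <= y <= x -> P y) ->
     exists2 eps, 0 < eps & forall y, x < y < x + eps -> y <= b -> P y) ->
  (forall x, a < x <= b -> (forall y, a <= y < x -> P y) -> P x) ->
  forall x, a <= x <= b -> P x.
Proof.
move=> Pa Pstep Plim x0 /andP[ax0 x0b].
pose A := [set x | a <= x <= b /\ forall y, a <= y <= x -> P y].
have Aa : A a.
  split; first by rewrite lexx (le_trans ax0).
  by move=> y; rewrite -eq_le => /eqP <-.
have supA : has_sup A by split; [exists a|exists b => y [/andP[]]].
set s := sup A.
have as_ : a <= s by apply: ub_le_sup => //; case: supA.
have sb : s <= b by apply: ge_sup; [exists a|move=> y [/andP[]]].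
have Plt y : a <= y < s -> P y.
  move=> /andP[ay ys]; have e0 : 0 < s - y by rewrite subr_gt0.
  have [z [_ Pz] sz] := sup_adherent e0 supA.
  by apply: Pz; rewrite ay ltW// (le_lt_trans _ sz)// opprB addrC subrK.
have Ps : P s.
  have [sa|sa] := eqVneq s a; first by rewrite sa.
  by apply: Plim => //; rewrite sb lt_neqAle eq_sym sa as_.
have Ple y : a <= y <= s -> P y.
  by move=> /andP[ay]; rewrite le_eqVlt => /predU1P[->//|ys]; apply: Plt; rewrite ay.
have [x0s|sx0] := leP x0 s; first by apply: Ple; rewrite ax0.
have sb' : s < b by apply: lt_le_trans x0b.
have [|eps eps0 Pe] := Pstep s _ Ple; first by rewrite as_.
pose z := Num.min b (s + eps / 2).
have zs : s < z by rewrite lt_min sb' ltrDl divr_gt0.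
suff : A z by move=> Az; have := ub_le_sup (proj2 supA) Az; rewrite leNgt zs.
split; first by rewrite (le_trans as_ (ltW zs)) ge_min lexx.
move=> y /andP[ay yz]; have [ys|sy] := leP y s; first by apply: Ple; rewrite ay.
move: yz; rewrite le_min => /andP[yb yse]; apply: Pe => //; rewrite sy /=; lra.
Qed.

(** One-sided neighbourhoods are what the slopes of a function in the directions at
    a point give access to. *)
Lemma locally_constant (T : Type) (F : R -> T) a b : a <= b ->
  (forall u, a <= u < b -> exists2 eps, 0 < eps &
     forall y, u < y < u + eps -> y <= b -> F y = F u) ->
  (forall u, a < u <= b -> exists2 eps, 0 < eps &
     forall y, u - eps < y < u -> a <= y -> F y = F u) ->
  F a = F b.
Proof.
move=> ab Fr Fl; suff H x : a <= x <= b -> F x = F a by rewrite (H b) ?ab ?lexx.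
apply: (real_induction (P := fun x => F x = F a)) => // {}x.
- move=> xab Px; have [eps eps0 H] := Fr _ xab.
  exists eps => // y xy yb; rewrite H//; apply: Px; case/andP: xab => -> _.
  by rewrite lexx.
- move=> xab Px; have [eps eps0 H] := Fl _ xab; case/andP: xab => ax xb.
  pose y := Num.max a (x - eps / 2).
  have ay : a <= y by rewrite le_max lexx.
  have yx : y < x by rewrite gt_max ax /=; lra.
  rewrite -(H y)//; first by apply: Px; rewrite ay.
  by rewrite yx lt_max andbT; apply/orP; right; lra.
Qed.

End RealInduction.

(** The order of [R] is well founded on the finitely many values of [f]. *)
Lemma finite_real_ind (R : realType) (T : finType) (f : T -> R) (P : T -> Prop) :
  (forall u, (forall w, f w < f u -> P w) -> P u) -> forall u, P u.
Proof.
move=> H u; have [n] := ubnP #|[pred w | f w < f u]|.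
elim: n u => // n IH u hn; apply: H => w wu; apply: IH.
move: hn; rewrite ltnS; apply: leq_trans; apply: proper_card; apply/properP; split.
  by apply/fintype.subsetP => z; rewrite !inE => /lt_trans; apply.
by exists w; rewrite !inE ?wu ?ltxx.
Qed.

Lemma min_lipschitz (R : realDomainType) (a b c d m : R) :
  `|a - c| <= m -> `|b - d| <= m -> `|Num.min a b - Num.min c d| <= m.
Proof.
rewrite !ler_norml; case: (leP a b) => ?; case: (leP c d) => ?; lra.
Qed.

(** * Points and subdivisions *)

Section Points.
Variables (R : realType) (G : metric_graph R).
Implicit Types (e : edge G) (p : gpoint G).

Lemma pt_interior e s (h : 0 < s < len e) :
  pt e s = inr (exist (fun x : edge G * R => is_true (0 < x.2 < len x.1)) (e, s) h).
Proof.
rewrite /pt; case: insubP => [x _ xE|]; last by rewrite h.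
by congr inr; apply: val_inj.
Qed.

Lemma pt_inj e e' s s' : 0 < s < len e -> 0 <= s' <= len e' ->
  pt e s = pt e' s' -> e = e' /\ s = s'.
Proof.
move=> hs /andP[s'0 s'l]; rewrite (pt_interior hs).
move: s'0; rewrite le_eqVlt => /predU1P[<-|s'0]; first by rewrite pt0.
move: s'l; rewrite le_eqVlt => /predU1P[->|s'l]; first by rewrite pt_len.
have h' : 0 < s' < len e' by rewrite s'0.
by rewrite (pt_interior h') => -[-> ->].
Qed.

Lemma pt_interior_neq e s v : 0 < s < len e -> pt e s <> inl v.
Proof. by move=> hs; rewrite (pt_interior hs). Qed.

Lemma ptP p : (exists e s, 0 <= s <= len e /\ p = pt e s) \/ (exists v, p = inl v).
Proof.
case: p => [v|x]; first by right; exists v.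
left; exists (val x).1, (val x).2; rewrite pt_val; split => //.
by have /andP[? ?] := valP x; rewrite !ltW.
Qed.

(** The parameter, on the edge carrying the direction [w], of the point [p]. *)
Definition base p (w : edge G * bool) : R :=
  match p with inl _ => if w.2 then 0 else len w.1 | inr x => (val x).2 end.

Lemma base_bounds p w : w \in tangents p ->
  [/\ 0 <= base p w <= len w.1, pt w.1 (base p w) = p &
   if w.2 then base p w < len w.1 else 0 < base p w].
Proof.
case: p w => [v|x] [e b]; rewrite inE /=.
  move=> /eqP <-; have l0 := len_gt0 e.
  by case: b; rewrite /= ?lexx (ltW l0) ?pt0 ?pt_len.
move/eqP => ->; have /andP[x0 xl] := valP x.
by rewrite (ltW x0) (ltW xl) pt_val; case: b.
Qed.

Lemma walkE p w s : walk p w s = pt w.1 (if w.2 then base p w + s else base p w - s).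
Proof. by case: p. Qed.

Lemma base_pt e s b : 0 <= s <= len e -> (if b then s < len e else 0 < s) ->
  (e, b) \in tangents (pt e s) /\ base (pt e s) (e, b) = s.
Proof.
move=> /andP[s0 sl]; have [->|sn0] := eqVneq s 0.
  by case: b; rewrite ?ltxx// => _; rewrite pt0 inE /=.
have [->|snl] := eqVneq s (len e).
  by case: b; rewrite ?ltxx// => _; rewrite pt_len inE /=.
have hs : 0 < s < len e by rewrite !lt_neqAle s0 sl eq_sym sn0 snl.
by rewrite (pt_interior hs) inE /= eqxx.
Qed.

End Points.

Section Sinusoids.
Variable R : realType.

(** Coefficients, on the edges of [G], of a function [x cos (k t) + d sin (k t)]
    which is continuous and satisfies the Kirchhoff condition at the
    vertices. *)
Definition sinusoidal (G : metric_graph R) (k : R) : Prop :=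
  exists (x : vert G -> R) (d : edge G -> R),
  [/\ forall e, x (tgt e) = x (src e) * cos (k * len e) + d e * sin (k * len e),
      forall v, \sum_(e | src e == v) d e +
        \sum_(e | tgt e == v)
          (x (src e) * sin (k * len e) - d e * cos (k * len e)) = 0 &
      (exists v, x v != 0) \/ (exists e, d e != 0)].

End Sinusoids.

Section Connected.
Variables (R : realType) (G : metric_graph R).

Lemma graph_ind (P : vert G -> Prop) :
  (forall e : edge G, P (src e) <-> P (tgt e)) -> forall u v, P u -> P v.
Proof.
move=> H u v Pu; have /connectP[s + ->] := vert_connected u v.
elim: s u Pu => [|w s IH] u Pu //= /andP[/existsP[e uw] ws]; apply: IH ws.
by case/orP: uw => /andP[/eqP es /eqP et]; move: Pu; rewrite -es -et => /H.
Qed.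

End Connected.

Section Split.
Variables (R : realType) (H : metric_graph R) (k0 : edge H) (s0 : R).
Hypothesis hs : 0 < s0 < len k0.

(** [None] is both the new vertex, at the parameter [s0] of [k0], and the new edge,
    from this vertex to the former target of [k0]; [Some k0] is the other half. *)
Definition split_src (k : option (edge H)) : option (vert H) :=
  omap (@src R H) k.
Definition split_tgt (k : option (edge H)) : option (vert H) :=
  if k is Some k then if k == k0 then None else Some (tgt k) else Some (tgt k0).
Definition split_len (k : option (edge H)) : R :=
  if k is Some k then if k == k0 then s0 else len k else len k0 - s0.

Lemma split_len_gt0 k : 0 < split_len k.
Proof.
case/andP: hs => ? ?; case: k => [k|] /=; last by rewrite subr_gt0.
by case: ifP => // _; exact: len_gt0.
Qed.

Lemma split_vert_neq0 : (0 < #|{: option (vert H)}|)%N.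
Proof. by rewrite card_option. Qed.

Let adj := [rel u v : option (vert H) | [exists e,
   ((split_src e == u) && (split_tgt e == v)) || ((split_src e == v) && (split_tgt e == u))]].

Lemma split_connected u v : connect adj u v.
Proof.
have adjC : connect_sym adj.
  by apply: sym_connect_sym => x y /=; apply: eq_existsb => e; rewrite orbC.
have adj1 e : connect adj (split_src e) (split_tgt e).
  by apply: connect1; apply/existsP; exists e; rewrite !eqxx.
have step (e : edge H) : connect adj (Some (src e)) (Some (tgt e)).
  have [->|ek] := eqVneq e k0.
    have := adj1 (Some k0); rewrite /= eqxx => H1.
    exact: connect_trans H1 (adj1 None).
  by have := adj1 (Some e); rewrite /= (negbTE ek).
have SS x y : connect adj (Some x) (Some y).
  apply: (@graph_ind _ _ (fun z => connect adj (Some x) (Some z)) _ x) => // e.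
  split=> h; apply: connect_trans h _; first exact: step.
  by rewrite adjC; exact: step.
have NS y : connect adj None (Some y).
  exact: connect_trans (adj1 None) (SS _ _).
by case: u v => [u|] [v|] //; rewrite adjC.
Qed.

Definition split : metric_graph R :=
  MetricGraph split_len_gt0 split_vert_neq0 split_connected.

End Split.

Lemma big_option (R : nmodType) (T : finType) (P : pred (option T))
    (F : option T -> R) :
  \sum_(k | P k) F k =
  (if P None then F None else 0) + \sum_(k | P (Some k)) F (Some k).
Proof.
rewrite big_mkcond (bigD1 None) //=; congr (_ + _).
rewrite (reindex_omap Some id) => [|[]//]; rewrite [RHS]big_mkcond /=.
by apply: eq_bigl => k; rewrite eqxx.
Qed.

Section Subdivision.
Variables (R : realType) (G : metric_graph R).

Lemma sum_tangents_vertex (F : edge G -> R -> bool -> R) v :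
  \sum_(w in tangents (inl v : gpoint G)) F w.1 (base (inl v) w) w.2 =
  \sum_(k | src k == v) F k 0 true + \sum_(k | tgt k == v) F k (len k) false.
Proof.
rewrite (eq_bigl (fun w : edge G * bool =>
  ((if w.2 then src w.1 else tgt w.1) == v))); last by move=> w; rewrite inE.
rewrite big_mkcond /= -(pair_big xpredT xpredT (fun e b =>
  if (if b then src e else tgt e) == v
  then F e (if b then 0 else len e) b else 0)) /=.
rewrite (eq_bigr (fun e => (if src e == v then F e 0 true else 0) +
  (if tgt e == v then F e (len e) false else 0))) ?big_split /= -?big_mkcond //.
by move=> e _; rewrite big_bool /=.
Qed.

Lemma sum_tangents_interior (F : edge G -> R -> bool -> R) e s : 0 < s < len e ->
  \sum_(w in tangents (pt e s)) F w.1 (base (pt e s) w) w.2 =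
  F e s true + F e s false.
Proof.
move=> hs; rewrite (pt_interior hs) /=.
rewrite (eq_bigl (fun w : edge G * bool => (w.1 == e) && xpredT w.2));
  last by move=> w; rewrite inE andbT.
by rewrite -(pair_big_dep (fun e' => e' == e) (fun _ => xpredT)
  (fun e b => F e s b)) /= big_pred1_eq big_bool.
Qed.

(** [H], embedded in the space of points of [G], has the same points and the
    same metric as [G] but more vertices: the edge [k] of [H] is the part of
    the edge [sub_edge k] of [G] with parameters in
    [[sub_offset k, sub_offset k + len k]].  The last two fields belong to the
    record because they are obtained by splitting one edge after the other. *)
Record subdivision (H : metric_graph R) := Subdivision {
  sub_vert : vert H -> gpoint G;
  sub_edge : edge H -> edge G;
  sub_offset : edge H -> R;
  sub_vert_inj : injective sub_vert;
  sub_offset_ge0 : forall k, 0 <= sub_offset k;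
  sub_offset_le : forall k, sub_offset k + len k <= len (sub_edge k);
  sub_vert_src : forall k, sub_vert (src k) = pt (sub_edge k) (sub_offset k);
  sub_vert_tgt : forall k,
    sub_vert (tgt k) = pt (sub_edge k) (sub_offset k + len k);
  sub_interior : forall k u t, sub_offset k < t < sub_offset k + len k ->
    sub_vert u <> pt (sub_edge k) t;
  sub_disjoint : forall k k' t, sub_edge k = sub_edge k' ->
    sub_offset k < t < sub_offset k + len k ->
    sub_offset k' < t < sub_offset k' + len k' -> k = k';
  sub_cover : forall e t, 0 <= t <= len e -> exists2 k, sub_edge k = e &
    sub_offset k <= t <= sub_offset k + len k;
  sub_old_vert : forall v, exists u, sub_vert u = inl v;
  sub_directions : forall (F : edge G -> R -> bool -> R) u,
    \sum_(w in tangents (sub_vert u)) F w.1 (base (sub_vert u) w) w.2 =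
    \sum_(k | src k == u) F (sub_edge k) (sub_offset k) true +
    \sum_(k | tgt k == u) F (sub_edge k) (sub_offset k + len k) false;
  sub_sinusoidal : forall k, sinusoidal H k -> sinusoidal G k
}.

Lemma trivial_subdivision : subdivision G.
Proof.
apply: (@Subdivision G inl id (fun=> 0)) => //.
- by move=> u v [].
- by move=> k; rewrite add0r.
- by move=> k; rewrite pt0.
- by move=> k; rewrite add0r pt_len.
- by move=> k u t; rewrite add0r => /pt_interior_neq H /esym/H.
- by move=> e t ht; exists e; rewrite ?add0r.
- by move=> v; exists v.
- move=> F u; rewrite sum_tangents_vertex; congr (_ + _).
  by apply: eq_bigr => e _; rewrite add0r.
Defined.

(** [c] sends each edge of [H'] to the edge of [H] of which it is a part. *)
Definition refines (H : metric_graph R) (B : subdivision H)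
    (H' : metric_graph R) (B' : subdivision H') (c : edge H' -> edge H) : Prop :=
  [/\ forall u, exists u', sub_vert B' u' = sub_vert B u,
      forall k, [/\ sub_edge B' k = sub_edge B (c k),
        sub_offset B (c k) <= sub_offset B' k &
        sub_offset B' k + len k <= sub_offset B (c k) + len (c k)],
      forall j t, sub_offset B j <= t <= sub_offset B j + len j ->
        exists2 k, c k = j & sub_offset B' k <= t <= sub_offset B' k + len k &
      forall j, \sum_(k | c k == j) len k = len j].

Section SplitStep.
Variables (H : metric_graph R) (B : subdivision H) (k0 : edge H) (s0 : R).
Hypothesis hs : 0 < s0 < len k0.
Local Notation H' := (split hs).

Definition split_vert (u : vert H') : gpoint G :=
  if u is Some u then sub_vert B u else pt (sub_edge B k0) (sub_offset B k0 + s0).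
Definition split_edge (k : edge H') : edge G :=
  if k is Some k then sub_edge B k else sub_edge B k0.
Definition split_offset (k : edge H') : R :=
  if k is Some k then sub_offset B k else sub_offset B k0 + s0.

Let H'len_le (k : edge H) : @len R H' (Some k) <= len k.
Proof.
rewrite /= ; case: eqP => [->|//]; by case/andP: hs => _ /ltW.
Qed.

Let mid_interior : 0 < sub_offset B k0 + s0 < len (sub_edge B k0).
Proof.
have := sub_offset_ge0 B k0; have := sub_offset_le B k0; case/andP: hs.
by move=> *; apply/andP; split; lra.
Qed.

(** At the new vertex, of degree two, Kirchhoff's condition says that the function
    is differentiable, hence sinusoidal on the whole of [k0]. *)
Lemma split_sinusoidal k : sinusoidal H' k -> sinusoidal H k.
Proof.
move=> [x [d [h1 h2 h3]]].
have E1 : x (Some (tgt k0)) = x None * cos (k * (len k0 - s0)) +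
    d None * sin (k * (len k0 - s0)) := h1 None.
have E2 : x None = x (Some (src k0)) * cos (k * s0) + d (Some k0) * sin (k * s0).
  by have := h1 (Some k0); rewrite /= eqxx.
have E3 : d None + (x (Some (src k0)) * sin (k * s0) -
    d (Some k0) * cos (k * s0)) = 0.
  have := h2 None; rewrite !big_option /= add0r big1 ?addr0 //.
  rewrite (big_pred1 k0) /=; last by move=> e /=; case: (e =P k0).
  by rewrite eqxx.
have lE : k * len k0 = k * s0 + k * (len k0 - s0) by ring.
have dN : d None = d (Some k0) * cos (k * s0) - x (Some (src k0)) * sin (k * s0).
  by lra.
exists (fun v => x (Some v)), (fun e => d (Some e)); split.
- move=> e; have [->|ek] := eqVneq e k0.
    by rewrite E1 lE cosD sinD dN E2; ring.
  by have := h1 (Some e); rewrite /= (negbTE ek).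
- move=> v; have := h2 (Some v); rewrite !big_option /= add0r => H2; rewrite -[RHS]H2.
  congr (_ + _) => //; rewrite [LHS]big_mkcond (bigD1 k0) //=.
  rewrite [X in _ = _ + X]big_mkcond.
  rewrite [X in _ = _ + X](bigD1 k0) //= eqxx /= add0r; congr (_ + _).
    rewrite -[Some _ == Some v]/(tgt k0 == v); case: ifP => // _.
    by rewrite E2 dN lE sinD cosD; ring.
  by apply: eq_bigr => e /negbTE ->.
- case: h3 => [[[v|] xv]|[[e|] de]]; [by left; exists v| |by right; exists e|].
    have [xs|xs] := eqVneq (x (Some (src k0))) 0; last by left; exists (src k0).
    right; exists k0; apply: contraNneq xv => dk.
    by rewrite E2 xs dk !mul0r addr0.
  have [xs|xs] := eqVneq (x (Some (src k0))) 0; last by left; exists (src k0).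
  right; exists k0; apply: contraNneq de => dk.
  by rewrite dN xs dk !mul0r subr0.
Qed.

Lemma split_subdivision : exists B' : subdivision H',
  [/\ sub_vert B' = split_vert, sub_edge B' = split_edge &
      sub_offset B' = split_offset].
Proof.
have s0_gt : 0 < s0 by case/andP: hs.
have s0_lt : s0 < len k0 by case/andP: hs.
have midE u : sub_vert B u <> pt (sub_edge B k0) (sub_offset B k0 + s0).
  by apply: sub_interior; lra.
unshelve eexists; first apply: (@Subdivision H' split_vert split_edge split_offset);
  last by split.
- move=> [u|] [v|] //=.
  + by move/sub_vert_inj => ->.
  + by move/midE.
  + by move/esym/midE.
- by move=> [k|] /=; [exact: sub_offset_ge0|have := sub_offset_ge0 B k0; lra].
- move=> [k|] /=; last by have := sub_offset_le B k0; lra.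
  by have := H'len_le k; have := sub_offset_le B k; rewrite /=; lra.
- by move=> [k|] /=; rewrite ?sub_vert_src.
- move=> [k|] /=; last by rewrite sub_vert_tgt; congr (pt _ _); lra.
  by case: eqP => [->//|_] /=; rewrite sub_vert_tgt.
- move=> [k|] [u|] t /=.
  + move=> ht; apply: sub_interior.
    by have := H'len_le k; rewrite /=; lra.
  + move=> ht /(@pt_inj _ _ _ _ _ _ mid_interior).
    have := H'len_le k; have := sub_offset_ge0 B k; have := sub_offset_le B k.
    rewrite /= => h1 h2 h3 [|ek tE]; first lra.
    have kk : k0 = k.
      by apply: (@sub_disjoint _ B _ _ t) => //; rewrite -?tE; lra.
    by move: ht; rewrite -kk eqxx tE; lra.
  + by move=> ht; apply: sub_interior; lra.
  + move=> ht /(@pt_inj _ _ _ _ _ _ mid_interior).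
    have := sub_offset_ge0 B k0; have := sub_offset_le B k0.
    by move=> h1 h2 [|_ tE]; lra.
- move=> [k|] [k'|] t /= ek ht ht'; last by [].
  + congr Some; apply: (sub_disjoint ek (t := t)).
      by have := H'len_le k; rewrite /=; lra.
    by have := H'len_le k'; rewrite /=; lra.
  + have kk : k = k0.
      apply: (sub_disjoint ek (t := t)); last by lra.
      by have := H'len_le k; rewrite /=; lra.
    by exfalso; move: ht; rewrite kk eqxx; lra.
  + have kk : k0 = k'.
      apply: (sub_disjoint ek (t := t)); first by lra.
      by have := H'len_le k'; rewrite /=; lra.
    by exfalso; move: ht'; rewrite -kk eqxx; lra.
- move=> e t /(sub_cover B)[k ke ht].
  have [kk|kk] := eqVneq k k0; last by exists (Some k) => //=; rewrite (negbTE kk).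
  have [tm|tm] := leP t (sub_offset B k0 + s0).
    by exists (Some k) => //=; rewrite kk eqxx -kk; move: tm ht; rewrite kk; lra.
  by exists None => /=; [rewrite -kk|move: ht; rewrite kk; lra].
- by move=> v; have [u uE] := sub_old_vert B v; exists (Some u).
- move=> F [u|] /=; last first.
    rewrite sum_tangents_interior //.
    rewrite !big_option /= add0r big1 ?addr0 //; congr (_ + _).
    rewrite (big_pred1 k0) /=; last by move=> k /=; case: (k =P k0).
    by rewrite eqxx.
  rewrite sub_directions !big_option /= add0r; congr (_ + _).
  have -> : sub_offset B k0 + s0 + (len k0 - s0) = sub_offset B k0 + len k0 by ring.
  rewrite [LHS]big_mkcond (bigD1 k0) //=; congr (_ + _).
  rewrite -big_mkcondr [RHS]big_mkcond [LHS]big_mkcond /=.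
  apply: eq_bigr => k _; case: (k =P k0) => //= _.
- by move=> k /split_sinusoidal; exact: sub_sinusoidal.
Qed.

Lemma split_refines : exists (B' : subdivision H') (c : edge H' -> edge H),
  refines B B' c /\
  exists u, sub_vert B' u = pt (sub_edge B k0) (sub_offset B k0 + s0).
Proof.
have [B' [vE eE oE]] := split_subdivision.
exists B', (odflt k0); split; last by exists None; rewrite vE.
split; rewrite ?vE ?eE ?oE.
- by move=> u; exists (Some u).
- case/andP: hs => s0_gt s0_lt; case => [k|] /=; last by split => //; lra.
  by split => //; have := H'len_le k; rewrite /=; lra.
- move=> j t ht; have [kk|kk] := eqVneq j k0.
    have [tm|tm] := leP t (sub_offset B k0 + s0).
      by exists (Some j) => //=; move: ht; rewrite kk eqxx; lra.
    by exists None => //=; move: ht; rewrite kk; lra.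
  by exists (Some j) => //=; rewrite (negbTE kk).
- move=> j; rewrite big_option /= (big_pred1 j) //=.
  by rewrite eq_sym; case: eqP => [->|_]; rewrite ?add0r//; lra.
Qed.

End SplitStep.

Lemma refinement_at (P : seq (gpoint G)) (H : metric_graph R)
    (B : subdivision H) :
  exists (H' : metric_graph R) (B' : subdivision H') (c : edge H' -> edge H),
  refines B B' c /\ forall p, p \in P -> exists u, sub_vert B' u = p.
Proof.
elim: P H B => [|p P IH] H B.
  exists H, B, id; split => //; split => //.
  - by move=> u; exists u.
  - by move=> j t ht; exists j.
  - by move=> j; rewrite (big_pred1 j).
have [[u up]|np] := pselect (exists u, sub_vert B u = p).
  have [H' [B' [c [rB PB]]]] := IH H B; exists H', B', c; split => // q.
  rewrite inE => /predU1P[->|/PB//]; case: rB => /(_ u)[u' u'E] _ _ _.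
  by exists u'; rewrite u'E.
have [k [s [hs ps]]] : exists k s, 0 < s < len k /\
    pt (sub_edge B k) (sub_offset B k + s) = p.
  case: p np => [v|x] np.
    by case: np; have [u uv] := sub_old_vert B v; exists u.
  have /andP[x0 xl] := valP x.
  have [|k ke ht] := @sub_cover _ B (val x).1 (val x).2; first by rewrite !ltW.
  exists k, ((val x).2 - sub_offset B k).
  have -> : sub_offset B k + ((val x).2 - sub_offset B k) = (val x).2 by ring.
  rewrite ke pt_val; split => //; case/andP: ht => h1 h2.
  apply/andP; split; rewrite lt_neqAle; (apply/andP; split; last lra).
    apply/eqP => h; apply: np; exists (src k).
    by rewrite sub_vert_src -(pt_val x) ke; congr pt; lra.
  apply/eqP => h; apply: np; exists (tgt k).
  by rewrite sub_vert_tgt -(pt_val x) ke; congr pt; lra.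
have [B1 [c1 [[q1 q2 q3 q4] [u1 u1E]]]] := split_refines B hs.
have [H' [B' [c [[r1 r2 r3 r4] PB]]]] := IH _ B1.
exists H', B', (c1 \o c); split; last first.
  move=> q; rewrite inE => /predU1P[->|/PB//].
  by have [u uE] := r1 u1; exists u; rewrite uE u1E.
split.
- by move=> u; have [u' <-] := q1 u; exact: r1.
- move=> j; have [h1 h2 h3] := r2 j; have [h1' h2' h3'] := q2 (c j).
  by rewrite h1 h1' (le_trans h2' h2) (le_trans h3 h3').
- by move=> j t /q3[i <- /r3[l <- lt]]; exists l.
- move=> j; rewrite -q4 (partition_big c (fun i => c1 i == j)) //=.
  apply: eq_bigr => i ij; rewrite -[RHS](r4 i); apply: eq_bigl => l.
  by rewrite /=; case: (c l =P i) => [->|_]; rewrite ?ij ?andbT ?andbF.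
Qed.

End Subdivision.

(** * Distance and volume on a graph with edge lengths *)

Section Darts.
Variables (R : realType) (H : metric_graph R).

Definition org (w : edge H * bool) := if w.2 then src w.1 else tgt w.1.
Definition dst (w : edge H * bool) := if w.2 then tgt w.1 else src w.1.
Definition degree (u : vert H) : nat := #|[pred w | org w == u]|.

Lemma sum_darts (F : edge H * bool -> R) :
  \sum_w F w = \sum_k (F (k, true) + F (k, false)).
Proof.
rewrite (eq_bigr (fun w => F (w.1, w.2))); last by case.
rewrite -(pair_bigA _ (fun k b => F (k, b))) /=.
by apply: eq_bigr => k _; rewrite big_bool.
Qed.

Lemma sum_darts_org (F : edge H * bool -> R) :
  \sum_u \sum_(w | org w == u) F w = \sum_k (F (k, true) + F (k, false)).
Proof. by rewrite -sum_darts [RHS](partition_big org xpredT). Qed.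

End Darts.

Section Distance.
Variables (R : realType) (H : metric_graph R) (S : pred (vert H)).

Definition edge_lip (F : vert H -> R) :=
  forall e, `|F (tgt e) - F (src e)| <= len e.

Definition subdistance (F : vert H -> R) :=
  edge_lip F /\ forall s, S s -> F s <= 0.

(** The largest of the 1-Lipschitz functions which are nonpositive on [S]: this
    definition needs no paths, and maximality provides the geodesics. *)
Definition dist_to (u : vert H) : R := sup [set F u | F in subdistance].

Hypothesis S_neq0 : exists s, S s.

Lemma subdistance_sup u : has_sup [set F u | F in subdistance].
Proof.
split; first by exists 0, (fun=> 0) => //; split => // e; rewrite subrr normr0 ltW// len_gt0.
have [s Ss] := S_neq0.
suff: exists B, forall F, subdistance F -> F u <= B.
  by case=> B hB; exists B => _ [F /hB FB <-].
apply: (@graph_ind _ H (fun u => exists B, forall F, subdistance F -> F u <= B) _ s).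
  move=> e; split=> -[B hB]; exists (B + len e) => F hF;
    have := hB F hF; have := hF.1 e; rewrite ler_norml; lra.
by exists 0 => F hF; exact: hF.2.
Qed.

Lemma dist_to_ge F u : subdistance F -> F u <= dist_to u.
Proof. by move=> hF; apply: ub_le_sup; [exact: (subdistance_sup u).2|exists F]. Qed.

Lemma dist_to_le u B : (forall F, subdistance F -> F u <= B) -> dist_to u <= B.
Proof.
move=> hB; apply: ge_sup; first exact: (subdistance_sup u).1.
by move=> _ [F hF <-]; exact: hB.
Qed.

Lemma dist_to_ge0 u : 0 <= dist_to u.
Proof.
apply: (@dist_to_ge (fun=> 0)); split => // e.
by rewrite subrr normr0 ltW// len_gt0.
Qed.

Lemma dist_to0 s : S s -> dist_to s = 0.
Proof.
move=> Ss; apply/eqP; rewrite eq_le dist_to_ge0 andbT.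
by apply: dist_to_le => F hF; exact: hF.2.
Qed.

Lemma dist_to_lip : edge_lip dist_to.
Proof.
move=> e; rewrite ler_norml; apply/andP; split.
  rewrite lerBrDr addrC lerBlDr; apply: dist_to_le => F hF.
  by have := dist_to_ge (tgt e) hF; have := hF.1 e; rewrite ler_norml; lra.
rewrite lerBlDr; apply: dist_to_le => F hF.
by have := dist_to_ge (src e) hF; have := hF.1 e; rewrite ler_norml; lra.
Qed.

Lemma dist_to_dart w : dist_to (org w) <= dist_to (dst w) + len w.1.
Proof.
by have := dist_to_lip w.1; rewrite ler_norml /org /dst; case: w.2; lra.
Qed.

(** Otherwise the largest subdistance could be increased at [u]. *)
Lemma dist_to_parent u : ~~ S u ->
  exists2 w, org w = u & dist_to u = dist_to (dst w) + len w.1.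
Proof.
move=> Su; apply: contrapT => H0.
have lt w : org w = u -> dist_to u < dist_to (dst w) + len w.1.
  move=> wu; rewrite lt_neqAle -{2}wu dist_to_dart andbT; apply/eqP => h.
  by apply: H0; exists w.
pose eps := \big[Order.min/(1 : R)]_(w | org w == u)
  (dist_to (dst w) + len w.1 - dist_to u).
have eps0 : 0 < eps by apply: lt_bigmin => // w /eqP /lt; rewrite subr_gt0.
have epsle w : org w = u -> eps <= dist_to (dst w) + len w.1 - dist_to u.
  by move=> wu; apply: bigmin_le_cond; rewrite wu.
pose F x := dist_to x + (if x == u then eps else 0).
have hF : subdistance F.
  split; last first.
    move=> s Ss; rewrite /F dist_to0 //; case: eqP => [su|_]; last by rewrite addr0.
    by move: Su; rewrite -su Ss.
  move=> e; have := dist_to_lip e; rewrite !ler_norml /F => hl.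
  have [su|su] := eqVneq (src e) u; have [tu|tu] := eqVneq (tgt e) u.
  - lra.
  - by have := epsle (e, true) su; rewrite /dst /= -su; lra.
  - by have := epsle (e, false) tu; rewrite /dst /= -tu; lra.
  - lra.
by have := dist_to_ge u hF; rewrite /F eqxx; lra.
Qed.

Let near R0 k := dist_to (src k) + dist_to (tgt k) + len k <= 2 * R0.

(** Seen from [S], every edge is travelled from both of its ends up to the
    middle of the part which is not covered by going through the other end;
    a dart counts for [+1] if it moves away from [S] and for [-1] otherwise. *)
Let sgn w : R := if dist_to (org w) == dist_to (dst w) + len w.1 then -1 else 1.

Lemma near_edges_le R0 : 0 <= R0 ->
  \sum_(k | near R0 k) len k <=
  \sum_u Num.max 0 (R0 - dist_to u) * \sum_(w | org w == u) sgn w.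
Proof.
move=> R00.
have -> : \sum_u Num.max 0 (R0 - dist_to u) * \sum_(w | org w == u) sgn w =
  \sum_u \sum_(w | org w == u) Num.max 0 (R0 - dist_to (org w)) * sgn w.
  apply: eq_bigr => u _; rewrite mulr_sumr; apply: eq_bigr => w /eqP wu.
  by rewrite wu.
rewrite sum_darts_org big_mkcond; apply: ler_sum => k _.
rewrite /sgn /org /dst /near /=.
have := len_gt0 k; have := dist_to_lip k; rewrite ler_norml.
move: (dist_to (src k)) (dist_to (tgt k)) (len k) => a b l ab l0.
case: ifP => H1; case: (a =P b + l) => H2; case: (b =P a + l) => H3;
 case: (leP 0 (R0 - a)) => H4; case: (leP 0 (R0 - b)) => H5; move: H1; lra.
Qed.

Lemma sum_sgn_le (u : vert H) : \sum_(w | org w == u) sgn w <= (degree u)%:R.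
Proof.
rewrite /degree -sum1_card natr_sum; apply: ler_sum => w _.
by rewrite /sgn; case: ifP => _ //; lra.
Qed.

Lemma sum_sgn_le2 (u : vert H) : ~~ S u -> \sum_(w | org w == u) sgn w <= (degree u)%:R - 2.
Proof.
move=> Su; have [w0 w0u h] := dist_to_parent Su.
rewrite /degree -sum1_card natr_sum (bigD1 w0) /=; last by rewrite w0u.
rewrite [X in _ <= X - _](bigD1 w0) /=; last by rewrite inE w0u.
have -> : sgn w0 = -1 by rewrite /sgn w0u -h eqxx.
have : \sum_(i | (org i == u) && (i != w0)) sgn i <=
  \sum_(i in [pred w | org w == u] | i != w0) 1%:R :> R.
  by apply: ler_sum => w _; rewrite /sgn; case: ifP => _ //; lra.
lra.
Qed.

(** In [near_edges_le], the radius [R0 - dist_to u] left at [u] is multiplied by the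
    number of darts from [u] away from [S], minus the number of those towards [S].
    There is one of the latter outside of [S], so that a vertex of degree two does
    not contribute: only [S] and the branching vertices near it do. *)
Lemma near_volume (V : pred (vert H)) (dmax : nat) R0 : 0 <= R0 ->
  (forall u : vert H, ~~ V u -> degree u = 2%N) ->
  (forall u : vert H, dist_to u < R0 -> (degree u <= dmax)%N) ->
  \sum_(k | near R0 k) len k <=
  R0 * dmax%:R * (#|S|%:R + #|[pred v | V v && (dist_to v < R0)]|%:R).
Proof.
move=> R00 hV hd; apply: le_trans (near_edges_le R00) _.
have -> : R0 * dmax%:R * (#|S|%:R + #|[pred v | V v && (dist_to v < R0)]|%:R) =
  \sum_u ((if u \in S then R0 * dmax%:R else 0) +
   (if V u && (dist_to u < R0) then R0 * dmax%:R else 0)).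
  rewrite big_split /= -!big_mkcond /= !sumr_const; move: (R0 * _) => c.
  by rewrite mulrDr !mulr_natr.
apply: ler_sum => u _.
have Rd0 : 0 <= R0 * dmax%:R by rewrite mulr_ge0.
have mle : Num.max 0 (R0 - dist_to u) <= R0.
  by rewrite ge_max R00 lerBlDr lerDl dist_to_ge0.
have m0 : 0 <= Num.max 0 (R0 - dist_to u) by rewrite le_max lexx.
have bnd : Num.max 0 (R0 - dist_to u) * \sum_(w | org w == u) sgn w <= R0 * dmax%:R.
  case: (ltP (dist_to u) R0) => uR; last first.
    by have -> : Num.max 0 (R0 - dist_to u) = 0;
      [apply/max_idPl; rewrite subr_le0 | rewrite mul0r].
  apply: (@le_trans _ _ (Num.max 0 (R0 - dist_to u) * dmax%:R)).
    apply: ler_wpM2l => //; apply: le_trans (sum_sgn_le u) _.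
    by rewrite ler_nat hd.
  by apply: ler_wpM2r.
rewrite -[u \in S]/(S u).
case: (boolP (S u)) => Su.
  by apply: le_trans bnd _; rewrite lerDl; case: ifP.
rewrite add0r; case: (boolP (V u)) => Vu /=.
  case: ltP => // hR; have -> : Num.max 0 (R0 - dist_to u) = 0.
    by apply/max_idPl; rewrite subr_le0.
  by rewrite mul0r.
apply: mulr_ge0_le0 => //; apply: le_trans (sum_sgn_le2 Su) _.
by rewrite (hV _ Vu); lra.
Qed.

(** The geodesic from [u] to [S] lies in the edges closer to [S] than [u]. *)
Lemma ball_volume_ge u :
  dist_to u <= \sum_(k | (dist_to (src k) <= dist_to u) &&
                         (dist_to (tgt k) <= dist_to u)) len k.
Proof.
apply: (finite_real_ind (f := dist_to) (P := fun u => dist_to u <=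
  \sum_(k | (dist_to (src k) <= dist_to u) && (dist_to (tgt k) <= dist_to u)) len k)).
move=> {}u IH; case: (boolP (S u)) => Su.
  by rewrite dist_to0 //; apply: sumr_ge0 => k _; rewrite ltW// len_gt0.
have [[k b] wu h] := dist_to_parent Su; have /= l0 := len_gt0 k.
rewrite /= in h.
have lt : dist_to (dst (k, b)) < dist_to u by rewrite h; lra.
have := IH _ lt => IH1; rewrite {1}h.
rewrite (bigD1 k) /=; last by move: wu lt; rewrite /org /dst /=; case: (b) => <-; lra.
rewrite [leLHS]addrC lerD2l; apply: le_trans IH1 _.
rewrite [leLHS]big_mkcond [leRHS]big_mkcond; apply: ler_sum => j _.
case: ifP => [/andP[h1 h2]|_]; last by case: ifP => // _; rewrite ltW// len_gt0.
rewrite ifT // (le_trans h1 (ltW lt)) (le_trans h2 (ltW lt)) /=.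
apply/eqP => jk; move: wu lt h1 h2; rewrite jk /org /dst /=.
by case: (b) => <-; lra.
Qed.

End Distance.

Section PointDistance.
Variables (R : realType) (H : metric_graph R).
Implicit Types (u v w : vert H).

Definition vdist v u : R := dist_to (pred1 v) u.

Let ex1 v : exists s, pred1 v s. Proof. by exists v; exact: eqxx. Qed.

Lemma vdistxx v : vdist v v = 0.
Proof. exact: (dist_to0 (ex1 v) (eqxx v)). Qed.

Lemma vdist_sym v u : vdist v u = vdist u v.
Proof.
suff le a b : vdist a b <= vdist b a by apply/eqP; rewrite eq_le !le.
have : subdistance (pred1 b) (fun x => vdist a b - vdist a x).
  split=> [e|s /eqP ->]; last by rewrite subrr.
  have -> : vdist a b - vdist a (tgt e) - (vdist a b - vdist a (src e)) =
    vdist a (src e) - vdist a (tgt e) by ring.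
  by rewrite distrC; exact: dist_to_lip (ex1 a) e.
by move/(dist_to_ge (ex1 b)) => /(_ a); rewrite vdistxx subr0.
Qed.

Lemma vdist_triangle w v u : vdist v u <= vdist v w + vdist w u.
Proof.
have : subdistance (pred1 w) (fun x => vdist v x - vdist v w).
  split=> [e|s /eqP ->]; last by rewrite subrr.
  by rewrite opprB addrA subrK; exact: dist_to_lip (ex1 v) e.
by move/(dist_to_ge (ex1 w)) => /(_ u); rewrite lerBlDl.
Qed.

Lemma vdist_dart (a : edge H * bool) : vdist (dst a) (org a) <= len a.1.
Proof.
have := dist_to_dart (ex1 (dst a)) a.
by rewrite -/(vdist _ _) -/(vdist (dst a) (dst a)) vdistxx add0r.
Qed.

(** The point of [S] is found by following parents. *)
Lemma dist_to_attained (S : pred (vert H)) u : (exists s, S s) ->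
  exists2 s, S s & vdist s u <= dist_to S u.
Proof.
move=> S0; apply: (finite_real_ind (f := dist_to S)
  (P := fun u => exists2 s, S s & vdist s u <= dist_to S u)) => {}u IH.
have [Su|Su] := boolP (S u); first by exists u; rewrite // vdistxx dist_to_ge0.
have [w wu h] := dist_to_parent S0 Su.
have [|s Ss hs] := IH (dst w); first by rewrite h ltrDl len_gt0.
exists s => //; apply: le_trans (vdist_triangle (dst w) _ _) _.
by rewrite h -wu lerD // vdist_dart.
Qed.

(** When the edges are short, geodesics have vertices almost everywhere. *)
Lemma geodesic_point v u x eta : 0 < eta -> (forall k : edge H, len k <= eta) ->
  0 <= x <= vdist v u ->
  exists w, [/\ x <= vdist v w, vdist v w < x + eta &
                vdist w u <= vdist v u - vdist v w].
Proof.
move=> eta0 heta; move=> /andP[x0]; move: u.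
apply: (finite_real_ind (f := vdist v)) => u IH hx.
have [hu|hu] := ltP (vdist v u) (x + eta).
  by exists u; rewrite vdistxx subrr.
have [uv|uv] := eqVneq u v.
  by move: hu; rewrite uv vdistxx; lra.
have [w wu h] := dist_to_parent (ex1 v) uv; rewrite -/(vdist _ _) -/(vdist v (dst w)) in h.
have lw := len_gt0 w.1; have ew := heta w.1.
have [||z [z1 z2 z3]] := IH (dst w); [lra|lra|].
exists z; split => //.
by have := vdist_triangle (dst w) z u; have := vdist_dart w; rewrite wu; lra.
Qed.

(** The edges of a geodesic from [v] to [u]; each inner vertex [w] of the
    geodesic belongs to two of its darts. *)
Lemma geodesic v u : exists (A : {set vert H}) (B : {set edge H}),
  [/\ v \in A /\ u \in A,
      forall w, w \in A -> w != u -> vdist v w < vdist v u,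
      forall k, k \in B -> src k \in A /\ tgt k \in A,
      \sum_(k in B) len k = vdist v u &
      (forall w, w \in A -> w != v -> w != u ->
        (2 <= #|[pred a | (org a == w) && (a.1 \in B)]|)%N) /\
      (u != v -> (1 <= #|[pred a | (org a == u) && (a.1 \in B)]|)%N)].
Proof.
move: u; apply: (finite_real_ind (f := vdist v)) => u IH.
have [uv|uv] := eqVneq u v.
  exists [set v]%SET, finset.set0; rewrite uv inE eqxx; split => //.
  - by move=> w; rewrite inE => ->.
  - by move=> k; rewrite finset.in_set0.
  - by rewrite finset.big_set0 vdistxx.
  - by split => // w; rewrite inE => ->.
have [a au h] := dist_to_parent (ex1 v) uv; rewrite -/(vdist _ _) -/(vdist v (dst a)) in h.
have la := len_gt0 a.1.
have [|A [B [[vA wA] A_lt BA lB [B2 B1]]]] := IH (dst a); first lra.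
have A_le w : w \in A -> vdist v w <= vdist v (dst a).
  by move=> /A_lt H1; have [->//|/H1/ltW] := eqVneq w (dst a).
have uA : u \notin A by apply/negP => /A_le; lra.
have aB : a.1 \notin B.
  apply/negP => /BA [h1 h2]; move: uA; rewrite -au /org.
  by case: ifP => _; rewrite ?h1 ?h2.
pose B' := (a.1 |: B)%SET.
have sub w : (#|[pred x : edge H * bool | (org x == w) && (x.1 \in B)]| <=
    #|[pred x : edge H * bool | (org x == w) && (x.1 \in B')]|)%N.
  apply: subset_leq_card; apply/fintype.subsetP => x; rewrite !inE => /andP[-> ->].
  by rewrite orbT.
exists (u |: A)%SET, B'; split.
- by rewrite !inE vA eqxx orbT.
- by move=> w; rewrite !inE => /orP[->//|/A_le ? _]; lra.
- move=> k; rewrite !inE => /predU1P[->|/BA[-> ->]]; last by rewrite !orbT.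
  move: wA au; rewrite /org /dst; case: ifP => _ h1 h2; rewrite -h2 h1 eqxx ?orbT //.
- by rewrite big_setU1 //= lB h addrC.
- split=> [w|_]; last first.
    by apply/card_gt0P; exists a; rewrite !inE au !eqxx.
  rewrite !inE => /predU1P[->|wA' wv wu]; first by rewrite eqxx.
  have [wa|wa] := eqVneq w (dst a); last exact: leq_trans (B2 _ wA' wv wa) (sub w).
  have dv : dst a != v by rewrite -wa.
  rewrite wa; apply: leq_ltn_trans (B1 dv) _; apply: proper_card; apply/properP; split.
    apply/fintype.subsetP => x; rewrite !inE => /andP[-> ->]; by rewrite orbT.
  exists (a.1, ~~ a.2); rewrite !inE /= ?eqxx ?(negbTE aB) ?andbF //.
  by rewrite /org /dst /=; case: a.2; rewrite /= eqxx.
Qed.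

End PointDistance.

(** * Singular forms in a family of quadratic forms *)

Section Crossing.
Variables (R : realType) (T : finType) (M : R -> T -> T -> R).
Implicit Types (x y : T -> R) (k : R).

Definition bil k x y : R := \sum_i \sum_j M k i j * (x i * y j).
Definition dot x y : R := \sum_i x i * y i.
Definition app k x i : R := \sum_j M k i j * x j.

(** An orthonormal basis of a plane on which the quadratic form of [M k] is
    nonpositive. *)
Definition nonpos_frame k x y := [/\ dot x x = 1, dot y y = 1, dot x y = 0 &
  forall a b, let z i := a * x i + b * y i in bil k z z <= 0].

Hypothesis M_sym : forall k i j, M k i j = M k j i.
Hypothesis M_continuous : forall i j, continuous (fun k => M k i j).

Lemma eq_bil k x x' y y' : x =1 x' -> y =1 y' -> bil k x y = bil k x' y'.
Proof.
by move=> xE yE; apply: eq_bigr => i _; apply: eq_bigr => j _; rewrite xE yE.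
Qed.

Lemma bil_sym k x y : bil k x y = bil k y x.
Proof.
rewrite /bil exchange_big; apply: eq_bigr => i _; apply: eq_bigr => j _.
by rewrite M_sym [x j * _]mulrC.
Qed.

Lemma bil_comb k a b x y (z : T -> R) :
  bil k (fun i => a * x i + b * y i) z = a * bil k x z + b * bil k y z.
Proof.
rewrite /bil !mulr_sumr -big_split; apply: eq_bigr => i _ /=.
by rewrite !mulr_sumr -big_split; apply: eq_bigr => j _ /=; ring.
Qed.

Lemma bil_comb2 k a b x y : let z i := a * x i + b * y i in
  bil k z z = a ^+ 2 * bil k x x + 2 * a * b * bil k x y + b ^+ 2 * bil k y y.
Proof.
move=> z; rewrite bil_comb ![bil k _ z]bil_sym !bil_comb [bil k y x]bil_sym; ring.
Qed.

Lemma dot_comb a b x y (z : T -> R) :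
  dot (fun i => a * x i + b * y i) z = a * dot x z + b * dot y z.
Proof.
by rewrite /dot !mulr_sumr -big_split; apply: eq_bigr => i _ /=; ring.
Qed.

Lemma dot_sym x y : dot x y = dot y x.
Proof. by apply: eq_bigr => i _; rewrite mulrC. Qed.

Lemma dot_ge0 x : 0 <= dot x x.
Proof. by apply: sumr_ge0 => i _; rewrite -expr2 sqr_ge0. Qed.

Lemma dot_gt0 x i : x i != 0 -> 0 < dot x x.
Proof.
move=> xi; rewrite /dot (bigD1 i) //= ltr_pwDl //.
  by rewrite -expr2 exprn_even_gt0.
by apply: sumr_ge0 => j _; rewrite -expr2 sqr_ge0.
Qed.

Lemma bil_app k x y : bil k x y = dot (app k y) x.
Proof.
rewrite /bil /dot /app; apply: eq_bigr => i _; rewrite mulr_suml.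
by apply: eq_bigr => j _; ring.
Qed.

Lemma bil_le k x : bil k x x <= (\sum_i \sum_j `|M k i j|) * dot x x.
Proof.
rewrite /bil mulr_suml; apply: ler_sum => i _; rewrite mulr_suml; apply: ler_sum => j _.
apply: le_trans (ler_norm _) _; rewrite normrM; apply: ler_wpM2l => //.
have le1 l : x l ^+ 2 <= dot x x.
  rewrite /dot (bigD1 l) //= -expr2 lerDl; apply: sumr_ge0 => m _.
  by rewrite -expr2 sqr_ge0.
have := le1 i; have := le1 j; rewrite ler_norml.
have := sqr_ge0 (x i - x j); have := sqr_ge0 (x i + x j).
by move: (x i) (x j) (dot x x) => a b c; lra.
Qed.

Lemma dot_eq0 x : dot x x = 0 -> forall i, x i = 0.
Proof.
move=> x0 i; apply/eqP; apply: contraPT x0 => /dot_gt0 h; apply/eqP.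
by rewrite gt_eqF.
Qed.

(** The Gram-Schmidt process. *)
Lemma nonpos_frame_exists k x y :
  (forall a b, let z i := a * x i + b * y i in bil k z z <= 0) ->
  (forall a b, (a != 0) || (b != 0) -> exists i, a * x i + b * y i != 0) ->
  exists x' y', nonpos_frame k x' y'.
Proof.
move=> hq free.
have nx : 0 < dot x x.
  have [|i] := free 1 0; first by rewrite oner_eq0.
  by rewrite mul1r mul0r addr0; exact: dot_gt0.
pose c := dot x y / dot x x.
pose z i := - c * x i + 1 * y i.
have nz : 0 < dot z z.
  have [|i] := free (- c) 1; first by rewrite oner_eq0 orbT.
  by exact: (@dot_gt0 z i).
have xz : dot x z = 0.
  by rewrite dot_sym dot_comb mul1r [dot y x]dot_sym mulNr divfK ?gt_eqF// addNr.
pose s := (Num.sqrt (dot x x))^-1; pose t := (Num.sqrt (dot z z))^-1.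
have ss : s ^+ 2 * dot x x = 1.
  by rewrite exprVn sqr_sqrtr ?ltW// mulVf ?gt_eqF.
have tt : t ^+ 2 * dot z z = 1.
  by rewrite exprVn sqr_sqrtr ?ltW// mulVf ?gt_eqF.
have dotZ a b u v : dot (fun i => a * u i) (fun i => b * v i) = a * b * dot u v.
  by rewrite /dot mulr_sumr; apply: eq_bigr => i _; ring.
exists (fun i => s * x i), (fun i => t * z i); split; rewrite ?dotZ -?expr2 //.
  by rewrite xz mulr0.
move=> a b /=.
have := hq (a * s - b * t * c) (b * t).
rewrite /= (eq_bil _ (x' := fun i => a * (s * x i) + b * (t * z i))
   (y' := fun i => a * (s * x i) + b * (t * z i))) // => i; rewrite /z; ring.
Qed.

Section MinimalFrame.
Variable K : R.
Hypotheses (K0 : 0 < K) (frameK : exists x y, nonpos_frame K x y).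

(* A triple (k, x, y) is encoded as a row vector. *)
Let N := #|T|.
Let V := 'rV[R]_(1 + (N + N)).
Let ck (z : V) : R := z 0 (lshift (N + N) 0).
Let cx (z : V) (i : T) : R := z 0 (rshift 1 (lshift N (enum_rank i))).
Let cy (z : V) (i : T) : R := z 0 (rshift 1 (rshift N (enum_rank i))).
Let enc (k : R) (x y : T -> R) : V := row_mx (\row__ k)
  (row_mx (\row_i x (enum_val i)) (\row_i y (enum_val i))).

Let ckE k x y : ck (enc k x y) = k.
Proof. by rewrite /ck /enc row_mxEl mxE. Qed.
Let cxE k x y : cx (enc k x y) =1 x.
Proof. by move=> i; rewrite /cx /enc row_mxEr row_mxEl mxE enum_rankK. Qed.
Let cyE k x y : cy (enc k x y) =1 y.
Proof. by move=> i; rewrite /cy /enc row_mxEr row_mxEr mxE enum_rankK. Qed.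

Let ck_cont : continuous ck. Proof. exact: coord_continuous. Qed.
Let cx_cont i : continuous (cx^~ i). Proof. exact: coord_continuous. Qed.
Let cy_cont i : continuous (cy^~ i). Proof. exact: coord_continuous. Qed.

Let sum_cont (U : topologicalType) (I : finType) (F : I -> U -> R) :
  (forall i, continuous (F i)) -> continuous (fun z => \sum_i F i z).
Proof.
by move=> h; apply: continuous_big => //; exact: add_continuous.
Qed.

Let mul_cont (U : topologicalType) (f g : U -> R) :
  continuous f -> continuous g -> continuous (fun z => f z * g z).
Proof. by move=> hf hg z; apply: continuousM; [exact: hf|exact: hg]. Qed.

Let add_cont (U : topologicalType) (f g : U -> R) :
  continuous f -> continuous g -> continuous (fun z => f z + g z).
Proof. by move=> hf hg z; apply: continuousD; [exact: hf|exact: hg]. Qed.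

Let dot_cont (u v : V -> T -> R) : (forall i, continuous (fun z => u z i)) ->
  (forall i, continuous (fun z => v z i)) -> continuous (fun z => dot (u z) (v z)).
Proof. by move=> hu hv; apply: sum_cont => i; exact: mul_cont. Qed.

Let bil_cont (u : V -> T -> R) : (forall i, continuous (fun z => u z i)) ->
  continuous (fun z => bil (ck z) (u z) (u z)).
Proof.
move=> hu; apply: sum_cont => i; apply: sum_cont => j; apply: mul_cont.
  by move=> z; apply: (@continuous_comp _ _ _ ck (fun k => M k i j));
    [exact: ck_cont|exact: M_continuous].
exact: mul_cont.
Qed.

Let frames : set V := [set z | 0 <= ck z <= K /\ nonpos_frame (ck z) (cx z) (cy z)].

Let frames_compact : compact frames.
Proof.
pose box := [set z : V | forall i, `[- (K + 1), K + 1]%classic (z ord0 i)].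
apply: (@subclosed_compact _ _ box).
- have cl (f : V -> R) (A : set R) : continuous f -> closed A -> closed (f @^-1` A).
    by move=> /continuous_closedP; apply.
  have -> : frames = ck @^-1` [set y | 0 <= y] `&` (ck @^-1` [set y | y <= K] `&`
    ((fun z => dot (cx z) (cx z)) @^-1` [set y | y = 1] `&`
    ((fun z => dot (cy z) (cy z)) @^-1` [set y | y = 1] `&`
    ((fun z => dot (cx z) (cy z)) @^-1` [set y | y = 0] `&`
    \bigcap_(ab in [set: R * R])
      (fun z => bil (ck z) (fun i => ab.1 * cx z i + ab.2 * cy z i)
        (fun i => ab.1 * cx z i + ab.2 * cy z i)) @^-1` [set y | y <= 0])))).
    apply/seteqP; split => z /=.
      by move=> [/andP[? ?] [? ? ? h]]; do 5!split => //; move=> [a b] _; exact: h.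
    move=> [? [? [? [? [? h]]]]]; split; first by apply/andP.
    by split => // a b; exact: (h (a, b)).
  apply: closedI; first by apply: cl => //; exact: closed_ge.
  apply: closedI; first by apply: cl => //; exact: closed_le.
  apply: closedI; first by apply: cl; [exact: dot_cont|exact: closed_eq].
  apply: closedI; first by apply: cl; [exact: dot_cont|exact: closed_eq].
  apply: closedI; first by apply: cl; [exact: dot_cont|exact: closed_eq].
  apply: closed_bigI => -[a b] _ /=; apply: cl; last exact: closed_le.
  apply: bil_cont => i; apply: add_cont; apply: mul_cont => //; exact: cst_continuous.
- apply: (@rV_compact _ _ (fun=> `[- (K + 1), K + 1]%classic)) => i.
  exact: segment_compact.
- move=> z [/andP[k0 kK] [xx yy _ _]] i /=; rewrite in_itv /=.
  have le1 x j : dot x x = 1 -> - (K + 1) <= x j <= K + 1.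
    rewrite /dot (bigD1 j) //= => h.
    have h0 : 0 <= \sum_(i0 | i0 != j) x i0 * x i0.
      by apply: sumr_ge0 => l _; rewrite -expr2 sqr_ge0.
    by move: (x j) h h0 => a; move: K0; nra.
  case: (split_ordP i) => [j ->|j ->].
    by move: k0 kK; rewrite /ck (ord1 j); lra.
  case: (split_ordP j) => [l ->|l ->].
    by have := le1 _ (enum_val l) xx; rewrite /cx enum_valK.
  by have := le1 _ (enum_val l) yy; rewrite /cy enum_valK.
Qed.

(** The pairs formed by [k] and a frame for [M k] form a compact set. *)
Lemma minimal_frame : exists k x y, [/\ 0 <= k <= K, nonpos_frame k x y &
  forall k' x' y', 0 <= k' <= K -> nonpos_frame k' x' y' -> k <= k'].
Proof.
have enc_frame k x y : 0 <= k <= K -> nonpos_frame k x y -> frames (enc k x y).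
  move=> hk [xx yy xy h]; rewrite /frames /= ckE; split => //.
  have -> : cx (enc k x y) = x by apply/funext/cxE.
  have -> : cy (enc k x y) = y by apply/funext/cyE.
  by split.
have [x [y xy]] := frameK.
have [] := @compact_EVT_min _ _ ck frames _ frames_compact.
- by exists (enc K x y); apply: enc_frame => //; rewrite lexx ltW.
- by apply: continuous_subspaceT.
move=> z; rewrite inE => -[zk zf] hz; exists (ck z), (cx z), (cy z); split => //.
move=> k' x' y' hk' hf'; have := hz (enc k' x' y'); rewrite ckE inE; apply.
exact: enc_frame.
Qed.

End MinimalFrame.

(** Negative definiteness of a symmetric matrix of size 2 is given by strict
    inequalities between continuous functions of its entries. *)
Lemma negative_pair_open k x y : 0 < k ->
  (forall a b, (a != 0) || (b != 0) ->
    let z i := a * x i + b * y i in bil k z z < 0) ->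
  exists2 k', 0 <= k' < k &
    forall a b, let z i := a * x i + b * y i in bil k' z z <= 0.
Proof.
move=> k0 neg.
have bc (u v : T -> R) : continuous (fun k => bil k u v).
  have sum_cont (F : T -> R -> R) : (forall i, continuous (F i)) ->
      continuous (fun k => \sum_i F i k).
    by move=> h; apply: continuous_big => //; exact: add_continuous.
  apply: (sum_cont (fun i k => \sum_j M k i j * (u i * v j))) => i.
  apply: (sum_cont (fun j k => M k i j * (u i * v j))) => j l.
  by apply: (@continuousM _ _ (fun k => M k i j) (fun=> u i * v j));
    [exact: M_continuous|exact: cst_continuous].
have xx : bil k x x < 0.
  have := neg 1 0; rewrite oner_eq0 => /(_ isT) /=; rewrite bil_comb2; lra.
have yy : bil k y y < 0.
  have := neg 0 1; rewrite oner_eq0 orbT => /(_ isT) /=; rewrite bil_comb2; lra.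
have det : 0 < bil k x x * bil k y y - bil k x y ^+ 2.
  have := neg (bil k x y) (- bil k x x).
  rewrite oppr_eq0 (lt_eqF xx) orbT => /(_ isT) /=; rewrite bil_comb2.
  by move: xx yy; move: (bil k x x) (bil k x y) (bil k y y) => a b c; nra.
have det_cont : continuous (fun k => bil k x x * bil k y y - bil k x y * bil k x y).
  by move=> l; apply: cvgB; apply: cvgM; exact: bc.
have nx : \forall l \near k, bil l x x < 0.
  have /cvgr_lt := bc x x k; exact.
have ny : \forall l \near k, bil l y y < 0.
  have /cvgr_lt := bc y y k; exact.
have nd : \forall l \near k, 0 < bil l x x * bil l y y - bil l x y * bil l x y.
  by have /cvgr_gt := det_cont k; apply; rewrite -expr2.
have : \forall l \near k, [/\ bil l x x < 0, bil l y y < 0 &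
    0 < bil l x x * bil l y y - bil l x y * bil l x y].
  by near=> l; split; near: l.
move=> /nbhs_ballP[e /= e0 he].
pose k' := Num.max 0 (k - e / 2).
have k'0 : 0 <= k' by rewrite le_max lexx.
have k'k : k' < k by rewrite gt_max k0 /=; lra.
exists k'; first by rewrite k'0.
have [|h1 h2 h3] := he k'.
  have k'e : k - e / 2 <= k' by rewrite /k' le_max lexx orbT.
  by rewrite /ball /= ger0_norm ?subr_ge0 ?ltW//; move: e0 => /= e0; lra.
move=> a b; rewrite bil_comb2; move: h1 h2 h3.
move: (bil k' x x) (bil k' x y) (bil k' y y) => p q r hp hr hd.
rewrite -(nmulr_rge0 _ hp).
have -> : p * (a ^+ 2 * p + 2 * a * b * q + b ^+ 2 * r) =
  (a * p + b * q) ^+ 2 + b ^+ 2 * (p * r - q * q) by ring.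
by rewrite addr_ge0 ?sqr_ge0// mulr_ge0 ?sqr_ge0// ltW.
Unshelve. all: by end_near. Qed.

(** If no [M k] with [0 < k <= K] were singular, a nonpositive plane for the
    form at the least possible [k] could be tilted into a negative definite
    one by the gradient step [1 - eps * M k], and such planes persist for
    slightly smaller values of [k]. *)
Lemma kernel_crossing K : 0 < K ->
  (forall x y, ~ nonpos_frame 0 x y) -> (exists x y, nonpos_frame K x y) ->
  exists2 k, 0 < k <= K & exists2 x, exists i, x i != 0 & forall i, app k x i = 0.
Proof.
move=> K0 no0 exK; have [k [x [y [/andP[k0 kK] [xx yy xy npos] kmin]]]] :=
  minimal_frame K0 exK.
have {}k0 : 0 < k.
  rewrite lt_neqAle k0 andbT; apply/eqP => k00; apply: (no0 x y).
  by rewrite k00; split.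
exists k; first by rewrite k0.
apply: contrapT => nsing.
have app0 z i : z i != 0 -> 0 < dot (app k z) (app k z).
  move=> zi; apply: contrapT => h; apply: nsing; exists z; first by exists i.
  apply: dot_eq0; apply/eqP; rewrite eq_le dot_ge0 andbT leNgt; exact/negP.
pose C := 1 + \sum_i \sum_j `|M k i j|.
have C0 : 0 < C by rewrite ltr_pwDl// sumr_ge0// => i _; rewrite sumr_ge0.
pose step z i := z i - C^-1 * app k z i.
have stepC a b i : step (fun i => a * x i + b * y i) i = a * step x i + b * step y i.
  rewrite /step; suff -> : app k (fun i => a * x i + b * y i) i =
    a * app k x i + b * app k y i by ring.
  by rewrite /app !mulr_sumr -big_split; apply: eq_bigr => j _ /=; ring.
have free a b : (a != 0) || (b != 0) -> exists i, a * x i + b * y i != 0.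
  move=> ab; apply: contrapT => h.
  have h0 i : a * x i + b * y i = 0.
    by apply/eqP; apply: contrapT => /negP hi; apply: h; exists i.
  have d0 z : dot (fun i => a * x i + b * y i) z = 0.
    by apply: big1 => i _; rewrite h0 mul0r.
  move: (d0 x) (d0 y); rewrite !dot_comb xx yy xy [dot y x]dot_sym xy.
  by rewrite !mulr0 !mulr1 addr0 add0r => a0 b0; move: ab; rewrite a0 b0 eqxx.
have neg a b : (a != 0) || (b != 0) ->
    let z i := a * step x i + b * step y i in bil k z z < 0.
  move=> /free[i zi] /=; set z0 := fun i => a * x i + b * y i.
  have -> : bil k (fun i => a * step x i + b * step y i)
    (fun i => a * step x i + b * step y i) = bil k (step z0) (step z0).
    by apply: eq_bil => j; rewrite stepC.
  have -> : bil k (step z0) (step z0) =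
      bil k (fun i => 1 * z0 i + (- C^-1) * app k z0 i)
       (fun i => 1 * z0 i + (- C^-1) * app k z0 i).
    by apply: eq_bil => j; rewrite /step mul1r mulNr.
  rewrite bil_comb2; have hz : bil k z0 z0 <= 0 := npos a b.
  have -> : bil k z0 (app k z0) = dot (app k z0) (app k z0).
    by rewrite bil_sym bil_app.
  have p0 := app0 z0 i zi.
  have := bil_le k (app k z0).
  move: p0; set p := dot _ _; set q := bil k (app k z0) _ => p0 hq.
  have hq' : q < C * p by rewrite (le_lt_trans hq)// ltr_pM2r// ltrDr.
  have Ci : 0 < C^-1 by rewrite invr_gt0.
  have : C^-1 ^+ 2 * q < C^-1 * p.
    rewrite expr2 -mulrA ltr_pM2l// mulrC ltr_pdivrMr// mulrC //.
  have : 0 < C^-1 * p by rewrite mulr_gt0.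
  move: hz; rewrite sqrrN; move: (C^-1) (bil k z0 z0) => c h; lra.
have [k' /andP[k'0 k'k] neg'] := negative_pair_open k0 neg.
have [|x' [y' f']] := nonpos_frame_exists neg'.
  move=> a b ab; apply: contrapT => h.
  have h0 i : a * step x i + b * step y i = 0.
    by apply/eqP; apply: contrapT => /negP hi; apply: h; exists i.
  have := neg a b ab; rewrite /= /bil big1 ?ltxx// => i _.
  by rewrite big1 // => j _; rewrite h0 mul0r mulr0.
have := kmin k' x' y' _ f'; rewrite k'0 (le_trans (ltW k'k) kK) => /(_ isT).
by rewrite leNgt k'k.
Qed.

End Crossing.

(** * Rayleigh quotients and sinusoidal functions *)

Section Sinc.
Variable R : realType.
Implicit Types x y : R.

Lemma sin_mvt x : 0 <= x -> exists2 xi, 0 <= xi <= x & sin x = cos xi * x.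
Proof.
move=> x0.
have [|c] := @MVT_segment R sin cos 0 x x0 (fun y _ => is_derive_sin y).
  by apply: continuous_subspaceT => y; exact: continuous_sin.
by rewrite in_itv /= sin0 !subr0 => ? ->; exists c.
Qed.

Lemma sin_le_id x : 0 <= x -> `|sin x| <= x.
Proof.
move=> x0; have [xi _ ->] := sin_mvt x0.
by rewrite normrM (ger0_norm x0) ler_piMl // cos_max.
Qed.

Lemma cos_ge_quad x : 0 <= x -> 1 - x ^+ 2 / 2 <= cos x.
Proof.
move=> x0; have -> : x = (x / 2) *+ 2 by rewrite -mulr_natr divfK.
rewrite cos_mulr2n cos2sin2.
have x20 : 0 <= x / 2 by rewrite divr_ge0.
have := sin_le_id x20; rewrite -(ler_sqr) ?nnegrE // real_normK ?num_real //.
by move: (x / 2) (sin _) => a b; lra.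
Qed.

Lemma sin_ge_cubic x : 0 <= x -> x * (1 - x ^+ 2 / 2) <= sin x.
Proof.
move=> x0; have [xi /andP[xi0 xix] ->] := sin_mvt x0.
rewrite mulrC; apply: ler_wpM2r => //; apply: le_trans (cos_ge_quad xi0).
by rewrite lerD2l lerN2; apply: ler_wpM2r; rewrite ?invr_ge0// ler_sqr ?nnegrE.
Qed.

(** The quotient makes [dtn] below continuous at [k = 0]. *)
Definition sinc x : R := if x == 0 then 1 else sin x / x.

Lemma sinc_bound x : `|sinc x - 1| <= x ^+ 2 / 2.
Proof.
wlog x0 : x / 0 <= x => [H|].
  have [/H//|/ltW x0] := leP 0 x.
  have := H (- x); rewrite oppr_ge0 sqrrN => /(_ x0); rewrite /sinc oppr_eq0.
  by rewrite sinN invrN mulrNN.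
rewrite /sinc; have [->|xn0] := eqVneq x 0.
  by rewrite subrr normr0 expr0n mul0r.
have x_gt0 : 0 < x by rewrite lt_neqAle eq_sym xn0.
have h1 : sin x / x <= 1.
  by rewrite ler_pdivrMr // mul1r (le_trans (ler_norm _)) // sin_le_id.
have h2 : 1 - x ^+ 2 / 2 <= sin x / x.
  by rewrite ler_pdivlMr // mulrC sin_ge_cubic.
by rewrite ler_norml; lra.
Qed.

Lemma continuous_sinc : continuous sinc.
Proof.
move=> x; have [->|xn0] := eqVneq x 0.
  apply/cvgrPdist_le => eps eps0; apply/nbhs_ballP; exists (Num.min 1 eps) => /=.
    by rewrite lt_min eps0 ltr01.
  move=> y; rewrite /ball /= sub0r normrN lt_min => /andP[y1 ye].
  rewrite {1}/sinc eqxx distrC; apply: le_trans (sinc_bound y) _.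
  rewrite -real_normK ?num_real //.
  by move: y1 ye (normr_ge0 y); move: `|y| => a; nra.
have xn : {for x, continuous (fun y => sin y / y)}.
  apply: cvgM; first exact: continuous_sin.
  exact: cvgV.
rewrite /continuous_at /sinc (negbTE xn0); apply: cvg_trans xn.
apply: near_eq_cvg.
have nx : \forall y \near nbhs x, y != 0.
  by apply: open_nbhs_nbhs; split; [exact: open_neq|exact: xn0].
by apply: filterS nx => y /negbTE ->.
Qed.

End Sinc.

Section Rayleigh.
Variables (R : realType) (H : metric_graph R).

(** The weight of the edge [e] in the Dirichlet-to-Neumann form: the minimum of
    the integral of [f'^2 - k^2 f^2] on [e], for given values [a], [b] of [f] at
    the ends, is [dtn k e * ((a^2 + b^2) * cos (k * len e) - 2 * a * b)] as long as
    [k * len e <= 1]. *)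
Definition dtn (k : R) (e : edge H) : R :=
  (len e * Num.max (1 / 2) (sinc (k * len e)))^-1.

Definition dtn_matrix (k : R) (i j : vert H) : R :=
  \sum_e dtn k e * (cos (k * len e) *
    ((src e == i)%:R * (src e == j)%:R + (tgt e == i)%:R * (tgt e == j)%:R)
    - ((src e == i)%:R * (tgt e == j)%:R + (tgt e == i)%:R * (src e == j)%:R)).

Lemma dtn_matrix_sym k i j : dtn_matrix k i j = dtn_matrix k j i.
Proof. by apply: eq_bigr => e _; congr (_ * (_ - _)); ring. Qed.

Let lin_continuous (e : edge H) : continuous (fun k : R => k * len e).
Proof. by move=> k; apply: cvgM; [exact: cvg_id|exact: cvg_cst]. Qed.

Lemma dtn_matrix_continuous i j : continuous (fun k => dtn_matrix k i j).
Proof.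
apply: continuous_big => [|e _ k]; first exact: add_continuous.
apply: cvgM.
  apply: cvgV; first by rewrite mulf_neq0 ?gt_eqF ?len_gt0// lt_max; apply/orP; left; lra.
  apply: cvgM; first exact: cvg_cst.
  have c2 : continuous (fun k : R => sinc (k * len e)).
    by move=> l; exact: (continuous_comp (@lin_continuous e l) (@continuous_sinc R _)).
  exact: (max_fun_continuous (@cst_continuous R R (1 / 2)) c2).
apply: cvgB; last exact: cvg_cst.
apply: cvgM; last exact: cvg_cst.
exact: (continuous_comp (@lin_continuous e k) (@continuous_cos R _)).
Qed.

Let sum1 (u : vert H) (x : vert H -> R) : \sum_i (u == i)%:R * x i = x u.
Proof.
rewrite (bigD1 u) //= eqxx mul1r big1 ?addr0 // => i.
by rewrite eq_sym => /negbTE ->; rewrite mul0r.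
Qed.

Lemma app_dtn k x u : app dtn_matrix k x u = \sum_e dtn k e *
  ((src e == u)%:R * (cos (k * len e) * x (src e) - x (tgt e)) +
   (tgt e == u)%:R * (cos (k * len e) * x (tgt e) - x (src e))).
Proof.
rewrite /app /dtn_matrix.
under eq_bigr => j _ do rewrite mulr_suml.
rewrite exchange_big; apply: eq_bigr => e _ /=.
transitivity (\sum_j dtn k e *
  (((src e == u)%:R * cos (k * len e)) * ((src e == j)%:R * x j) +
   ((tgt e == u)%:R * cos (k * len e)) * ((tgt e == j)%:R * x j) -
   (src e == u)%:R * ((tgt e == j)%:R * x j) -
   (tgt e == u)%:R * ((src e == j)%:R * x j))).
  by apply: eq_bigr => j _; ring.
by rewrite -mulr_sumr !sumrB big_split /= -!mulr_sumr !sum1; ring.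
Qed.

Lemma bil_dtn k x y : bil dtn_matrix k x y = \sum_e dtn k e *
  (cos (k * len e) * (x (src e) * y (src e) + x (tgt e) * y (tgt e)) -
   (x (src e) * y (tgt e) + x (tgt e) * y (src e))).
Proof.
rewrite (bil_sym dtn_matrix_sym) bil_app /dot.
under eq_bigr => i _ do rewrite app_dtn mulr_suml.
rewrite exchange_big; apply: eq_bigr => e _ /=.
transitivity (\sum_j dtn k e *
  ((cos (k * len e) * x (src e) - x (tgt e)) * ((src e == j)%:R * y j) +
   (cos (k * len e) * x (tgt e) - x (src e)) * ((tgt e == j)%:R * y j))).
  by apply: eq_bigr => j _; ring.
by rewrite -mulr_sumr big_split /= -!mulr_sumr !sum1; ring.
Qed.

Lemma dtn_sin k e : 0 < k -> k * len e <= 1 ->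
  0 < sin (k * len e) /\ dtn k e = k / sin (k * len e).
Proof.
move=> k0 kl; have l0 := len_gt0 e.
have t0 : 0 < k * len e by rewrite mulr_gt0.
have := sin_ge_cubic (ltW t0).
have : 1 / 2 <= 1 - (k * len e) ^+ 2 / 2 by move: t0 kl; move: (k * len e) => t; nra.
move=> h1 h2.
have h3 : (k * len e) * (1 / 2) <= sin (k * len e).
  by apply: le_trans h2; apply: ler_wpM2l => //; exact: ltW.
have s0 : 0 < sin (k * len e) by apply: lt_le_trans h3; rewrite mulr_gt0.
split=> //; rewrite /dtn /sinc gt_eqF //.
have -> : Num.max (1 / 2) (sin (k * len e) / (k * len e)) = sin (k * len e) / (k * len e).
  by apply/max_idPr; rewrite ler_pdivlMr // mulrC.
by field; rewrite !gt_eqF.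
Qed.

(** The equation of the kernel at a vertex is Kirchhoff's condition there for the
    sinusoidal function which takes the values [x] at the vertices. *)
Lemma sinusoidal_kernel k x : 0 < k -> (forall e : edge H, k * len e <= 1) ->
  (exists u, x u != 0) -> (forall u, app dtn_matrix k x u = 0) -> sinusoidal H k.
Proof.
move=> k0 kl x0 hx.
exists x, (fun e => (x (tgt e) - x (src e) * cos (k * len e)) / sin (k * len e)).
split; last by left.
  move=> e; have [s0 _] := dtn_sin k0 (kl e).
  by rewrite divfK ?gt_eqF// addrC subrK.
move=> v; have := hx v; rewrite app_dtn => /eqP.
have -> : \sum_e dtn k e *
  ((src e == v)%:R * (cos (k * len e) * x (src e) - x (tgt e)) +
   (tgt e == v)%:R * (cos (k * len e) * x (tgt e) - x (src e))) =
  - k * (\sum_(e | src e == v)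
      (x (tgt e) - x (src e) * cos (k * len e)) / sin (k * len e) +
   \sum_(e | tgt e == v) (x (src e) * sin (k * len e) -
     (x (tgt e) - x (src e) * cos (k * len e)) / sin (k * len e) * cos (k * len e))).
  rewrite [X in _ = _ * (X + _)]big_mkcond [X in _ = _ * (_ + X)]big_mkcond.
  rewrite -big_split mulr_sumr; apply: eq_bigr => e _ /=.
  have [s0 ->] := dtn_sin k0 (kl e).
  have := cos2Dsin2 (k * len e); move: (sin _) (cos _) s0 => s c s0 cs.
  have -> : x (src e) * s - (x (tgt e) - x (src e) * c) / s * c =
    (x (src e) * (c ^+ 2 + s ^+ 2) - x (tgt e) * c) / s.
    by field; rewrite gt_eqF.
  rewrite cs; case: (src e == v); case: (tgt e == v); rewrite /= ?mulr1n ?mulr0n; field; rewrite gt_eqF //.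
by rewrite mulf_eq0 oppr_eq0 gt_eqF //= => /eqP.
Qed.

(** Two functions with disjoint supports and small Rayleigh quotients span a
    plane on which the form at [K] is nonpositive; at [0], it is positive
    outside of the constants. *)
Lemma sinusoidal_rayleigh (K : R) (f : bool -> vert H -> R) : 0 < K ->
  (forall e : edge H, K * len e <= 1) ->
  (forall u, f true u * f false u = 0) ->
  (forall e : edge H, f true (src e) * f false (tgt e) = 0 /\
                      f true (tgt e) * f false (src e) = 0) ->
  (forall b, exists u, f b u != 0) ->
  (forall b, \sum_(e : edge H) (f b (tgt e) - f b (src e)) ^+ 2 / len e <=
     K ^+ 2 / 16 * \sum_(e : edge H) len e * (f b (src e) ^+ 2 + f b (tgt e) ^+ 2)) ->
  exists2 k, 0 < k <= K & sinusoidal H k.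
Proof.
move=> K0 Kl fu fe f0 fR.
have [||k /andP[k0 kK] [x x0 hx]] := @kernel_crossing R (vert H) dtn_matrix
   dtn_matrix_sym dtn_matrix_continuous K K0; last first.
- exists k; first by rewrite k0.
  apply: sinusoidal_kernel hx => // e; apply: le_trans (Kl e).
  by apply: ler_wpM2r => //; rewrite ltW ?len_gt0.
- have bilK b : bil dtn_matrix K (f b) (f b) <= 0.
    rewrite bil_dtn; apply: (@le_trans _ _ (\sum_(e : edge H)
      (2 * ((f b (tgt e) - f b (src e)) ^+ 2 / len e) -
       2 * (K ^+ 2 / 16 * (len e * (f b (src e) ^+ 2 + f b (tgt e) ^+ 2)))))); last first.
      by rewrite sumrB -!mulr_sumr; have := fR b; lra.
    apply: ler_sum => e _; move: (f b (src e)) (f b (tgt e)) => u v.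
    have l0 := len_gt0 e; have [s0 ->] := dtn_sin K0 (Kl e).
    have t0 : 0 < K * len e by rewrite mulr_gt0.
    have h1 := sin_le_id (ltW t0); rewrite gtr0_norm // in h1.
    have h2 : K * len e * (1 / 2) <= sin (K * len e).
      apply: le_trans (sin_ge_cubic (ltW t0)); apply: ler_wpM2l; first exact: ltW.
      by move: t0 (Kl e); move: (K * len e) => t; nra.
    have h3 : cos (K * len e) <= 1 - (K * len e) ^+ 2 / 8.
      pose y := K * len e / 2.
      have yE : K * len e = y *+ 2 by rewrite -mulr_natr divfK.
      have y0 : 0 <= y by rewrite divr_ge0// ltW.
      have y1 : y <= 1 / 2 by rewrite ler_wpM2r // Kl.
      have : y / 2 <= sin y by apply: le_trans (sin_ge_cubic y0); nra.
      by rewrite yE cos_mulr2n cos2sin2; move: (sin y) => s hs; nra.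
    rewrite -subr_ge0.
    have -> : 2 * ((v - u) ^+ 2 / len e) - 2 * (K ^+ 2 / 16 * (len e * (u ^+ 2 + v ^+ 2)))
      - K / sin (K * len e) * (cos (K * len e) * (u * u + v * v) - (u * v + v * u)) =
      (sin (K * len e) * (2 * (v - u) ^+ 2 - (K * len e) ^+ 2 / 8 * (u ^+ 2 + v ^+ 2))
       - (K * len e) * ((v - u) ^+ 2 - (1 - cos (K * len e)) * (u ^+ 2 + v ^+ 2)))
      / (len e * sin (K * len e)).
      by field; rewrite !gt_eqF.
    apply: divr_ge0; last by rewrite mulr_ge0 // ltW.
    have : 0 <= (v - u) ^+ 2 by exact: sqr_ge0.
    have : 0 <= u ^+ 2 + v ^+ 2 by rewrite addr_ge0 // sqr_ge0.
    move: ((v - u) ^+ 2) (u ^+ 2 + v ^+ 2) => P S hS hP.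
    move: t0 h1 h2 h3; set s := sin (K * len e); set c := cos (K * len e).
    move: (K * len e) => t t0 h1 h2 h3.
    have e1 : t * P <= s * (2 * P) by nra.
    have e2 : t * (t ^+ 2 / 8 * S) <= t * ((1 - c) * S).
      by apply: ler_wpM2l; [exact: ltW|apply: ler_wpM2r => //; lra].
    have e3 : s * (t ^+ 2 / 8 * S) <= t * (t ^+ 2 / 8 * S).
      by apply: ler_wpM2r => //; rewrite mulr_ge0 // divr_ge0 // sqr_ge0.
    lra.
  have d0 b : 0 < dot (f b) (f b) by have [u] := f0 b; exact: dot_gt0.
  have dtf : dot (f true) (f false) = 0 by apply: big1 => u _; exact: fu.
  have bil_tf : bil dtn_matrix K (f true) (f false) = 0.
    rewrite bil_dtn; apply: big1 => e _; have [e1 e2] := fe e.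
    by rewrite e1 e2 !fu !addr0 mulr0 subr0 mulr0.
  pose x b u := (Num.sqrt (dot (f b) (f b)))^-1 * f b u.
  have dotZ a b g h : dot (fun i => a * g i) (fun i => b * h i) = a * b * dot g h.
    by rewrite /dot mulr_sumr; apply: eq_bigr => i _; ring.
  have xx b : dot (x b) (x b) = 1.
    by rewrite dotZ -expr2 exprVn sqr_sqrtr ?ltW// mulVf ?gt_eqF.
  exists (x true), (x false); split => //; first by rewrite dotZ dtf mulr0.
  move=> a b /=.
  rewrite (eq_bil _ _ (x' := fun i => a * (Num.sqrt (dot (f true) (f true)))^-1 * f true i +
      b * (Num.sqrt (dot (f false) (f false)))^-1 * f false i)
    (y' := fun i => a * (Num.sqrt (dot (f true) (f true)))^-1 * f true i +
      b * (Num.sqrt (dot (f false) (f false)))^-1 * f false i)); last 2 first.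
  - by move=> i; rewrite /x !mulrA.
  - by move=> i; rewrite /x !mulrA.
  rewrite (bil_comb2 dtn_matrix_sym) bil_tf mulr0 addr0.
  by rewrite -(addr0 0) lerD // mulr_ge0_le0 ?sqr_ge0.
- move=> x y [xx yy xy npos].
  have bil0 z : bil dtn_matrix 0 z z = \sum_(e : edge H) (z (tgt e) - z (src e)) ^+ 2 / len e.
    rewrite bil_dtn; apply: eq_bigr => e _; rewrite /dtn mul0r /sinc eqxx cos0.
    have -> : Num.max (1 / 2) 1 = 1 :> R by apply/max_idPr; lra.
    by field; rewrite gt_eqF ?len_gt0.
  have const z : bil dtn_matrix 0 z z <= 0 -> forall u v, z u = z v.
    move=> z0; have ze (e : edge H) : z (src e) = z (tgt e).
      have : (z (tgt e) - z (src e)) ^+ 2 / len e <= 0.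
        apply: le_trans z0; rewrite bil0 (bigD1 e) //= lerDl; apply: sumr_ge0 => j _.
        by rewrite divr_ge0 ?sqr_ge0// ltW// len_gt0.
      rewrite pmulr_lle0 ?invr_gt0 ?len_gt0 // => h; apply/esym/eqP; rewrite -subr_eq0.
      by rewrite -sqrf_eq0 eq_le h sqr_ge0.
    move=> u v; apply: (@graph_ind _ H (fun w => z u = z w) _ u v) => // e.
    by rewrite ze.
  have cx := const x; have cy := const y.
  have := npos 1 0; rewrite /= (eq_bil _ _ (x' := x) (y' := x)); try by move=> i; ring.
  move/cx => {}cx.
  have := npos 0 1; rewrite /= (eq_bil _ _ (x' := y) (y' := y)); try by move=> i; ring.
  move/cy => {}cy.
  have [u _] : exists u : vert H, True.
    by have /card_gt0P[u _] := vert_neq0 H; exists u.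
  have xE : dot x x = #|vert H|%:R * (x u * x u).
    by rewrite /dot (eq_bigr (fun=> x u * x u)) ?sumr_const ?mulr_natl // => i _; rewrite (cx i u).
  have yE : dot y y = #|vert H|%:R * (y u * y u).
    by rewrite /dot (eq_bigr (fun=> y u * y u)) ?sumr_const ?mulr_natl // => i _; rewrite (cy i u).
  have xyE : dot x y = #|vert H|%:R * (x u * y u).
    rewrite /dot (eq_bigr (fun=> x u * y u)) ?sumr_const ?mulr_natl // => i _.
    by rewrite (cx i u) (cy i u).
  have := oner_neq0 R; rewrite -[X in X != 0](mulr1 1) -{1}xx -yy xE yE.
  have -> : #|vert H|%:R * (x u * x u) * (#|vert H|%:R * (y u * y u)) =
    (#|vert H|%:R * (x u * y u)) ^+ 2 by ring.
  by rewrite -xyE xy expr0n eqxx.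
Qed.

End Rayleigh.

(** * Sinusoidal functions are eigenfunctions *)

Section Topology.
Variables (R : realType) (G : metric_graph R).
Implicit Types (e : edge G) (p q : gpoint G).

Lemma gpoint_ballE p r q : ball p r q = (path_dist p q < r) :> Prop.
Proof. by rewrite ballEmdist. Qed.

Lemma edgewise_lipschitz_continuous (g : gpoint G -> R) (C : R) : 0 < C ->
  (forall e s t, 0 <= s <= len e -> 0 <= t <= len e ->
    `|g (pt e t) - g (pt e s)| <= C * `|t - s|) -> continuous g.
Proof.
move=> C0 gl p A /= /nbhs_ballP[eps /= eps0 hA]; apply/nbhs_ballP.
exists (eps / C) => /=; first by rewrite divr_gt0.
move=> q; rewrite gpoint_ballE ltr_pdivlMr // => h; apply: hA; rewrite /ball /=.
have := @path_dist_lip _ G (fun x => C^-1 * g x) _ q p.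
rewrite -mulrBr normrM gtr0_norm ?invr_gt0 // ler_pdivrMl // => H.
rewrite (le_lt_trans (H _)) // 1?mulrC 1?path_dist_sym // => e s t hs ht.
by rewrite -mulrBr normrM gtr0_norm ?invr_gt0 // ler_pdivrMl // gl.
Qed.

Let clamp e (s : R) := Num.max 0 (Num.min s (len e)).

Lemma pt_clamp e s : pt e s = pt e (clamp e s).
Proof.
have l0 := len_gt0 e; rewrite /clamp.
have [s0|s0] := leP s 0.
  have -> : Num.max 0 (Num.min s (len e)) = 0.
    by apply/max_idPl; rewrite ge_min s0.
  rewrite pt0 /pt insubF ?s0 //=; apply/negbTE; rewrite negb_and -leNgt s0 //.
have [ls|ls] := leP (len e) s.
  have -> : Num.max 0 (len e) = len e by apply/max_idPr/ltW.
  rewrite pt_len /pt insubF /=; first by rewrite leNgt s0.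
  by apply/negbTE; rewrite negb_and -!leNgt ls orbT.
by have -> : Num.max 0 s = s by apply/max_idPr/ltW.
Qed.

Lemma clamp_bounds e s : 0 <= clamp e s <= len e.
Proof. by rewrite /clamp le_max lexx ge_max (ltW (len_gt0 e)) ge_min lexx orbT. Qed.

Lemma clamp_lip e s t : `|clamp e t - clamp e s| <= `|t - s|.
Proof.
have l0 := len_gt0 e.
rewrite /clamp; have : 0 <= `|t - s| by []; have := ler_norm (t - s).
have := ler_norm (s - t); rewrite distrC; move: `|t - s| => d.
rewrite ler_norml.
by case: (leP s (len e)) => ?; case: (leP t (len e)) => ?;
  case: (leP 0 s) => ?; case: (leP 0 t) => ?; case: (leP 0 (len e)) => ?; lra.
Qed.

Lemma pt_lip e s t : path_dist (pt e s) (pt e t) <= `|t - s|.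
Proof.
apply: le_trans (clamp_lip e s t); rewrite (pt_clamp e s) (pt_clamp e t).
have := @path_dist_le _ G (pt e (clamp e s)) (pt e (clamp e t))
  [:: (e, (clamp e s, clamp e t))].
by rewrite /path_length big_seq1 /= !clamp_bounds; apply; split.
Qed.

Lemma pt_continuous e : continuous (pt e).
Proof.
move=> s A /= /nbhs_ballP[r /= r0 hr]; apply/nbhs_ballP; exists r => //= t.
rewrite /ball /= => st; apply: hr; rewrite gpoint_ballE.
by apply: le_lt_trans (pt_lip e s t) _; rewrite distrC.
Qed.

Lemma borel_measurable_pt e (A : set (gpoint G)) : borel A ->
  measurable (pt e @^-1` A).
Proof.
move=> bA; suff: <<s [set U : set (gpoint G) | open U] >> `<=`
    [set B | measurable (pt e @^-1` B)] by apply.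
apply: smallest_sub; last first.
  move=> U /= oU; apply: open_measurable; apply: open_comp => // s _.
  exact: pt_continuous.
split => /=.
- by rewrite preimage_set0.
- by move=> B mB; rewrite setTD preimage_setC; exact: measurableC.
- by move=> F mF; rewrite preimage_bigcup; exact: bigcup_measurable.
Qed.

End Topology.

Section Slope.
Variables (R : realType) (G : metric_graph R).

Lemma slope_germ (f : gpoint G -> R) p w (m eps : R) : 0 < eps ->
  (forall s, 0 < s < eps -> f (walk p w s) = f p + m * s) -> slope f p w = m.
Proof.
move=> eps0 hf; apply/cvg_lim => //.
have : cst m s @[s --> (0 : R)^'+] --> m by apply: cvg_cst.
apply: cvg_trans; apply: near_eq_cvg; near=> s.
have s0 : 0 < s by near: s; exact: nbhs_right_gt.
rewrite hf; first by rewrite addrC addKr mulfK // gt_eqF.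
by rewrite s0 /=; near: s; exact: nbhs_right_lt.
Unshelve. all: by end_near. Qed.

Lemma slope_is_derive (f : gpoint G -> R) p w (g : R -> R) (m eps : R) : 0 < eps ->
  (forall s, 0 < s < eps -> f (walk p w s) = g s) -> f p = g 0 ->
  is_derive (0 : R) (1 : R) g m -> slope f p w = m.
Proof.
move=> eps0 hf fp [dg <-]; apply/cvg_lim => //.
have : h^-1 *: (g (h *: (1 : R) + 0) - g 0) @[h --> 0^'+] --> 'D_1 g 0.
  exact: cvg_dnbhs_at_right.
apply: cvg_trans; apply: near_eq_cvg; near=> s.
have s0 : 0 < s by near: s; exact: nbhs_right_gt.
rewrite hf; first by rewrite fp /GRing.scale /= mulr1 addr0 mulrC.
by rewrite s0 /=; near: s; exact: nbhs_right_lt.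
Unshelve. all: by end_near. Qed.

End Slope.

Section Eigenfunction.
Variables (R : realType) (G : metric_graph R) (k : R).
Hypothesis k0 : 0 < k.
Variables (x : vert G -> R) (d : edge G -> R).
Hypothesis x_tgt : forall e,
  x (tgt e) = x (src e) * cos (k * len e) + d e * sin (k * len e).
Hypothesis kirchhoff : forall v, \sum_(e | src e == v) d e +
  \sum_(e | tgt e == v) (x (src e) * sin (k * len e) - d e * cos (k * len e)) = 0.
Hypothesis nonzero : (exists v, x v != 0) \/ (exists e, d e != 0).

Let F (e : edge G) (t : R) : R := x (src e) * cos (k * t) + d e * sin (k * t).
Let dF (e : edge G) (t : R) : R :=
  k * (d e * cos (k * t) - x (src e) * sin (k * t)).
Let f (p : gpoint G) : R :=
  match p with inl v => x v | inr y => F (val y).1 (val y).2 end.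

Let fE e s : 0 <= s <= len e -> f (pt e s) = F e s.
Proof.
move=> /andP[]; rewrite le_eqVlt => /predU1P[<-|s0].
  by rewrite pt0 /= /F mulr0 cos0 sin0 mulr1 mulr0 addr0.
rewrite le_eqVlt => /predU1P[->|sl]; first by rewrite pt_len /= x_tgt.
have h : 0 < s < len e by rewrite s0.
by rewrite (pt_interior h).
Qed.

Let dsin (t : R) : is_derive t (1 : R) (fun t => sin (k * t)) (k * cos (k * t)).
Proof.
have lin : is_derive t (1 : R) ( *%R k) k.
  have := @is_deriveZ R R R id k t 1 1 (is_derive_id _ _).
  by rewrite [k *: (1 : R)]mulr1.
have := @is_derive1_comp R (@sin R) ( *%R k) t _ _ (is_derive_sin _) lin.
by rewrite mulrC.
Qed.

Let dcos (t : R) : is_derive t (1 : R) (fun t => cos (k * t)) (- k * sin (k * t)).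
Proof.
have lin : is_derive t (1 : R) ( *%R k) k.
  have := @is_deriveZ R R R id k t 1 1 (is_derive_id _ _).
  by rewrite [k *: (1 : R)]mulr1.
have := @is_derive1_comp R (@cos R) ( *%R k) t _ _ (is_derive_cos _) lin.
by rewrite mulrC mulrN mulNr.
Qed.

Let dcomb (a b : R) (t : R) :
  is_derive t (1 : R) (fun t => a * cos (k * t) + b * sin (k * t))
    (k * (b * cos (k * t) - a * sin (k * t))).
Proof.
have h := is_deriveD (is_deriveZ a (dcos t)) (is_deriveZ b (dsin t)).
by apply: (is_derive_eq h); rewrite /GRing.scale /=; ring.
Qed.

Let dFE e (t : R) : is_derive t (1 : R) (F e) (dF e t).
Proof. exact: dcomb. Qed.

Let ddFE e (t : R) : is_derive t (1 : R) (dF e) (- k ^+ 2 * F e t).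
Proof.
have h := is_deriveZ k (dcomb (d e) (- x (src e)) t).
rewrite (_ : dF e = k \*: (fun t => d e * cos (k * t) + - x (src e) * sin (k * t))).
  by apply: (is_derive_eq h); rewrite /GRing.scale /F /=; ring.
by apply/funext => u; rewrite /dF /= /GRing.scale /= mulNr.
Qed.

Let F_continuous e : continuous (F e).
Proof. by move=> t; apply: differentiable_continuous; apply/derivable1_diffP. Qed.

Let dF_le e (t : R) : `|dF e t| <= k * (`|d e| + `|x (src e)|).
Proof.
rewrite /dF normrM gtr0_norm // ler_pM2l // (le_trans (ler_normB _ _)) //.
by apply: lerD; rewrite normrM ler_piMr // ?cos_max ?sin_max.
Qed.

Let F_lip e (s t : R) : `|F e t - F e s| <= k * (`|d e| + `|x (src e)|) * `|t - s|.
Proof.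
wlog st : s t / s <= t => [H|].
  have [/H//|/ltW ts] := leP s t.
  by rewrite (distrC (F e t)) (distrC t s) H.
have [|c _ ->] := @MVT_segment R (F e) (dF e) s t st (fun u _ => dFE e u).
  exact/continuous_subspaceT/F_continuous.
by rewrite normrM; apply: ler_wpM2r.
Qed.

Let f_continuous : continuous f.
Proof.
pose C := 1 + \sum_e k * (`|d e| + `|x (src e)|).
have ge0 e : 0 <= k * (`|d e| + `|x (src e)|).
  by rewrite mulr_ge0 ?addr_ge0// ltW.
apply: (@edgewise_lipschitz_continuous _ _ _ C).
  by rewrite ltr_pwDl // sumr_ge0.
move=> e s t hs ht; rewrite !fE //; apply: le_trans (F_lip e s t) _.
apply: ler_wpM2r => //; rewrite /C (bigD1 e) //= addrCA lerDl addr_ge0 //.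
exact: sumr_ge0.
Qed.

Let near_interior (e : edge G) (t : R) : 0 < t < len e ->
  \forall s \near nbhs t, 0 < s < len e.
Proof.
move=> ht; have : open_nbhs t `]0, len e[%classic.
  by split; [exact: interval_open|rewrite /= in_itv].
by move/open_nbhs_nbhs; apply: filterS => s; rewrite /= in_itv.
Qed.

Let h (e : edge G) (s : R) := f (pt e s).

Let hF (e : edge G) (t : R) : 0 < t < len e -> \forall s \near nbhs t, F e s = h e s.
Proof.
move/near_interior; apply: filterS => s /andP[s0 sl].
by rewrite /h fE // !ltW.
Qed.

Let dhE (e : edge G) (t : R) : 0 < t < len e -> is_derive t (1 : R) (h e) (dF e t).
Proof. by move=> ht; apply: near_eq_is_derive (hF ht) (dFE e t). Qed.

Let derive_h (e : edge G) (t : R) : 0 < t < len e -> \forall s \near nbhs t, dF e s = derive1 (h e) s.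
Proof.
move/near_interior; apply: filterS => s hs.
by rewrite derive1E; have [_ ->] := dhE hs.
Qed.

Let ddhE (e : edge G) (t : R) : 0 < t < len e ->
  is_derive t (1 : R) (derive1 (h e)) (- k ^+ 2 * F e t).
Proof. by move=> ht; apply: near_eq_is_derive (derive_h ht) (ddFE e t). Qed.

Let second_hE (e : edge G) (t : R) : 0 < t < len e -> derive1n 2 (h e) t = - k ^+ 2 * F e t.
Proof. by move=> ht; rewrite derive1nS derive1n1 derive1E; have [_ ->] := ddhE ht. Qed.

Let second_derivativeE (e : edge G) (t : R) : 0 < t < len e ->
  second_derivative f (pt e t) = - k ^+ 2 * F e t.
Proof. by move=> ht; rewrite (pt_interior ht) -(second_hE ht). Qed.

Let f_piecewise_C2 : piecewise_C2 f.
Proof.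
exists set0 => // e t ht _ /=; split.
- by have [] := dhE ht.
- by have [] := ddhE ht.
- change (derive1n 2 (h e) s @[s --> t] --> derive1n 2 (h e) t).
  rewrite (second_hE ht).
  have : (fun s => - k ^+ 2 * F e s) @ t --> - k ^+ 2 * F e t.
    by apply: cvgM; [exact: cvg_cst|exact: F_continuous].
  apply: cvg_trans; apply: near_eq_cvg; move/near_interior: ht.
  by apply: filterS => s /second_hE.
Qed.

Let integrable_F (e : edge G) : lebesgue_measure.-integrable `]0, len e[
  (EFin \o (fun t => - k ^+ 2 * F e t)).
Proof.
have : lebesgue_measure.-integrable `[0, len e]%classic
    (EFin \o (fun t => - k ^+ 2 * F e t)).
  apply: continuous_compact_integrable; first exact: segment_compact.
  apply: continuous_subspaceT => t.
  by apply: cvgM; [exact: cvg_cst|exact: F_continuous].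
apply: integrableS => //.
by apply: subset_itvW.
Qed.

Let f_Zh : Zh f.
Proof.
split => // e; apply: eq_integrable (integrable_F e) => //.
by move=> t; rewrite inE /= in_itv /= => ht; rewrite second_derivativeE.
Qed.

Let f_neq0 : exists p, f p != 0.
Proof.
case: nonzero => [[v xv]|[e de]]; first by exists (inl v).
have [xs|xs] := eqVneq (x (src e)) 0; last by exists (inl (src e)).
pose t := Num.min (len e / 2) (k^-1).
have t0 : 0 < t by rewrite lt_min divr_gt0 ?len_gt0// invr_gt0.
have tl : t < len e.
  by rewrite gt_min; apply/orP; left; have := len_gt0 e; lra.
exists (pt e t); rewrite fE ?ltW//= /F xs mul0r add0r mulf_neq0 // gt_eqF //.
apply: sin_gt0_pi; rewrite mulr_gt0 //=.
have : k * t <= 1 by rewrite -ler_pdivlMl // mulr1 /t ge_min lexx orbT.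
by move/le_lt_trans; apply; have := pi_ge2 R; lra.
Qed.

Let slopeE p w : w \in tangents p ->
  slope f p w = (if w.2 then 1 else -1) * dF w.1 (base p w).
Proof.
move=> wp; have [/andP[b0 bl] pE bb] := base_bounds wp.
have fp : f p = F w.1 (base p w) by rewrite -{1}pE fE // b0.
pose eps := if w.2 then len w.1 - base p w else base p w.
have eps0 : 0 < eps by rewrite /eps; case: ifP bb => _; rewrite ?subr_gt0.
pose c : R := if w.2 then 1 else -1.
apply: (@slope_is_derive _ _ _ _ _ (fun s => F w.1 (base p w + c * s)) _ eps) => //.
- move=> s /andP[s0 se]; rewrite walkE fE.
    by congr (F _ _); rewrite /c; case: w.2; ring.
  by move: se; rewrite /eps; case: w.2 => se; lra.
- by rewrite mulr0 addr0.
have lin : is_derive (0 : R) (1 : R) (fun s => base p w + c * s) c.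
  have hd := is_deriveD (is_derive_cst (base p w) (0 : R) (1 : R))
    (is_deriveZ c (is_derive_id (0 : R) (1 : R))).
  by apply: (is_derive_eq hd); rewrite /GRing.scale /= mulr1 add0r.
have := dFE w.1 (base p w + c * 0); rewrite mulr0 addr0 => dd.
have dd' : is_derive (base p w + c * 0) (1 : R) (F w.1) (dF w.1 (base p w)).
  by rewrite mulr0 addr0.
have := @is_derive1_comp R (F w.1) (fun s => base p w + c * s) 0 _ _ dd' lin.
by rewrite mulrC.
Qed.

Let sum_slopes0 p : sum_slopes f p = 0.
Proof.
rewrite /sum_slopes (eq_bigr _ (@slopeE p)).
case: p => [v|y]; last first.
  rewrite -(pt_val y).
  by rewrite (sum_tangents_interior (fun e s (b : bool) => (if b then 1 else -1) * dF e s)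
    (valP y)); ring.
rewrite (sum_tangents_vertex (fun e s (b : bool) => (if b then 1 else -1) * dF e s)).
transitivity (k * (\sum_(e | src e == v) d e +
    \sum_(e | tgt e == v) (x (src e) * sin (k * len e) - d e * cos (k * len e))));
  last by rewrite kirchhoff mulr0.
rewrite mulrDr !mulr_sumr; congr (_ + _).
  by apply: eq_bigr => e _; rewrite /dF mulr0 cos0 sin0; ring.
by apply: eq_bigr => e _; rewrite /dF; ring.
Qed.

Lemma eigenvalue_of_sinusoid : Defs.eigenvalue G (k ^+ 2).
Proof.
exists f; split => // A bA; rewrite /laplacian fsbig1 ?subr0; last first.
  by move=> p _; exact: sum_slopes0.
rewrite /gint mulr_sumr -sumrN; apply: eq_bigr => e _.
have mA : measurable (`]0, len e[ `&` pt e @^-1` A).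
  by apply: measurableI => //; exact: borel_measurable_pt.
have iF : lebesgue_measure.-integrable (`]0, len e[ `&` pt e @^-1` A)
    (EFin \o (fun t => - k ^+ 2 * F e t)).
  exact: integrableS (integrable_F e).
have k2 : - k ^+ 2 != 0 by rewrite oppr_eq0 sqrf_eq0 gt_eqF.
have -> : \int[lebesgue_measure]_(t in `]0, len e[ `&` pt e @^-1` A)
    second_derivative f (pt e t) =
    \int[lebesgue_measure]_(t in `]0, len e[ `&` pt e @^-1` A) (- k ^+ 2 * F e t).
  apply: eq_Rintegral => t; rewrite inE /= in_itv /= => -[ht _].
  by rewrite second_derivativeE.
have -> : \int[lebesgue_measure]_(t in `]0, len e[ `&` pt e @^-1` A) f (pt e t) =
    \int[lebesgue_measure]_(t in `]0, len e[ `&` pt e @^-1` A)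
      ((- k ^+ 2)^-1 * (- k ^+ 2 * F e t)).
  apply: eq_Rintegral => t; rewrite inE /= in_itv /= => -[/andP[t0 tl] _].
  by rewrite mulKf // fE // !ltW.
rewrite [X in _ = _ * X]RintegralZl // mulrA.
by rewrite invrN mulrN mulfV ?sqrf_eq0 ?gt_eqF // mulN1r.
Qed.

End Eigenfunction.

Lemma sinusoidal_eigenvalue (R : realType) (G : metric_graph R) (k : R) :
  0 < k -> sinusoidal G k -> Defs.eigenvalue G (k ^+ 2).
Proof. by move=> k0 [x [d [h1 h2 h3]]]; exact: (eigenvalue_of_sinusoid k0 h1 h2 h3). Qed.

Lemma lambda1_le (R : realType) (G : metric_graph R) (k : R) :
  0 < k -> sinusoidal G k -> lambda1 G <= k ^+ 2.
Proof.
move=> k0 /(sinusoidal_eigenvalue k0) ek; rewrite /lambda1.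
set A := [set l | _]; have Ak : A (k ^+ 2) by split; rewrite ?sqrf_eq0 ?gt_eqF.
(* without a lower bound, the infimum is 0 by convention *)
have [hA|hA] := pselect (has_inf A); first by apply: ge_inf => //; case: hA.
by rewrite inf_out // sqr_ge0.
Qed.

(** * Piecewise linear functions with integer slopes *)

Section PiecewiseLinear.
Variables (R : realType) (G : metric_graph R).
Implicit Types (e : edge G) (p : gpoint G) (f g h : gpoint G -> R) (b : bool).

Let shift b (s t : R) := if b then s + t else s - t.

(** [f] has slope [m] at the parameter [s] of [e], in the direction [b]. *)
Definition germ f e (s : R) b (m : R) : Prop :=
  exists2 eps, 0 < eps & forall t, 0 < t < eps ->
    f (pt e (shift b s t)) = f (pt e s) + m * t.

Definition direction e (s : R) b : bool :=
  (0 <= s <= len e) && (if b then s < len e else 0 < s).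

(** Piecewise linearity with integer slopes, expressed locally: there are
    finitely many pieces by compactness. *)
Definition integral_pl f : Prop :=
  forall e s b, direction e s b -> exists m : int, germ f e s b m%:~R.

Definition edge_slope f e s b : R := slope f (pt e s) (e, b).

Lemma germ_slope f e s b m : direction e s b -> germ f e s b m ->
  edge_slope f e s b = m.
Proof.
move=> /andP[hs hb] [eps eps0 hf]; apply: (slope_germ eps0) => t ht.
have [_ bE] := base_pt hs hb.
by rewrite walkE bE /=; exact: hf.
Qed.

Lemma tangent_direction p w : w \in tangents p ->
  direction w.1 (base p w) w.2 /\ pt w.1 (base p w) = p.
Proof. by move=> /base_bounds[h1 h2 h3]; rewrite /direction h1. Qed.

Lemma slope_edge_slope f p w : w \in tangents p ->
  slope f p w = edge_slope f w.1 (base p w) w.2.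
Proof.
by move=> /tangent_direction[_ h]; rewrite /edge_slope h -surjective_pairing.
Qed.

Lemma slope_germP f : integral_pl f -> forall e s b, direction e s b ->
  germ f e s b (edge_slope f e s b).
Proof.
by move=> fpl e s b hd; have [m hm] := fpl e s b hd; rewrite (germ_slope hd hm).
Qed.

Lemma slope_int f : integral_pl f -> forall e s b, direction e s b ->
  exists m : int, edge_slope f e s b = m%:~R.
Proof.
by move=> fpl e s b hd; have [m hm] := fpl e s b hd; exists m; exact: germ_slope.
Qed.

Lemma germ_lin f g (a c : R) e s b m n : germ f e s b m -> germ g e s b n ->
  germ (fun p => a * f p + c * g p) e s b (a * m + c * n).
Proof.
move=> [e1 e10 h1] [e2 e20 h2]; exists (Num.min e1 e2); first by rewrite lt_min e10.
move=> t /andP[t0]; rewrite lt_min => /andP[te1 te2].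
by rewrite h1 ?t0 // h2 ?t0 //; ring.
Qed.

Lemma germ_cst (c : R) e s b : germ (fun=> c) e s b 0.
Proof. by exists 1 => // t _; rewrite mul0r addr0. Qed.

Lemma germ_lt f e s b m : germ f e s b m -> 0 < f (pt e s) ->
  exists2 eps, 0 < eps & forall t, 0 < t < eps -> 0 < f (pt e (shift b s t)).
Proof.
move=> [e1 e10 h1] fs.
have m0 : 0 < `|m| + 1 by rewrite ltr_wpDl.
exists (Num.min e1 (f (pt e s) / (`|m| + 1))); first by rewrite lt_min e10 divr_gt0.
move=> t /andP[t0]; rewrite lt_min => /andP[te1].
rewrite ltr_pdivlMr // => tm; rewrite h1 ?t0 //.
have := ler_norm (- m); rewrite normrN; move: tm t0; move: `|m| => a; nra.
Qed.

Lemma germ_max_gt f g e s b m n : germ f e s b m -> germ g e s b n ->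
  g (pt e s) < f (pt e s) -> germ (fun p => Num.max (f p) (g p)) e s b m.
Proof.
move=> hf hg fg; have hd := germ_lin 1 (-1) hf hg.
have [|e1 e10 h1] := germ_lt hd; first by lra.
have [e2 e20 h2] := hf; exists (Num.min e1 e2); first by rewrite lt_min e10.
move=> t /andP[t0]; rewrite lt_min => /andP[te1 te2].
have := h1 t; rewrite t0 te1 => /(_ isT) h.
have -> : Num.max (f (pt e s)) (g (pt e s)) = f (pt e s).
  by apply/max_idPl/ltW.
rewrite -h2 ?t0 //; apply/max_idPl; lra.
Qed.

Lemma germ_max_eq f g e s b m n : germ f e s b m -> germ g e s b n ->
  g (pt e s) = f (pt e s) ->
  germ (fun p => Num.max (f p) (g p)) e s b (Num.max m n).
Proof.
move=> [e1 e10 h1] [e2 e20 h2] fg; exists (Num.min e1 e2); first by rewrite lt_min e10.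
move=> t /andP[t0]; rewrite lt_min => /andP[te1 te2].
rewrite h1 ?t0 // h2 ?t0 // fg maxxx; case: (leP m n) => mn.
  by apply/max_idPr; rewrite lerD2l ler_wpM2r // ltW.
by apply/max_idPl; rewrite lerD2l ler_wpM2r // ltW.
Qed.

Lemma germ_maxC f g e s b m : germ (fun p => Num.max (g p) (f p)) e s b m ->
  germ (fun p => Num.max (f p) (g p)) e s b m.
Proof. by move=> [e1 e10 h]; exists e1 => // t /h; rewrite maxC [X in _ = X + _]maxC. Qed.

Lemma integral_pl_max f g : integral_pl f -> integral_pl g ->
  integral_pl (fun p => Num.max (f p) (g p)).
Proof.
move=> fpl gpl e s b hd; have [m hm] := fpl _ _ _ hd; have [n hn] := gpl _ _ _ hd.
case: (ltgtP (g (pt e s)) (f (pt e s))) => h.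
- by exists m; exact: germ_max_gt hm hn h.
- by exists n; apply: germ_maxC; exact: germ_max_gt hn hm h.
- have := germ_max_eq hm hn h.
  by case: leP => _ H; [exists n|exists m].
Qed.

Lemma integral_pl_sub f g : integral_pl f -> integral_pl g ->
  integral_pl (fun p => f p - g p).
Proof.
move=> fpl gpl e s b hd; have [m hm] := fpl _ _ _ hd; have [n hn] := gpl _ _ _ hd.
exists (m - n); have [eps eps0 H] := germ_lin 1 (-1) hm hn; exists eps => // t /H.
by rewrite intrB; lra.
Qed.

Lemma integral_pl_addc f (c : R) : integral_pl f -> integral_pl (fun p => f p + c).
Proof.
move=> fpl e s b hd; have [m [eps eps0 H]] := fpl _ _ _ hd.
by exists m, eps => // t /H ->; ring.
Qed.

(* At an interior point, the slopes are the derivatives of the function on both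
   sides. *)
Let slope_right f e s b m : direction e s b -> germ f e s b m ->
  exists2 eps, 0 < eps & forall t, 0 < t < eps ->
    edge_slope f e (shift b s t) b = m /\ edge_slope f e (shift b s t) (~~ b) = - m.
Proof.
move=> /andP[/andP[s0 sl] hb] [e1 e10 h1].
pose room := if b then len e - s else s.
have room0 : 0 < room by rewrite /room; move: hb; case: (b); rewrite ?subr_gt0.
exists (Num.min e1 room); first by rewrite lt_min e10.
move=> t /andP[t0]; rewrite lt_min => /andP[te tr].
have dir b' : direction e (shift b s t) b'.
  move: tr; rewrite /direction /shift /room; case: (b) => tr; case: b'; apply/andP;
   split; lra.
split; apply: germ_slope => //.
  exists (e1 - t); first by rewrite subr_gt0.
  move=> u /andP[u0 ut].
  have -> : shift b (shift b s t) u = shift b s (t + u) by rewrite /shift; case: (b); ring.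
  by rewrite !h1 ?t0 //; [ring|apply/andP; split; lra].
exists t => // u /andP[u0 ut].
have -> : shift (~~ b) (shift b s t) u = shift b s (t - u) by rewrite /shift; case: (b) => /=; ring.
by rewrite !h1 ?t0 //; [ring|apply/andP; split; lra].
Qed.

(** The slope of [f] does not jump at [s]. *)
Definition unbroken f e s := edge_slope f e s true = - edge_slope f e s false.

(** On both sides of a point, [f] is affine for a while; the edge is compact. *)
Lemma finitely_many_breaks f : integral_pl f -> forall e,
  exists B : seq R, forall u, 0 < u < len e -> u \notin B -> unbroken f e u.
Proof.
move=> fpl e; have l0 := len_gt0 e.
suff H x : 0 <= x <= len e -> exists B : seq R,
    forall u, 0 < u < x -> u \notin B -> unbroken f e u.
  by apply: H; rewrite lexx ltW.
apply: (real_induction (P := fun x => exists B : seq R,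
  forall u, 0 < u < x -> u \notin B -> unbroken f e u)).
- by exists [::] => u; lra.
- move=> {}x /andP[x0 xl] Px.
  have [|B hB] := Px x; first by rewrite x0 lexx.
  have hd : direction e x true by rewrite /direction x0 xl ltW.
  have [eps eps0 hs] := slope_right hd (slope_germP fpl hd).
  exists eps => // y /andP[xy ye] _; exists (x :: B) => u /andP[u0 uy].
  rewrite inE negb_or => /andP[ux uB]; have [lt|gt|eq] := ltgtP u x.
  + by apply: hB => //; rewrite u0.
  + have [|h1 h2] := hs (u - x); first by apply/andP; split; lra.
    by move: h1 h2; rewrite /shift addrC subrK /unbroken => -> /= ->; rewrite opprK.
  + by rewrite eq eqxx in ux.
- move=> {}x /andP[x0 xl] Px.
  have hd : direction e x false by rewrite /direction x0 xl ltW.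
  have [eps eps0 hs] := slope_right hd (slope_germP fpl hd).
  pose y := Num.max 0 (x - eps / 2).
  have y0 : 0 <= y by rewrite le_max lexx.
  have yx : y < x by rewrite gt_max x0 /=; lra.
  have ye : x - eps < y by rewrite lt_max; apply/orP; right; lra.
  have [|B hB] := Px y; first by rewrite y0.
  exists (y :: B) => u /andP[u0 ux].
  rewrite inE negb_or => /andP[uy uB]; have [lt|gt|eq] := ltgtP u y.
  + by apply: hB => //; rewrite u0.
  + have [|h1 h2] := hs (x - u); first by apply/andP; split; lra.
    move: h1 h2; rewrite /shift /unbroken.
    have -> : x - (x - u) = u by ring.
    by move=> /= -> ->.
  + by rewrite eq eqxx in uy.
Qed.

Lemma unbroken_slope f e (a c : R) : integral_pl f -> 0 <= a -> a < c -> c <= len e ->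
  (forall u, a < u < c -> unbroken f e u) ->
  edge_slope f e a true = - edge_slope f e c false.
Proof.
move=> fpl a0 ac cl hu.
pose F u := if u < c then edge_slope f e u true else - edge_slope f e c false.
have -> : edge_slope f e a true = F a by rewrite /F ac.
have -> : - edge_slope f e c false = F c by rewrite /F ltxx.
apply: (locally_constant (ltW ac)) => u /andP[h1 h2].
- have hd : direction e u true by rewrite /direction; apply/andP; split; lra.
  have [eps eps0 hs] := slope_right hd (slope_germP fpl hd).
  exists (Num.min eps (c - u)); first by rewrite lt_min eps0 subr_gt0.
  move=> y /andP[uy yu] _; have yc : y < c by move: yu; rewrite -ltrBlDl lt_min; lra.
  have ye : y - u < eps by move: yu; rewrite -ltrBlDl lt_min; lra.
  rewrite /F yc h2; have [|] := hs (y - u); first by rewrite subr_gt0 uy.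
  by rewrite /shift addrC subrK.
- have hd : direction e u false by rewrite /direction; apply/andP; split; lra.
  have [eps eps0 hs] := slope_right hd (slope_germP fpl hd).
  exists eps => // y /andP[yu uy] ay; have yc : y < c by lra.
  rewrite /F yc; have [|_] := hs (u - y); first by apply/andP; split; lra.
  rewrite /shift; have -> : u - (u - y) = y by ring.
  move=> ->; case: ltP => uc; first by rewrite (hu u) // h1.
  by have -> : u = c by apply/eqP; rewrite eq_le h2.
Qed.

(** At the two ends of an edge of a fine enough subdivision, the outgoing slopes
    cancel out. *)
Lemma sum_slopes_finite f (Q : seq (gpoint G)) : integral_pl f ->
  exists P : seq (gpoint G), [/\ uniq P, {subset Q <= P},
    \sum_(p <- P) sum_slopes f p = 0 & forall p, p \notin P -> sum_slopes f p = 0].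
Proof.
move=> fpl.
have [Br hBr] := choice (finitely_many_breaks fpl).
pose P0 := Q ++ flatten [seq [seq pt e u | u <- Br e] | e <- enum (edge G)].
have [H [B [_ [_ hP]]]] := refinement_at P0 (trivial_subdivision G).
have brk e u : 0 < u < len e -> (forall v, sub_vert B v <> pt e u) -> unbroken f e u.
  move=> hu nv; apply: hBr => //; apply/negP => uB.
  have [|v vE] := hP (pt e u); last exact: (nv v).
  rewrite mem_cat; apply/orP; right; apply/flatten_mapP; exists e; rewrite ?mem_enum //.
  exact: map_f.
exists [seq sub_vert B u | u <- enum (vert H)]; split.
- by rewrite map_inj_uniq ?enum_uniq //; exact: sub_vert_inj.
- move=> q qQ; have [|v <-] := hP q; first by rewrite mem_cat qQ.
  by rewrite map_f // mem_enum.
- rewrite big_map big_enum /=.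
  transitivity (\sum_u (\sum_(k | src k == u) edge_slope f (sub_edge B k) (sub_offset B k) true
    + \sum_(k | tgt k == u) edge_slope f (sub_edge B k) (sub_offset B k + len k) false)).
    apply: eq_bigr => u _; rewrite -(sub_directions B) /sum_slopes.
    by apply: eq_bigr => w; exact: slope_edge_slope.
  have part (h : edge H -> vert H) (F : edge H -> R) :
      \sum_u \sum_(k | h k == u) F k = \sum_k F k.
    by rewrite [RHS](partition_big h xpredT).
  rewrite big_split /= !part -big_split big1 // => k _ /=.
  rewrite (@unbroken_slope f _ _ (sub_offset B k + len k)) ?addNr //.
  + exact: sub_offset_ge0.
  + by rewrite ltrDl len_gt0.
  + exact: sub_offset_le.
  + move=> u hu; apply: brk; last by move=> v; exact: sub_interior.
    by have := sub_offset_ge0 B k; have := sub_offset_le B k; lra.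
- move=> p pP.
  have nv v : sub_vert B v <> p.
    by move=> vp; move: pP; rewrite -vp map_f // mem_enum.
  case: p pP nv => [v|x] _ nv; first by have [u /nv] := sub_old_vert B v.
  rewrite /sum_slopes (eq_bigr (fun w => edge_slope f w.1 (base (inr x) w) w.2)); last first.
    by move=> w; exact: slope_edge_slope.
  rewrite -(pt_val x) (sum_tangents_interior (edge_slope f) (valP x)).
  have := @brk (val x).1 (val x).2 (valP x); rewrite pt_val => /(_ nv) ->.
  by rewrite addNr.
Qed.

Lemma sum_slopes_int f p : integral_pl f -> exists m : int, sum_slopes f p = m%:~R.
Proof.
move=> fpl.
have h w : exists m : int, w \in tangents p -> slope f p w = m%:~R.
  have [wp|_] := boolP (w \in tangents p); last by exists 0.
  have [hd _] := tangent_direction wp; have [m hm] := slope_int fpl hd.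
  by exists m; rewrite slope_edge_slope.
have [m hm] := choice h; exists (\sum_(w in tangents p) m w).
by rewrite rmorph_sum /=; apply: eq_bigr => w; exact: hm.
Qed.

End PiecewiseLinear.

(** * Divisors with light components in their complement *)

Section Slopes.
Variables (R : realType) (G : metric_graph R).
Implicit Types (p : gpoint G) (f g h : gpoint G -> R).

Lemma tangent_germ f p w : integral_pl f -> w \in tangents p ->
  germ f w.1 (base p w) w.2 (slope f p w).
Proof.
move=> fpl wp; rewrite slope_edge_slope //; apply: slope_germP => //.
by have [] := tangent_direction wp.
Qed.

Lemma slope_unique f p w (m : R) : w \in tangents p ->
  germ f w.1 (base p w) w.2 m -> slope f p w = m.
Proof.
move=> wp hm; rewrite slope_edge_slope //; apply: germ_slope hm.
by have [] := tangent_direction wp.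
Qed.

Lemma slope_sub f g p w : integral_pl f -> integral_pl g -> w \in tangents p ->
  slope (fun p => f p - g p) p w = slope f p w - slope g p w.
Proof.
move=> fpl gpl wp; apply: slope_unique => //.
have [eps eps0 H] := germ_lin 1 (-1) (tangent_germ fpl wp) (tangent_germ gpl wp).
by exists eps => // t /H; lra.
Qed.

Lemma slope_addc f (c : R) p w : integral_pl f -> w \in tangents p ->
  slope (fun p => f p + c) p w = slope f p w.
Proof.
move=> fpl wp; apply: slope_unique => //.
have [eps eps0 H] := tangent_germ fpl wp.
by exists eps => // t /H ->; ring.
Qed.

Lemma slope_max_gt f g p w : integral_pl f -> integral_pl g -> w \in tangents p ->
  g p < f p -> slope (fun p => Num.max (f p) (g p)) p w = slope f p w.
Proof.
move=> fpl gpl wp fg; apply: slope_unique => //.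
apply: germ_max_gt (tangent_germ fpl wp) (tangent_germ gpl wp) _.
by have [_ ->] := tangent_direction wp.
Qed.

Lemma slope_max_eq f g p w : integral_pl f -> integral_pl g -> w \in tangents p ->
  f p = g p ->
  slope (fun p => Num.max (f p) (g p)) p w = Num.max (slope f p w) (slope g p w).
Proof.
move=> fpl gpl wp fg; apply: slope_unique => //.
apply: germ_max_eq (tangent_germ fpl wp) (tangent_germ gpl wp) _.
by have [_ ->] := tangent_direction wp.
Qed.

Lemma sum_slopes_sub f g p : integral_pl f -> integral_pl g ->
  sum_slopes (fun p => f p - g p) p = sum_slopes f p - sum_slopes g p.
Proof.
by move=> fpl gpl; rewrite /sum_slopes -sumrB; apply: eq_bigr => w; exact: slope_sub.
Qed.

Lemma sum_slopes_addc f (c : R) p : integral_pl f ->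
  sum_slopes (fun p => f p + c) p = sum_slopes f p.
Proof. by move=> fpl; apply: eq_bigr => w; exact: slope_addc. Qed.

Lemma sum_slopes_max_ge f g p : integral_pl f -> integral_pl g ->
  f p = g p -> sum_slopes f p <= sum_slopes (fun p => Num.max (f p) (g p)) p.
Proof.
move=> fpl gpl fg; apply: ler_sum => w wp.
by rewrite slope_max_eq // le_max lexx.
Qed.

Lemma max_funC f g : (fun p => Num.max (f p) (g p)) = (fun p => Num.max (g p) (f p)).
Proof. by apply/funext => p; rewrite maxC. Qed.

End Slopes.

Section Connection.
Variables (R : realType) (G : metric_graph R).
Implicit Types (p : gpoint G).

(** [x] and [y] are in the same component of the complement of [S]. *)
Inductive linked (S : gpoint G -> Prop) : gpoint G -> gpoint G -> Prop :=
| linked_refl x : ~ S x -> linked S x x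
| linked_step (e : edge G) (s t : R) z : 0 <= s <= len e -> 0 <= t <= len e ->
    (forall u, Num.min s t <= u <= Num.max s t -> ~ S (pt e u)) ->
    linked S (pt e t) z -> linked S (pt e s) z.

Lemma linked_trans S x y z : linked S x y -> linked S y z -> linked S x z.
Proof.
move=> xy; elim: xy z => // e s t {}y hs ht h _ IH z yz.
exact: linked_step hs ht h (IH _ yz).
Qed.

Lemma linked_l S x y : linked S x y -> ~ S x.
Proof.
case=> [//|e s t z hs ht h _]; apply: h.
by rewrite ge_min le_max lexx.
Qed.

Lemma linked_sym S x y : linked S x y -> linked S y x.
Proof.
elim=> [z nz|e s t z hs ht h tz zt]; first exact: linked_refl.
apply: linked_trans zt _; apply: (@linked_step _ e t s) => //.
- by move=> u; rewrite minC maxC; exact: h.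
- by apply: linked_refl; apply: h; rewrite ge_min le_max lexx.
Qed.

Lemma linked_r S x y : linked S x y -> ~ S y.
Proof. by move/linked_sym/linked_l. Qed.

End Connection.

Section Descent.
Variables (R : realType) (G : metric_graph R) (E0 : gpoint G -> R).
Implicit Types (p : gpoint G) (f g h : gpoint G -> R).

(** The multiplicity of [p] in the divisor [E0 + div(g)]. *)
Definition chips g p : R := E0 p + sum_slopes g p.

Definition occupied g p : Prop := 0 < chips g p.

(** The functions [g] such that [E0 + div(g)] is effective. *)
Definition effective_at g : Prop := integral_pl g /\ forall p, 0 <= chips g p.

Lemma effective_addc g (c : R) : effective_at g -> effective_at (fun p => g p + c).
Proof.
move=> [gpl g0]; split; first exact: integral_pl_addc.
by move=> p; rewrite /chips sum_slopes_addc //; exact: g0.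
Qed.

Lemma chips_addc g (c : R) p : effective_at g ->
  chips (fun p => g p + c) p = chips g p.
Proof. by case=> gpl _; rewrite /chips sum_slopes_addc. Qed.

Lemma chips_max_gt f g p : effective_at f -> effective_at g -> g p < f p ->
  chips (fun p => Num.max (f p) (g p)) p = chips f p.
Proof.
move=> [fpl _] [gpl _] fg; congr (_ + _); apply: eq_bigr => w wp.
exact: slope_max_gt.
Qed.

Lemma chips_max_ge f g p : effective_at f -> effective_at g -> f p = g p ->
  chips f p <= chips (fun p => Num.max (f p) (g p)) p.
Proof. by move=> [fpl _] [gpl _] fg; rewrite lerD2l; exact: sum_slopes_max_ge. Qed.

Lemma effective_max f g : effective_at f -> effective_at g ->
  effective_at (fun p => Num.max (f p) (g p)).
Proof.
move=> ef eg; split; first by apply: integral_pl_max; [case: ef|case: eg].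
move=> p; have [h|h|h] := ltgtP (f p) (g p).
- by rewrite max_funC chips_max_gt //; case: eg.
- by rewrite chips_max_gt //; case: ef.
- by apply: le_trans (chips_max_ge ef eg h); case: ef.
Qed.

(** The slopes of the maximum are at least those of [f]; without chips of the
    maximum at [p], their sum cannot be larger, so they are the slopes of [f], and
    those of [g] as well. *)
Lemma slope_eq_of_unoccupied f g p : effective_at f -> effective_at g -> f p = g p ->
  ~ occupied (fun p => Num.max (f p) (g p)) p ->
  forall w, w \in tangents p -> slope f p w = slope g p w.
Proof.
move=> ef eg fg no.
have le a b : effective_at a -> effective_at b -> a p = b p ->
    ~ occupied (fun p => Num.max (a p) (b p)) p ->
    forall w, w \in tangents p -> slope b p w <= slope a p w.
  move=> ea eb ab {}no w wp; have [apl _] := ea; have [bpl _] := eb.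
  have a0 : 0 <= chips a p by case: ea.
  have mle w' : w' \in tangents p ->
      slope a p w' <= slope (fun p => Num.max (a p) (b p)) p w'.
    by move=> wp'; rewrite slope_max_eq // le_max lexx.
  have m0 : chips (fun p => Num.max (a p) (b p)) p <= 0 by rewrite leNgt; exact/negP.
  have : sum_slopes (fun p => Num.max (a p) (b p)) p <= sum_slopes a p.
    by move: m0 a0; rewrite /chips; lra.
  rewrite /sum_slopes (bigD1 w) //= [leRHS](bigD1 w) //= slope_max_eq // => H.
  have : \sum_(i in tangents p | i != w) slope a p i <=
    \sum_(i in tangents p | i != w) slope (fun p => Num.max (a p) (b p)) p i.
    by apply: ler_sum => i /andP[ip _]; exact: mle.
  move=> H'; have : Num.max (slope a p w) (slope b p w) <= slope a p w by lra.
  by rewrite ge_max => /andP[].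
move=> w wp; apply/eqP; rewrite eq_le le //; first exact: le.
by rewrite max_funC.
Qed.

Lemma unoccupied_of_max f g p : effective_at f -> effective_at g -> f p = g p ->
  ~ occupied (fun p => Num.max (f p) (g p)) p -> ~ occupied f p.
Proof.
move=> ef eg fg no h; apply: no; apply: lt_le_trans h _.
exact: chips_max_ge.
Qed.

(** At a zero of [f - g] without chips of the maximum, all the slopes of [f - g]
    vanish by [slope_eq_of_unoccupied]: the zero cannot be left. *)
Lemma sg_piece f g e (a c : R) : effective_at f -> effective_at g ->
  0 <= a -> a <= c -> c <= len e ->
  (forall u, a <= u <= c -> ~ occupied (fun p => Num.max (f p) (g p)) (pt e u)) ->
  Num.sg (f (pt e a) - g (pt e a)) = Num.sg (f (pt e c) - g (pt e c)).
Proof.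
move=> ef eg a0 ac cl no; have [fpl _] := ef; have [gpl _] := eg.
pose d p := f p - g p.
have dpl : integral_pl d by exact: integral_pl_sub.
have near u b : a <= u <= c -> direction e u b -> exists2 eps, 0 < eps &
    forall t, 0 < t < eps -> Num.sg (d (pt e (if b then u + t else u - t))) =
      Num.sg (d (pt e u)).
  move=> hu hd; have hm := slope_germP dpl hd.
  case: (ltgtP (d (pt e u)) 0) => h.
  - have [|eps eps0 H] := germ_lt (germ_lin (-1) 0 hm (germ_cst 0 e u b)).
      by rewrite mul0r; lra.
    exists eps => // t /H Ht; rewrite (ltr0_sg h) ltr0_sg //.
    by move: Ht; rewrite mul0r; lra.
  - have [eps eps0 H] := germ_lt hm h.
    by exists eps => // t /H Ht; rewrite (gtr0_sg h) gtr0_sg.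
  - have fg : f (pt e u) = g (pt e u) by move: h; rewrite /d; lra.
    have [hu' hb] := andP hd.
    have [wp bE] := base_pt hu' hb.
    have se := slope_eq_of_unoccupied ef eg fg (no _ hu) wp.
    have s0 : edge_slope d e u b = 0.
      rewrite /edge_slope (slope_sub fpl gpl wp) se subrr //.
    move: hm; rewrite s0 => -[eps eps0 H]; exists eps => // t /H ->.
    by rewrite mul0r addr0.
apply: (@locally_constant R R (fun u => Num.sg (d (pt e u)))) => // u /andP[h1 h2].
- have [||eps eps0 H] := near u true; first by rewrite h1 ltW.
    by rewrite /direction; apply/andP; split; lra.
  exists eps => // y /andP[uy yu] _; have := H (y - u).
  have -> : u + (y - u) = y by ring.
  by apply; apply/andP; split; lra.
- have [||eps eps0 H] := near u false; first by rewrite h2 ltW.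
    by rewrite /direction; apply/andP; split; lra.
  exists eps => // y /andP[uy yu] _; have := H (u - y).
  have -> : u - (u - y) = y by ring.
  by apply; apply/andP; split; lra.
Qed.

Lemma sg_linked f g x y : effective_at f -> effective_at g ->
  linked (occupied (fun p => Num.max (f p) (g p))) x y ->
  Num.sg (f x - g x) = Num.sg (f y - g y).
Proof.
move=> ef eg; elim=> // e s t z /andP[s0 sl] /andP[t0 tl] no _ <-.
have [st|ts] := leP s t.
  by apply: sg_piece => // u hu; apply: no; move: hu; case: (leP s t); lra.
by apply/esym/sg_piece => //; [exact: ltW|move=> u hu; apply: no; move: hu; case: (leP s t); lra].
Qed.

(** Where [f = g], a chip of [f] or of [g] would be one of the maximum; and the
    equality spreads along the component by [sg_linked]. *)
Lemma linked_flat f g x y : effective_at f -> effective_at g ->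
  linked (occupied (fun p => Num.max (f p) (g p))) x y -> f x = g x ->
  linked (occupied f) x y /\ linked (occupied g) x y.
Proof.
move=> ef eg; elim=> [z nz|e s t z hs ht no tz IH] fg.
  split; apply: linked_refl; first exact: unoccupied_of_max nz.
  by apply: (unoccupied_of_max eg ef) => //; rewrite max_funC.
have feq u : Num.min s t <= u <= Num.max s t -> f (pt e u) = g (pt e u).
  move=> hu; have [s0 sl] := andP hs; have [t0 tl] := andP ht.
  have : linked (occupied (fun p => Num.max (f p) (g p))) (pt e s) (pt e u).
    apply: (@linked_step _ _ _ e s u) => //.
    - by move: hu; case: (leP s t); lra.
    - by move=> v hv; apply: no; move: hu hv; case: (leP s t); case: (leP s u); lra.
    - by apply: linked_refl; exact: no.
  move/(sg_linked ef eg); rewrite fg subrr sgr0 => /esym/eqP.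
  by rewrite sgr_eq0 subr_eq0 => /eqP.
have [|l1 l2] := IH; first by apply: feq; rewrite ge_min le_max lexx !orbT.
split; apply: (@linked_step _ _ _ e s t) => // u hu.
  by apply: (unoccupied_of_max ef eg) => //; [exact: feq|exact: no].
apply: (unoccupied_of_max eg ef); first by rewrite feq.
by rewrite max_funC; exact: no.
Qed.

End Descent.

(** The least value [t] of [f] above which there is at most half of the weight. *)
Lemma weighted_median (R : realType) (I : finType) (w f : I -> R) (i0 : I) :
  (forall i, 0 <= w i) ->
  exists t, \sum_(i | f i < t) w i <= (\sum_i w i) / 2 /\
            \sum_(i | t < f i) w i <= (\sum_i w i) / 2.
Proof.
move=> w0; set W := \sum_i w i.
have W0 : 0 <= W by exact: sumr_ge0.
pose T i := \sum_(j | f i < f j) w j <= W / 2.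
have Tmax : T [arg max_(i > i0) f i]%O.
  case: arg_maxP => // i _ hi; rewrite /T big_pred0 ?divr_ge0 // => j.
  by apply/negbTE; rewrite -leNgt; exact: hi.
pose i1 := [arg min_(i < [arg max_(i > i0) f i]%O | T i) f i]%O.
have [Ti1 i1min] : T i1 /\ forall j, T j -> f i1 <= f j by rewrite /i1; case: arg_minP.
exists (f i1); split => //.
have [/existsP[j1 hj1]|/existsPn no] := boolP [exists j, f j < f i1]; last first.
  by rewrite big_pred0 ?divr_ge0 // => j; exact/negbTE/no.
pose j0 := [arg max_(j > j1 | f j < f i1) f j]%O.
have [j0lt j0max] : f j0 < f i1 /\ forall j, f j < f i1 -> f j <= f j0.
  by rewrite /j0; case: arg_maxP.
have : ~~ T j0 by apply/negP => /i1min; rewrite leNgt j0lt.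
rewrite /T -ltNge => h.
have WE : W = \sum_(j | f j0 < f j) w j + \sum_(j | f j < f i1) w j.
  rewrite /W (bigID (fun j => f j0 < f j)) /=; congr (_ + _); apply: eq_bigl => j.
  rewrite -leNgt; apply/idP/idP => [|/j0max//]; move=> h1; exact: le_lt_trans j0lt.
move: h; rewrite {1 2}WE; lra.
Qed.

Section DescentTheorem.
Variables (R : realType) (G : metric_graph R) (E0 : gpoint G -> R).
Variables (I : finType) (X : I -> gpoint G) (w : I -> R).
Hypothesis w0 : forall i, 0 <= w i.
Let W := \sum_i w i.

Definition component_weight (g : gpoint G -> R) (x : gpoint G) : R :=
  \sum_(i | `[< linked (occupied E0 g) x (X i) >]) w i.

(** If every effective divisor left a component of more than half of the total
    weight, the number of weighted points in such a component could be lowered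
    forever: a point of it can be occupied by another divisor, and on the way
    from one divisor to the other, at the level where the weights are balanced,
    the component of large weight is untouched by both divisors, hence smaller. *)
Theorem balanced_divisor : (exists g, effective_at E0 g) ->
  (forall p, exists2 h, effective_at E0 h & occupied E0 h p) ->
  exists2 g, effective_at E0 g & forall x, component_weight g x <= W / 2.
Proof.
move=> [g0 eg0] move_to; apply: contrapT => nobal.
have heavy g : effective_at E0 g -> exists x, W / 2 < component_weight g x.
  move=> eg; apply: contrapT => H; apply: nobal; exists g => // x.
  by rewrite leNgt; apply/negP => hx; apply: H; exists x.
have W2 : 0 <= W / 2 by rewrite divr_ge0 // sumr_ge0.
pose cls g x := [pred i | `[< linked (occupied E0 g) x (X i) >]].
suff no n g x : effective_at E0 g -> (#|cls g x| < n)%N -> ~ W / 2 < component_weight g x.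
  by have [x hx] := heavy _ eg0; apply: (no _ g0 x eg0 (ltnSn _)).
elim: n g x => // n IH g x eg cn hx.
have [i0 i0x] : exists i, cls g x i.
  apply: contrapT => H; move: hx; rewrite /component_weight big_pred0 ?ltNge ?W2 // => i.
  by apply/negbTE/negP => hi; apply: H; exists i.
have [h eh hocc] := move_to (X i0).
have [t0 [med1 med2]] := weighted_median (fun i => h (X i) - g (X i)) i0 w0.
pose g2 p := g p + t0.
have eg2 : effective_at E0 g2 by exact: effective_addc.
pose m p := Num.max (h p) (g2 p).
have em : effective_at E0 m by exact: effective_max.
have [y hy] := heavy _ em.
have sum_le (P Q : pred I) : (forall i, P i -> Q i) -> \sum_(i | P i) w i <= \sum_(i | Q i) w i.
  move=> PQ; rewrite [leLHS]big_mkcond [leRHS]big_mkcond; apply: ler_sum => i _.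
  by case: ifP => [/PQ ->//|_]; case: ifP.
have sgE i : cls m y i -> Num.sg (h y - g2 y) = Num.sg (h (X i) - g2 (X i)).
  by move=> /asboolP; exact: sg_linked.
have hyE : h y = g2 y.
  apply/eqP; rewrite -subr_eq0 -sgr_eq0; apply/eqP.
  case: (ltgtP (h y - g2 y) 0) => hlt; last by rewrite hlt sgr0.
    exfalso; move: hy; apply/negP; rewrite -leNgt; apply: le_trans med1.
    apply: sum_le => i hi; have := sgE i hi; rewrite (ltr0_sg hlt) => /esym/eqP.
    by rewrite sgr_cp0 /g2; lra.
  exfalso; move: hy; apply/negP; rewrite -leNgt; apply: le_trans med2.
  apply: sum_le => i hi; have := sgE i hi; rewrite (gtr0_sg hlt) => /esym/eqP.
  by rewrite sgr_cp0 /g2; lra.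
have flat i : cls m y i -> linked (occupied E0 h) y (X i) /\ linked (occupied E0 g) y (X i).
  move=> /asboolP l; have [l1 l2] := linked_flat eh eg2 l hyE; split => //.
  have -> // : occupied E0 g = occupied E0 g2.
  by apply/funext => p; rewrite /occupied /g2 chips_addc.
(* two sets of more than half of the total weight meet *)
have [i1 [i1x i1y]] : exists i, cls g x i /\ cls m y i.
  apply: contrapT => H.
  have : component_weight g x + component_weight m y <= W.
    rewrite /component_weight /W [leRHS](bigID (cls g x)) /= lerD2l; apply: sum_le => i hi.
    by apply/negP => hi'; apply: H; exists i.
  by move: hx hy; lra.
have xy : linked (occupied E0 g) x y.
  have [_ l] := flat _ i1y; apply: linked_trans (linked_sym l); exact/asboolP.
apply: (IH m y em) => //; move: cn; rewrite ltnS; apply: leq_trans.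
apply: proper_card; apply/properP; split.
  apply/fintype.subsetP => i hi; have [_ l] := flat _ hi.
  by apply/asboolP; exact: linked_trans l.
exists i0 => //; apply/negP => hi; have [l _] := flat _ hi.
exact: (linked_r l).
Qed.

End DescentTheorem.

(** The multiplicities of an effective divisor are integers of sum [d]. *)
Lemma occupied_finite (R : realType) (G : metric_graph R) (E0 : gpoint G -> R)
    (Q : seq (gpoint G)) (d : nat) (g : gpoint G -> R) :
  (forall p, exists m : int, E0 p = m%:~R) ->
  (forall P, uniq P -> {subset Q <= P} -> \sum_(p <- P) E0 p = d%:R) ->
  (forall p, p \notin Q -> E0 p = 0) ->
  effective_at E0 g ->
  exists S : seq (gpoint G), [/\ uniq S, forall p, occupied E0 g p <-> p \in S,
    (size S <= d)%N & (0 < d)%N -> S != [::]].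
Proof.
move=> E0int E0d E0Q [gpl g0].
have [P [uP QP sP P0]] := sum_slopes_finite Q gpl.
have cP : \sum_(p <- P) chips E0 g p = d%:R.
  by rewrite big_split /= sP addr0 E0d.
pose S := [seq p <- P | 0 < chips E0 g p].
have cS : \sum_(p <- S) chips E0 g p = d%:R.
  rewrite -cP big_filter big_mkcond; apply: eq_bigr => p _.
  by case: ltP => // h; apply/eqP; rewrite eq_le g0 h.
exists S; split.
- exact: filter_uniq.
- move=> p; rewrite mem_filter; split=> [h|/andP[]//]; apply/andP; split => //.
  apply: contraPT h => pP; rewrite /occupied /chips P0 // E0Q ?addr0 ?ltxx //.
  by apply: contra pP => /QP.
- rewrite -(ler_nat R) -cS -sum1_size natr_sum big_seq [leRHS]big_seq.
  apply: ler_sum => p; rewrite mem_filter => /andP[h _].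
  have [m mE] := E0int p; have [n nE] := sum_slopes_int p gpl.
  by move: h; rewrite /chips mE nE -intrD ltr0z ler1z.
- move=> d0; apply/eqP => S0; move: cS; rewrite S0 big_nil => /esym/eqP.
  by rewrite pnatr_eq0; lia.
Qed.

(** * Rational functions in a given direction *)

Section RationalFunctions.
Variables (R : realType) (G : metric_graph R).
Implicit Types (e : edge G) (p : gpoint G) (f : gpoint G -> R).

Let shift (b : bool) (s t : R) := if b then s + t else s - t.

Lemma avoid_finite (Q : seq (gpoint G)) e s b : direction e s b ->
  exists2 eps, 0 < eps & forall t, 0 < t < eps ->
    0 < shift b s t < len e /\ pt e (shift b s t) \notin Q.
Proof.
move=> /andP[/andP[s0 sl] hb].
pose room := if b then len e - s else s.
have room0 : 0 < room by rewrite /room; move: hb; case: (b); rewrite ?subr_gt0.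
have inroom t : 0 < t < room -> 0 < shift b s t < len e.
  by rewrite /room /shift; case: (b) => /andP[t0 tr]; apply/andP; split; lra.
elim: Q => [|q Q [eps eps0 IH]]; first by exists room => // t /inroom.
have [[t1 /andP[t10 t1r] qE]|nq] :=
  pselect (exists2 t1, 0 < t1 < room & pt e (shift b s t1) = q).
  exists (Num.min eps t1); first by rewrite lt_min eps0.
  move=> t /andP[t0]; rewrite lt_min => /andP[te tt1].
  have [|h1 h2] := IH t; first by rewrite t0.
  split=> //; rewrite inE negb_or h2 andbT -qE; apply/eqP => h.
  have [|_ st] := pt_inj h1 _ h.
    have := inroom t1; rewrite t10 t1r => /(_ isT)/andP[? ?].
    by rewrite !ltW.
  by move: st; rewrite /shift; case: (b); lra.
exists (Num.min eps room); first by rewrite lt_min eps0.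
move=> t /andP[t0]; rewrite lt_min => /andP[te tr].
have [|h1 h2] := IH t; first by rewrite t0.
split=> //; rewrite inE negb_or h2 andbT; apply/eqP => h.
by apply: nq; exists t => //; rewrite t0.
Qed.

(** The slopes are locally constant, hence constant, and so are the constant terms;
    continuity at 0 identifies the latter with [phi 0]. *)
Lemma locally_affine (phi : R -> R) (eps : R) : 0 < eps ->
  {for 0, continuous phi} ->
  (forall t, 0 < t < eps -> exists m : int, exists2 del, 0 < del &
     forall u, `|u - t| < del -> phi u = phi t + m%:~R * (u - t)) ->
  exists m : int, forall t, 0 < t < eps -> phi t = phi 0 + m%:~R * t.
Proof.
move=> eps0 c0 loc.
have loc' t : exists m : int, 0 < t < eps -> exists2 del, 0 < del &
     forall u, `|u - t| < del -> phi u = phi t + m%:~R * (u - t).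
  by have [/loc[m hm]|ht] := boolP (0 < t < eps); [exists m|exists 0].
have [m hm] := choice loc'.
have mloc t : 0 < t < eps -> exists2 del, 0 < del &
    forall u, `|u - t| < del -> 0 < u < eps -> m u = m t.
  move=> ht; have [del del0 hd] := hm t ht; exists del => // u ut hu.
  have [del' del'0 hd'] := hm u hu.
  pose h := Num.min (del' / 2) ((del - `|u - t|) / 2).
  have h0 : 0 < h by rewrite lt_min divr_gt0 //= divr_gt0 // subr_gt0.
  have h1 : h <= del' / 2 by rewrite ge_min lexx.
  have h2 : h <= (del - `|u - t|) / 2 by rewrite ge_min lexx orbT.
  have e1 : phi (u + h) = phi u + (m u)%:~R * h.
    have uh : u + h - u = h by ring.
    by rewrite hd' uh // (gtr0_norm h0); lra.
  have e2 := hd _ ut.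
  have e3 : phi (u + h) = phi t + (m t)%:~R * (u + h - t).
    apply: hd; have -> : u + h - t = (u - t) + h by ring.
    by rewrite (le_lt_trans (ler_normD _ _)) // (gtr0_norm h0); lra.
  have : (m u)%:~R * h = (m t)%:~R * h :> R by move: e1 e2 e3 => -> ->; lra.
  by move/(mulIf (lt0r_neq0 h0))/intr_inj.
have const_loc (F : R -> R) : (forall t, 0 < t < eps -> exists2 del, 0 < del &
    forall u, `|u - t| < del -> 0 < u < eps -> F u = F t) ->
    forall t u, 0 < t < eps -> 0 < u < eps -> F t = F u.
  move=> hF t u; wlog tu : t u / t <= u => [H ht hu|/andP[t0 te] /andP[u0 ue]].
    by have [/H->//|/ltW/H->] := leP t u.
  apply: locally_constant => // v /andP[h1 h2].
    have [|del del0 hd] := hF v; first by apply/andP; split; lra.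
    exists del => // y /andP[vy yv] yu; apply: hd; last by apply/andP; split; lra.
    by rewrite gtr0_norm; lra.
  have [|del del0 hd] := hF v; first by apply/andP; split; lra.
  exists del => // y /andP[vy yv] yu; apply: hd; last by apply/andP; split; lra.
  by rewrite ltr0_norm; lra.
have e20 : 0 < eps / 2 < eps by apply/andP; split; lra.
pose m0 := m (eps / 2).
have mE t : 0 < t < eps -> m t = m0.
  move=> ht; apply/(@intr_inj R).
  apply: (const_loc (fun t => (m t)%:~R)) => // v hv.
  by have [del del0 hd] := mloc v hv; exists del => // u ut hu; rewrite hd.
pose c := phi (eps / 2) - m0%:~R * (eps / 2).
have phiE t : 0 < t < eps -> phi t = c + m0%:~R * t.
  move=> ht; suff : phi t - m0%:~R * t = c by move=> <-; ring.
  apply: (const_loc (fun t => phi t - m0%:~R * t)) => // v hv.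
  have [del del0 hd] := hm v hv; exists del => // u ut hu.
  by rewrite (hd u ut) (mE v hv); ring.
exists m0 => t ht; rewrite phiE //; congr (_ + _).
apply/eqP; rewrite eq_sym -subr_eq0; apply: contraT => ne.
pose eta := `|phi 0 - c|.
have eta0 : 0 < eta by rewrite normr_gt0.
have /cvgrPdist_lt /(_ (eta / 2)) := c0; rewrite divr_gt0 // => /(_ isT).
move=> /nbhs_ballP[r /= r0 hr].
have m10 : 0 < `|m0%:~R : R| + 1 by rewrite ltr_wpDl.
pose u := Num.min (Num.min (r / 2) (eps / 2)) (eta / 2 / (`|m0%:~R : R| + 1)).
have u0 : 0 < u by rewrite !lt_min !divr_gt0.
have ur : u <= r / 2 by rewrite !ge_min lexx.
have ue : u <= eps / 2 by rewrite !ge_min lexx orbT.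
have um : u * (`|m0%:~R : R| + 1) <= eta / 2.
  by rewrite -ler_pdivlMr // !ge_min lexx !orbT.
have : `|phi 0 - phi u| < eta / 2.
  by apply: hr; rewrite /ball /= sub0r normrN gtr0_norm //; lra.
rewrite (phiE u); last by apply/andP; split; lra.
have : eta <= `|phi 0 - (c + m0%:~R * u)| + `|m0%:~R * u|.
  have -> : eta = `|(phi 0 - (c + m0%:~R * u)) + m0%:~R * u|.
    by rewrite /eta; congr (`|_|); ring.
  exact: ler_normD.
rewrite normrM (gtr0_norm u0); move: um; lra.
Qed.

(** Close to a point, in a given direction, the exceptional points are avoided. *)
Lemma rational_integral_pl f : rational_function f -> integral_pl f.
Proof.
move=> [fc [S /finite_seqP[Q SQ] hS]] e s b hd.
have [eps eps0 hav] := avoid_finite Q hd.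
pose phi t := f (pt e (shift b s t)).
have sc (b' : bool) : continuous (shift b' s).
  move=> t; rewrite /shift; case: b'; apply: cvgD; do ?exact: cvg_cst.
    exact: cvg_id.
  by apply: cvgN; exact: cvg_id.
have phic : continuous phi.
  move=> t; apply: (@continuous_comp _ _ _ (shift b s) (fun u => f (pt e u))).
    exact: sc.
  by apply: continuous_comp; [exact: pt_continuous|exact: fc].
have [||m hm] := @locally_affine phi eps eps0; first exact: phic.
  move=> t /hav[ht hQ]; have [|m] := hS e (shift b s t) ht; first by rewrite SQ; exact/negP.
  move=> /nbhs_ballP[del /= del0 hm]; exists (if b then m else - m), del => // u ut.
  rewrite /phi hm.
    by rewrite /shift; case: (b); rewrite ?intrN; ring.
  rewrite /ball /= /shift; case: (b).
    have -> : s + t - (s + u) = - (u - t) by ring.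
    by rewrite normrN.
  by have -> : s - t - (s - u) = u - t by ring.
exists m, eps => // t ht; rewrite -/(shift b s t) -/(phi t) hm //; congr (_ + _).
by rewrite /phi /shift; case: (b); rewrite ?addr0 ?subr0.
Qed.

End RationalFunctions.

(** * Degree and rank of divisors *)

Section Divisors.
Variables (R : realType) (G : metric_graph R).
Implicit Types (D E : divisor G) (p : gpoint G) (f : gpoint G -> R).

Lemma deg_sum D (P : seq (gpoint G)) : uniq P -> {subset dom D <= P} ->
  deg D = \sum_(p <- P) coeff p D.
Proof.
move=> uP sub; rewrite -{1}(freeg_sumE D) raddf_sum /=.
under eq_bigr => p _ do rewrite degU.
rewrite [RHS](bigID (mem (dom D))) /= [X in _ = _ + X]big1 ?addr0; last first.
  by move=> p; exact: coeff_outdom.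
rewrite -[RHS]big_filter; apply: perm_big; apply: uniq_perm.
- exact: uniq_dom.
- exact: filter_uniq.
- by move=> p; rewrite mem_filter; case: (boolP (p \in dom D)) => // /sub ->.
Qed.

Lemma effective_deg E : effective E -> 0 <= deg E.
Proof.
by move=> E0; rewrite (deg_sum (uniq_dom E)) //; apply: sumr_ge0 => p _; exact: E0.
Qed.

Lemma effective_deg0 E : effective E -> deg E = 0 -> E = 0.
Proof.
move=> E0 dE; apply/eqP/freeg_eqP => p; rewrite coeff0.
have [pE|] := boolP (p \in dom E); last exact: coeff_outdom.
apply/eqP; rewrite eq_le E0 andbT; move: dE.
rewrite (deg_sum (uniq_dom E)) // (bigD1_seq p) ?uniq_dom //= => dE.
by rewrite -dE lerDl; apply: sumr_ge0 => q _; exact: E0.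
Qed.

Lemma effective_deg1 E : effective E -> deg E = 1 -> exists p, E = << p >>.
Proof.
move=> E0 dE; have [p pE] : exists p, p \in dom E.
  have : dom E != [::] by rewrite dom_eq0; apply: contra_eq_neq dE => ->; rewrite deg0.
  by case: (dom E) => // p s _; exists p; rewrite mem_head.
exists p; apply/eqP; rewrite -subr_eq0; apply/eqP; apply: effective_deg0.
  move=> q; rewrite coeffB coeffU mul1r; case: eqP => [<-|_]; last by rewrite subr0.
  by rewrite subr_ge0 -gtz0_ge1 lt_neqAle E0 andbT eq_sym -mem_dom.
by rewrite degB dE degU subrr.
Qed.

Lemma effective_point p : effective (<< p >> : divisor G).
Proof. by move=> q; rewrite coeffU mul1r. Qed.

Lemma effectiveD D E : effective D -> effective E -> effective (D + E).
Proof. by move=> D0 E0 p; rewrite coeffD addr_ge0. Qed.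

Lemma deg_is_div f D : rational_function f -> is_div f D -> deg D = 0.
Proof.
move=> /rational_integral_pl fpl fD; apply: (@intr_inj R).
have [P [uP DP sP _]] := sum_slopes_finite (dom D) fpl.
rewrite (deg_sum uP DP) rmorph_sum /= mulr0z -[RHS]sP.
by apply: eq_bigr => p _; exact: fD.
Qed.

Lemma deg_lin_equiv D E : lin_equiv D E -> deg D = deg E.
Proof.
by move=> [f fr fd]; apply/eqP; rewrite -subr_eq0 -degB (deg_is_div fr fd).
Qed.

Lemma is_div_cst (c : R) : is_div (fun _ : gpoint G => c) 0.
Proof.
move=> p; rewrite coeff0 /sum_slopes big1 // => w wp.
by apply: slope_unique => //; exact: germ_cst.
Qed.

Lemma rational_cst (c : R) : rational_function (fun _ : gpoint G => c).
Proof.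
split; first exact: cst_continuous.
exists set0 => // e t _ _; exists 0; near=> s; rewrite mul0r addr0 //.
Unshelve. all: by end_near. Qed.

Lemma lin_equiv_refl D : lin_equiv D D.
Proof. by exists (fun=> 0); [exact: rational_cst|rewrite subrr; exact: is_div_cst]. Qed.

Lemma leastP (P : set nat) : (exists n, P n) ->
  P (least P) /\ forall n, P n -> (least P <= n)%N.
Proof.
move=> [n Pn]; rewrite /least; case: pselect => [exP|[]]; last first.
  by exists n; exact/asboolP.
case: ex_minnP => m /asboolP Pm mmin; split => // k Pk; apply: mmin; exact/asboolP.
Qed.

Let obstructions D := [set n | exists E,
  [/\ effective E, deg E = n%:Z & linear_system (D - E) = set0]].

(** [D] has rank at least one. *)
Definition moves D := forall p, linear_system (D - << p >>) !=set0.

Lemma moves_linear_system D E : moves D -> effective E -> deg E <= 1 ->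
  linear_system (D - E) !=set0.
Proof.
move=> mD E0 dE; have := effective_deg E0; rewrite le_eqVlt => /predU1P[|].
  move/esym/(effective_deg0 E0) => ->; rewrite subr0.
  have /card_gt0P[v _] := vert_neq0 G; have [F [F0 [f fr fd]]] := mD (inl v).
  exists (F + << inl v >>); split.
    by apply: effectiveD => //; exact: effective_point.
  by exists f => //; move: fd; rewrite opprB addrA addrAC.
move=> d0; have d1 : deg E = 1 by apply/eqP; rewrite eq_le dE -gtz0_ge1.
by have [p ->] := effective_deg1 E0 d1.
Qed.

(** No divisor of negative degree is equivalent to an effective one. *)
Lemma obstructions_exist D : exists n, obstructions D n.
Proof.
have /card_gt0P[v _] := vert_neq0 G; pose p : gpoint G := inl v.
exists (absz (deg D)).+1, (<< p >> *+ (absz (deg D)).+1); split.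
- by move=> q; rewrite coeffMn coeffU mul1r mulrn_wge0.
- by rewrite degMn degU natz.
- apply/seteqP; split => // F [F0 /deg_lin_equiv dF]; move: (effective_deg F0).
  rewrite dF degB degMn degU natz; lia.
Qed.

Lemma rank_eq1 D : rank D = 1 -> moves D.
Proof.
rewrite /rank -/(obstructions D) => h p; apply/set0P/eqP => E0.
have [_ lmin] := leastP (obstructions_exist D).
have := lmin 1%N; rewrite /obstructions /= => H; suff : (least (obstructions D) <= 1)%N by lia.
by apply: H; exists << p >>; split => //; [exact: effective_point|rewrite degU].
Qed.

(** If the rank were larger, subtracting any point would leave a divisor of rank at
    least one and of smaller degree. *)
Lemma rank_eq1_min D : moves D -> (forall D', moves D' -> deg D <= deg D') ->
  rank D = 1.
Proof.
move=> mD Dmin; rewrite /rank -/(obstructions D).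
have [[E [E0 dE lE]] lmin] := leastP (obstructions_exist D).
have l2 : (2 <= least (obstructions D))%N.
  rewrite leqNgt; apply/negP => l1; have := @moves_linear_system D E mD E0.
  by rewrite dE lE => H; have [|F] := H _; [lia|].
suff l2' : (least (obstructions D) <= 2)%N by lia.
apply: lmin; apply: contrapT => no2.
have /card_gt0P[v _] := vert_neq0 G; pose q : gpoint G := inl v.
have /Dmin : moves (D - << q >>).
  move=> p; apply/set0P/eqP => h; apply: no2; exists (<< q >> + << p >>); split.
  - by apply: effectiveD; exact: effective_point.
  - by rewrite degD !degU.
  - by rewrite opprD addrA.
by rewrite degB degU; lia.
Qed.

End Divisors.

(** * A rational function on a single edge *)

Section Converse.
Variables (R : realType) (G : metric_graph R).
Implicit Types (e : edge G) (p : gpoint G) (f : gpoint G -> R).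

Lemma integral_pl_rational f : continuous f -> integral_pl f -> rational_function f.
Proof.
move=> fc fpl; split => //.
have [B hB] := choice (finitely_many_breaks fpl).
exists [set` flatten [seq [seq pt e u | u <- B e] | e <- enum (edge G)]] => //.
move=> e t ht /negP nS; have /andP[t0 tl] := ht.
have ub : unbroken f e t.
  apply: hB => //; apply: contra nS => tB; apply/flatten_mapP; exists e.
    by rewrite mem_enum.
  exact: map_f.
have dr : direction e t true by rewrite /direction !ltW.
have dl : direction e t false by rewrite /direction !ltW.
have [m hm] := slope_int fpl dr; exists m.
have [e1 e10 h1] := slope_germP fpl dr; have [e2 e20 h2] := slope_germP fpl dl.
apply/nbhs_ballP; exists (Num.min e1 e2) => /=; first by rewrite lt_min e10.
move=> s; rewrite /ball /= lt_min => /andP[s1 s2].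
have [lt|gt|->] := ltgtP s t; last by rewrite subrr mulr0 addr0.
- have := h2 (t - s); rewrite /=; have -> : t - (t - s) = s by ring.
  move=> ->; last by move: s2; rewrite gtr0_norm; lra.
  by move: ub; rewrite /unbroken hm => ->; ring.
- have := h1 (s - t); rewrite /=; have -> : t + (s - t) = s by ring.
  by move=> ->; [rewrite hm|move: s1; rewrite ltr0_norm; lra].
Qed.

End Converse.

Section Trapezoid.
Variables (R : realType) (G : metric_graph R) (e0 : edge G) (s0 : R).
Hypothesis hs : 0 < s0 < len e0.
(** [f] below is zero outside of [e0] and has slopes -1, 0, 1 on it, with breaks at
    [s0] and at the symmetric parameter; these may coincide. *)
Let L := len e0.
Let m := Num.min s0 (L - s0).
Let tau (t : R) : R := - Num.min (Num.min t (L - t)) m.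
Let f (p : gpoint G) : R :=
  if p is inr y then if (val y).1 == e0 then tau (val y).2 else 0 else 0.

Let m0 : 0 < m.
Proof. by rewrite /m lt_min subr_gt0. Qed.

Let m2 : m <= L - m.
Proof. by rewrite /m; case: (leP s0 (L - s0)); lra. Qed.

Let fE e t : 0 <= t <= len e -> f (pt e t) = if e == e0 then tau t else 0.
Proof.
have l0 : 0 < L := len_gt0 e0; have h1 := m0; have h2 := m2.
move=> /andP[tge tle]; have [->|tn0] := eqVneq t 0.
  rewrite pt0 /=; case: eqP => // _; rewrite /tau.
  by case: (leP 0 (L - 0)) => ?; case: leP; lra.
have [->|tnl] := eqVneq t (len e).
  rewrite pt_len /=; case: eqP => // ->; rewrite /tau -/L.
  by rewrite subrr; case: (leP L 0) => ?; case: leP; lra.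
have ht : 0 < t < len e by rewrite !lt_neqAle eq_sym tn0 tge tnl.
by rewrite (pt_interior ht).
Qed.

Let slr (s : R) : int := if s < m then -1 else if s < L - m then 0 else 1.

Let tau_sym t : tau (L - t) = tau t.
Proof. by rewrite /tau subKr [Num.min (L - t) t]minC. Qed.

Let tau_low t : t <= m -> tau t = - t.
Proof.
have h2 := m2 => h; rewrite /tau; have -> : Num.min t (L - t) = t.
  by apply/min_idPl; lra.
by congr (- _); apply/min_idPl.
Qed.

Let tau_mid t : m <= t <= L - m -> tau t = - m.
Proof.
move=> /andP[h1 h2]; rewrite /tau; congr (- _); apply/min_idPr.
by rewrite le_min h1; lra.
Qed.

Let tau_high t : L - m <= t -> tau t = - (L - t).
Proof. by move=> h; rewrite -tau_sym tau_low //; lra. Qed.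

Let tau_right s : 0 <= s < L -> exists2 eps, 0 < eps & forall t, 0 < t < eps ->
  tau (s + t) = tau s + (slr s)%:~R * t.
Proof.
move=> /andP[sge sl]; rewrite /slr.
have [sm|ms] := ltP s m.
  exists (m - s); first by rewrite subr_gt0.
  by move=> t /andP[t0 te]; rewrite mulrNz mulr1z !tau_low; lra.
have [sm|ms'] := ltP s (L - m).
  exists (L - m - s); first by rewrite subr_gt0.
  by move=> t /andP[t0 te]; rewrite mulr0z mul0r addr0 !tau_mid //; lra.
by exists 1 => // t /andP[t0 te]; rewrite mulr1z mul1r !tau_high; lra.
Qed.

Let f_germ e s b : direction e s b ->
  germ f e s b (if e == e0 then (if b then slr s else slr (L - s))%:~R else 0).
Proof.
move=> /andP[/andP[sge sl] hb].
have [ee|ee] := eqVneq e e0; last first.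
  pose room := if b then len e - s else s.
  exists room; first by rewrite /room; move: hb; case: (b); rewrite ?subr_gt0.
  move=> t /andP[t0]; rewrite /room => tr; rewrite mul0r addr0 !fE.
  - by rewrite (negbTE ee).
  - by rewrite sge.
  - by move: tr; case: (b) => tr; lra.
subst e; move: hb; case: b => hb.
  have [|eps eps0 h] := tau_right (s := s); first by rewrite sge.
  exists (Num.min eps (len e0 - s)); first by rewrite lt_min eps0 subr_gt0.
  move=> t /andP[t0]; rewrite lt_min => /andP[te tr].
  by rewrite !fE ?eqxx ?h ?t0 ?sge //; lra.
have [|eps eps0 h] := tau_right (s := L - s); first by rewrite /L; lra.
exists (Num.min eps s); first by rewrite lt_min eps0.
move=> t /andP[t0]; rewrite lt_min => /andP[te tr].
rewrite !fE ?eqxx ?sge //; last by lra.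
rewrite -(tau_sym (s - t)) -(tau_sym s) -h ?t0 //.
by congr tau; ring.
Qed.

Let f_pl : integral_pl f.
Proof.
move=> e s b /f_germ; case: eqP => _ h; last by exists 0.
by case: b h => h; eexists; exact: h.
Qed.

Let f_continuous : continuous f.
Proof.
apply: (@edgewise_lipschitz_continuous _ _ _ 1) => // e s t ht hs'.
rewrite mul1r !fE //; case: eqP => [_|_]; last by rewrite subrr normr0.
rewrite /tau -opprD normrN; apply: min_lipschitz; last by rewrite subrr normr0.
apply: min_lipschitz => //; have -> : L - t - (L - s) = - (t - s) by ring.
by rewrite normrN.
Qed.

Lemma trapezoid_rational : rational_function f.
Proof. exact: integral_pl_rational. Qed.

Lemma trapezoid_div : is_div f (<< pt e0 s0 >> + << pt e0 (len e0 - s0) >>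
  - (<< inl (src e0) >> + << inl (tgt e0) >>)).
Proof.
move=> p; rewrite coeffB !coeffD !coeffU !mul1r.
have slope_f e s b : direction e s b -> edge_slope f e s b =
    (if e == e0 then (if b then slr s else slr (L - s))%:~R else 0).
  by move=> hd; apply: germ_slope => //; exact: f_germ.
rewrite /sum_slopes (eq_bigr _ (fun w => @slope_edge_slope _ _ f p w)).
have l0 := len_gt0 e0; have [sg0 sl0] := andP hs.
have hs' : 0 < len e0 - s0 < len e0 by apply/andP; split; lra.
case: p => [v|y].
  rewrite (sum_tangents_vertex (edge_slope f)).
  have sumE (h : edge G -> vert G) (F : edge G -> R) : (forall k, F k = if k == e0 then -1 else 0) ->
      \sum_(k | h k == v) F k = - (h e0 == v)%:R.
    move=> FE; rewrite big_mkcond (bigD1 e0) //= big1 ?addr0; last first.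
      by move=> k /negbTE ke; rewrite FE ke; case: ifP.
    by rewrite FE eqxx; case: (h e0 == v); rewrite ?oppr0.
  have slr0 : slr 0 = -1 by rewrite /slr m0.
  rewrite (sumE (@src R G)); last first.
    move=> k; rewrite slope_f; first by case: eqP => // _; rewrite slr0.
    by rewrite /direction lexx !ltW ?len_gt0.
  rewrite (sumE (@tgt R G)); last first.
    move=> k; rewrite slope_f; first by case: eqP => // ->; rewrite /L subrr slr0.
    by rewrite /direction lexx !ltW ?len_gt0.
  rewrite (pt_interior hs) (pt_interior hs') /= !intrD.
  have inlE (a c : vert G) : (inl a == inl c :> gpoint G) = (a == c) by [].
  by rewrite !inlE intrN intrD; case: (_ == v); case: (_ == v); rewrite /=; ring.
rewrite -(pt_val y) (sum_tangents_interior (edge_slope f) (valP y)).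
have /andP[t0 tl] := valP y; move: ((val y).1) ((val y).2) t0 tl => e t t0 tl.
have ht : 0 < t < len e by rewrite t0.
rewrite !slope_f /direction ?t0 ?tl ?ltW //.
have [ee|ee] := eqVneq e e0; last first.
  have ne s : 0 < s < len e0 -> (pt e0 s == pt e t) = false.
    move=> h; apply/negbTE/eqP => /(pt_inj h)[|E _]; first by rewrite !ltW.
    by move: ee; rewrite E eqxx.
  by rewrite !ne // addr0 (pt_interior ht) /= ?addr0 ?subr0.
subst e.
have ptE s : 0 < s < len e0 -> (pt e0 s == pt e0 t) = (s == t).
  move=> h; apply/eqP/eqP => [/(pt_inj h)[|//]|->//]; by rewrite !ltW.
rewrite !ptE // (pt_interior ht).
have ir v z : (inl v == inr z :> gpoint G) = false by [].
rewrite !ir -intrD; congr (_%:~R).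
have -> : (false%:R + false%:R : int) = 0 by [].
rewrite subr0 /slr /m /L.
by case: (leP s0 (len e0 - s0)) => ?; case: (ltgtP s0 t) => ?;
  case: (ltgtP (len e0 - s0) t) => ?; do 4?[case: ltP => ?]; rewrite //=;
  exfalso; lra.
Qed.

End Trapezoid.

(** * A divisor realizing the gonality *)

Section Gonality.
Variables (R : realType) (G : metric_graph R).
Hypothesis nontrivial : exists p q : gpoint G, p <> q.

(** Without an edge at [v], the connected metric graph would be a point. *)
Lemma incident_edge (v : vert G) : exists e, src e = v \/ tgt e = v.
Proof.
apply: contrapT => noe.
have all u : u = v.
  apply: (@graph_ind _ G (fun u => u = v) _ v u) => // e.
  by split=> h; exfalso; apply: noe; exists e; [left|right].
have allp (p : gpoint G) : p = inl v.
  case: p => [u|y]; first by rewrite (all u).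
  by exfalso; apply: noe; exists (val y).1; left; exact: all.
by case: nontrivial => p [q]; rewrite (allp p) (allp q).
Qed.

(** Every edge carries a chip at both of its ends: moving them inwards at the
    same speed reaches every point. *)
Lemma moves_exists : exists D : divisor G, moves D.
Proof.
pose D : divisor G := \sum_e (<< inl (src e) >> + << inl (tgt e) >>).
have Deff (P : pred (edge G)) :
    effective (\sum_(e | P e) (<< inl (src e) >> + << inl (tgt e) >>) : divisor G).
  apply: (big_ind (fun D => effective D)).
  - by move=> p; rewrite coeff0.
  - exact: effectiveD.
  - by move=> e _; apply: effectiveD; exact: effective_point.
exists D => -[v|y].
- have [e ev] := incident_edge v.
  exists (D - << inl v >>); split; last exact: lin_equiv_refl.
  rewrite /D (bigD1 e) //= addrAC; apply: effectiveD; last exact: Deff.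
  case: ev => <-; rewrite ?addrK; last exact: effective_point.
  by rewrite addrAC subrr add0r; exact: effective_point.
- set e := (val y).1; set s := (val y).2; have hs : 0 < s < len e := valP y.
  rewrite -(pt_val y) -/e -/s.
  exists (D - (<< inl (src e) >> + << inl (tgt e) >>) + << pt e (len e - s) >>).
  split.
    apply: effectiveD; last exact: effective_point.
    by rewrite /D (bigD1 e) //= addrAC subrr add0r; exact: Deff.
  exists (fun p => if p is inr z then if (val z).1 == e then
     - Num.min (Num.min (val z).2 (len e - (val z).2)) (Num.min s (len e - s)) else 0 else 0).
    exact: trapezoid_rational.
  have := trapezoid_div hs; congr is_div.
  by apply/eqP/freeg_eqP => q; rewrite !(coeffB, coeffD); ring.
Qed.

(** A divisor of least degree among those of rank at least one has rank exactly
    one, so that the set defining [gonality] is not empty. *)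
Lemma gonality_divisor : exists D : divisor G, deg D = (gonality G)%:Z /\ rank D = 1.
Proof.
have [D0 mD0] := moves_exists.
have ge0 (D : divisor G) : moves D -> 0 <= deg D.
  move=> mD; have [||F [F0 /deg_lin_equiv dF]] := @moves_linear_system _ _ D 0 mD.
  - by move=> p; rewrite coeff0.
  - by rewrite deg0.
  - by move: dF; rewrite subr0 => <-; exact: effective_deg.
pose P := [set n : nat | exists2 D : divisor G, moves D & deg D = n%:Z].
have [|[D mD dD] minD] := @leastP P.
  by exists (absz (deg D0)), D0 => //; rewrite gez0_abs // ge0.
have rD : rank D = 1.
  apply: rank_eq1_min => // D' mD'; rewrite dD -(gez0_abs (ge0 _ mD')) lez_nat.
  by apply: minD; exists D' => //; rewrite gez0_abs // ge0.
have [|[E [dE rE]] _] := @leastP [set d : nat | exists D : divisor G, deg D = d%:Z /\ rank D = 1].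
  by exists (least P), D.
by exists E.
Qed.

(** A divisor realizing the gonality, as a function [E0] supported by [Q]; since its
    rank is one, a chip can be brought to any given point. *)
Lemma gonality_system : exists (E0 : gpoint G -> R) (Q : seq (gpoint G)),
  [/\ forall p, exists m : int, E0 p = m%:~R,
      forall P, uniq P -> {subset Q <= P} -> \sum_(p <- P) E0 p = (gonality G)%:R,
      forall p, p \notin Q -> E0 p = 0,
      effective_at E0 (fun=> 0) &
      (0 < gonality G)%N /\
      forall p, exists2 h, effective_at E0 h & occupied E0 h p].
Proof.
have [D [dD rD]] := gonality_divisor; have mD := rank_eq1 rD.
have [||E [E0 /[dup] /deg_lin_equiv dE [f fr fd]]] := @moves_linear_system _ _ D 0 mD.
- by move=> p; rewrite coeff0.
- by rewrite deg0.
rewrite subr0 in dE fd; rewrite dD in dE.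
have fpl := rational_integral_pl fr.
exists (fun p => (coeff p E)%:~R), (dom E); split.
- by move=> p; exists (coeff p E).
- move=> P uP sub; rewrite -rmorph_sum /= -(deg_sum uP sub) dE //.
- by move=> p /coeff_outdom ->.
- split; first by apply: rational_integral_pl; exact: rational_cst.
  by move=> p; rewrite /chips -(@is_div_cst R G 0 p) coeff0 addr0 ler0z; exact: E0.
have hyp p : exists2 h, effective_at (fun p => (coeff p E)%:~R) h &
    1 <= chips (fun p => (coeff p E)%:~R) h p.
  have [F [F0 [g gr gd]]] := mD p; have gpl := rational_integral_pl gr.
  have cE q : chips (fun p => (coeff p E)%:~R) (fun q => g q - f q) q =
      (coeff q (F + << p >>))%:~R.
    rewrite /chips sum_slopes_sub // -(gd q) -(fd q) -intrB -intrD.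
    by congr (_%:~R); rewrite !(coeffB, coeffD); ring.
  exists (fun q => g q - f q).
    split; first exact: integral_pl_sub.
    by move=> q; rewrite cE ler0z; apply: effectiveD => //; exact: effective_point.
  by rewrite cE coeffD coeffU eqxx mul1r ler1z lerDr; exact: F0.
split; last by move=> p; have [h eh hp] := hyp p; exists h => //; exact: lt_le_trans hp.
have /card_gt0P[v _] := vert_neq0 G; have [F [F0 /deg_lin_equiv]] := mD (inl v).
by rewrite degB degU dD => dF; have := effective_deg F0; rewrite dF; lia.
Qed.

End Gonality.

(** * Edges of a model of the metric graph *)

Section Cells.
Variables (R : realType) (G H : metric_graph R) (B : subdivision G H).
Implicit Types (u v : vert H) (k : edge H).

(** Both are the number of directions at [u], which [sub_directions] counts. *)
Lemma degree_valence u : degree u = valence (sub_vert B u).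
Proof.
apply/eqP; rewrite -(eqr_nat R); apply/eqP.
rewrite /degree /valence -!sum1_card !natr_sum.
transitivity (\sum_(k | src k == u) 1 + \sum_(k | tgt k == u) 1 : R).
  rewrite big_mkcond sum_darts big_split /=.
  by rewrite [in RHS]big_mkcond [X in _ = _ + X]big_mkcond.
by rewrite -(sub_directions B (fun _ _ _ => 1)).
Qed.

Definition cell k : set (gpoint G) :=
  [set p | exists2 t, sub_offset B k <= t <= sub_offset B k + len k &
     p = pt (sub_edge B k) t].

Lemma cell_closed k : closed (cell k).
Proof.
apply: compact_closed; first exact: metric_hausdorff.
have -> : cell k = pt (sub_edge B k) @` `[sub_offset B k, sub_offset B k + len k]%classic.
  apply/seteqP; split => p /=.
    by move=> [t ht ->]; exists t; rewrite //= in_itv.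
  by move=> [t]; rewrite /= in_itv /= => ht <-; exists t.
apply: continuous_compact; last exact: segment_compact.
exact/continuous_subspaceT/pt_continuous.
Qed.

Lemma cells_closed (Bk : pred (edge H)) (A : pred (vert H)) :
  closed [set p | (exists2 k, Bk k & cell k p) \/ exists2 u, A u & p = sub_vert B u].
Proof.
have -> : [set p | (exists2 k, Bk k & cell k p) \/ exists2 u, A u & p = sub_vert B u] =
  (\bigcup_(k in [set k | Bk k]) cell k) `|` \bigcup_(u in [set u | A u]) [set sub_vert B u].
  apply/seteqP; split => p /=.
    by case=> [[k hk kp]|[u hu ->]]; [left; exists k|right; exists u].
  by case=> [[k hk kp]|[u hu ->]]; [left; exists k|right; exists u].
apply: closedU; apply: closed_bigcup; try exact: finite_finset.
  by move=> k _; exact: cell_closed.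
move=> u _; apply: compact_closed; first exact: metric_hausdorff.
exact: compact_set1.
Qed.

Lemma cell_vertex k u : cell k (sub_vert B u) -> u = src k \/ u = tgt k.
Proof.
move=> [t /andP[h1 h2] uE].
have [e1|n1] := eqVneq t (sub_offset B k).
  by left; apply: (@sub_vert_inj _ _ _ B); rewrite uE e1 sub_vert_src.
have [e2|n2] := eqVneq t (sub_offset B k + len k).
  by right; apply: (@sub_vert_inj _ _ _ B); rewrite uE e2 sub_vert_tgt.
exfalso; apply: (@sub_interior _ _ _ B k u t); last exact: uE.
by rewrite !lt_neqAle eq_sym n1 h1 n2.
Qed.

Lemma cell_src k : cell k (sub_vert B (src k)).
Proof.
by exists (sub_offset B k); rewrite ?sub_vert_src // lexx lerDl ltW// len_gt0.
Qed.

Lemma cell_tgt k : cell k (sub_vert B (tgt k)).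
Proof.
by exists (sub_offset B k + len k); rewrite ?sub_vert_tgt // lexx lerDl ltW// len_gt0.
Qed.

Lemma cover_cell p : (exists k, cell k p) \/ exists u, p = sub_vert B u.
Proof.
have [[e [s [hs ->]]]|[v ->]] := ptP p; last first.
  by right; have [u <-] := sub_old_vert B v; exists u.
by left; have [k ke hk] := sub_cover B hs; exists k, s => //; rewrite ke.
Qed.

Lemma interior_cells k k' t : sub_offset B k < t < sub_offset B k + len k ->
  cell k' (pt (sub_edge B k) t) -> k = k'.
Proof.
move=> ht [s /andP[s1 s2] E].
have t0 : 0 < t < len (sub_edge B k).
  by have := sub_offset_ge0 B k; have := sub_offset_le B k; lra.
have [|ek ts] := pt_inj t0 _ E.
  by have := sub_offset_ge0 B k'; have := sub_offset_le B k'; lra.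
subst s; apply: (@sub_disjoint _ _ _ B _ _ t) => //.
rewrite !lt_neqAle s1 s2 !andbT; apply/andP; split; apply/eqP => h.
  by apply: (@sub_interior _ _ _ B k (src k') t) => //; rewrite sub_vert_src E h.
by apply: (@sub_interior _ _ _ B k (tgt k') t) => //; rewrite sub_vert_tgt E -h.
Qed.

Let measure_cover (I : Type) (r : seq I) (a l : I -> R) (D : set R) :
  (forall i, 0 <= l i) -> measurable D ->
  (forall t, D t -> has (fun i => a i <= t <= a i + l i) r) ->
  (lebesgue_measure D <= (\sum_(i <- r) l i)%:E)%E.
Proof.
move=> l0; elim: r D => [|i r IH] D mD hD.
  have -> : D = set0 by apply/seteqP; split => // t /hD.
  by rewrite measure0 big_nil.
pose J := `[a i, a i + l i]%classic : set R.
have mJ : measurable J by exact: measurable_itv.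
have -> : D = (D `&` J) `|` (D `\` J) by rewrite setUIDK.
apply: (le_trans (measureU2 _ _ _)); [exact: measurableI|exact: measurableD|].
rewrite big_cons EFinD; apply: leeD.
  apply: (@le_trans _ _ (lebesgue_measure J)).
    by apply: le_measure; rewrite ?inE //; exact: measurableI.
  rewrite lebesgue_measure_itv /= lte_fin; case: ifP => _.
    by rewrite -EFinB lee_fin addrAC subrr add0r.
  by rewrite lee_fin.
apply: IH; first exact: measurableD.
by move=> t [/hD /= /orP[h|//]] []; rewrite /J /= in_itv.
Qed.

Lemma edge_length_ge0 (c : set (gpoint G)) : 0 <= edge_length c.
Proof. by apply: sumr_ge0 => e _; apply: Rintegral_ge0. Qed.

(** The part of [c] carried by an edge of [G] is covered by finitely many intervals,
    of lengths [len k]. *)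
Lemma edge_length_le (c : set (gpoint G)) (Bk : pred (edge H)) :
  closed c -> (forall p, c p -> exists2 k, Bk k & cell k p) ->
  edge_length c <= \sum_(k | Bk k) len k.
Proof.
move=> cc hc; rewrite /edge_length /gint.
rewrite [leRHS](partition_big (sub_edge B) xpredT) //=; apply: ler_sum => e _.
set D : set R := `]0, len e[ `&` pt e @^-1` c.
have mD : measurable D.
  apply: measurableI => //; apply: closed_measurable.
  by apply: preimage_closed => // t _; exact: pt_continuous.
rewrite Rintegral_cst // mul1r.
have hD : (lebesgue_measure D <=
    (\sum_(k <- [seq k <- index_enum (edge H) | Bk k & sub_edge B k == e]) len k)%:E)%E.
  apply: (@measure_cover _ _ (sub_offset B)) => // [k|t [ht /hc[k hk [s hs E]]]].
    by rewrite ltW // len_gt0.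
  rewrite /= in_itv /= in ht.
  have [|ek ts] := pt_inj ht _ E.
    by have := sub_offset_ge0 B k; have := sub_offset_le B k; lra.
  apply/hasP; exists k; last by rewrite ts.
  by rewrite mem_filter hk -ek eqxx mem_index_enum.
rewrite -big_filter; rewrite -lee_fin fineK //.
rewrite ge0_fin_numE // (le_lt_trans hD) // ltry //.
Qed.

End Cells.

Section Models.
Variables (R : realType) (G H : metric_graph R) (B : subdivision G H).
Variable V : set (gpoint G).
Hypotheses (Vset : vertex_set V) (VH : forall p, V p -> exists u, sub_vert B u = p).
Let inV (u : vert H) : Prop := V (sub_vert B u).

Lemma degree2 u : ~ inV u -> degree u = 2%N.
Proof.
case: Vset => _ _ hV nu; rewrite (degree_valence B); apply: contrapT => h.
exact/nu/hV.
Qed.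

Lemma mid_cell (k : edge H) t : sub_offset B k < t < sub_offset B k + len k ->
  ~ V (pt (sub_edge B k) t).
Proof. by move=> ht /VH[u]; exact: sub_interior. Qed.

Lemma model_lmin_ge0 : 0 <= model_lmin V.
Proof.
rewrite /model_lmin; set A := [set _ | _ in _].
have [[x Ax]|A0] := pselect (A !=set0).
  by apply: lb_le_inf; [exists x|move=> _ [c _ <-]; exact: edge_length_ge0].
suff -> : A = set0 by rewrite inf0.
by apply/seteqP; split => // x Ax; apply: A0; exists x.
Qed.

Lemma model_lmin_le c : model_edges V c -> model_lmin V <= edge_length c.
Proof.
move=> hc; apply: ge_inf; last by exists c.
by exists 0 => _ [d _ <-]; exact: edge_length_ge0.
Qed.

(** The cells of a geodesic between two neighbouring points of [V] form a closed
    set, and so do the other cells; they only meet at the two end points.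
    Hence the geodesic contains an edge of the model [V]. *)
Lemma model_lmin_geodesic u v : inV u -> inV v -> u != v ->
  (forall w, inV w -> w != v -> vdist v u <= vdist v w) ->
  model_lmin V <= vdist v u.
Proof.
move=> Vu Vv uv umin.
have [A [Bk [[vA uA] A_lt BA lB [B2 B1]]]] := geodesic v u.
have innerA w : w \in A -> w != v -> w != u -> forall a : edge H * bool,
    org a = w -> a.1 \in Bk.
  move=> wA wv wu a aw.
  have nV : ~ inV w by move=> /umin /(_ wv); rewrite leNgt A_lt.
  apply: contraT => aB; have := B2 w wA wv wu; rewrite -(degree2 nV) leqNgt.
  case/negP; rewrite /degree; apply: proper_card; apply/properP; split.
    by apply/fintype.subsetP => x; rewrite !inE => /andP[].
  by exists a; rewrite !inE ?aw ?eqxx // (negbTE aB).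
have [a au aB] : exists2 a : edge H * bool, org a = u & a.1 \in Bk.
  by have /card_gt0P[a] := B1 uv; rewrite !inE => /andP[/eqP ? ?]; exists a.
pose K1 := [set p | (exists2 k, k \in Bk & cell B k p) \/ exists2 u : vert H, pred0 u & p = sub_vert B u].
pose K2 := [set p | (exists2 k, k \notin Bk & cell B k p) \/ exists2 u, u \notin A & p = sub_vert B u].
have K1c : closed K1 by exact: (@cells_closed R G H B (fun k => k \in Bk) pred0).
have K2c : closed K2 by exact: (@cells_closed R G H B (fun k => k \notin Bk) (fun u => u \notin A)).
have K12 p : K1 p \/ K2 p.
  have [[k kp]|[w ->]] := cover_cell B p.
    by case: (boolP (k \in Bk)) => hk; [left|right]; left; exists k.
  have [wA|wA] := boolP (w \in A); last by right; right; exists w.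
  have [[k [kB hk]]|no] := pselect (exists k, k \in Bk /\ cell B k (sub_vert B w)).
    by left; left; exists k.
  have ends z : z = u \/ z = v -> exists k, cell B k (sub_vert B z).
    (* a vertex of the geodesic is on some edge *)
    case=> ->.
      by exists a.1; rewrite -au /org; case: a.2; [exact: cell_src|exact: cell_tgt].
    case: (pselect (exists k, cell B k (sub_vert B v))) => // nov.
    have : False.
      have all x : x = v.
        apply: (@graph_ind _ H (fun x => x = v) _ v x) => // e.
        by split=> h; exfalso; apply: nov; exists e; rewrite -h;
          [exact: cell_src|exact: cell_tgt].
      by move: uv; rewrite (all u) eqxx.
    by [].
  have [wu|wu] := eqVneq w u.
    have [k hk] := ends u (or_introl erefl); right; left; exists k; rewrite ?wu //.
    by apply/negP => kB; apply: no; exists k; rewrite wu.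
  have [wv|wv] := eqVneq w v.
    have [k hk] := ends v (or_intror erefl); right; left; exists k; rewrite ?wv //.
    by apply/negP => kB; apply: no; exists k; rewrite wv.
  exfalso; have := B2 w wA wv wu; case/ltnW/card_gt0P => b; rewrite !inE => /andP[/eqP bw bB].
  apply: no; exists b.1; split => //; rewrite -bw /org.
  by case: b.2; [exact: cell_src|exact: cell_tgt].
have K1K2 p : K1 p -> K2 p -> V p.
  case=> [[k kB kp]|[? //]].
  have [[w wp]|nw] := pselect (exists w, p = sub_vert B w); last first.
    case=> [[k' k'B k'p]|[w _ wp]]; last by exfalso; apply: nw; exists w.
    exfalso; case: kp => t /andP[t1 t2] pE.
    have ht : sub_offset B k < t < sub_offset B k + len k.
      rewrite !lt_neqAle t1 t2 !andbT; apply/andP; split; apply/eqP => h; apply: nw.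
        by exists (src k); rewrite sub_vert_src pE h.
      by exists (tgt k); rewrite sub_vert_tgt pE h.
    move: k'B; rewrite -(@interior_cells _ _ _ B k k' t ht) ?kB // -pE //.
  have wA : w \in A.
    have [h1 h2] := BA _ kB; move: kp; rewrite wp => /cell_vertex.
    by case=> ->.
  case=> [[k' k'B k'p]|[w' w'A w'p]]; last first.
    exfalso; move: w'A; rewrite -(@sub_vert_inj _ _ _ B w w') ?wA //.
    by rewrite -wp -w'p.
  rewrite wp; have [->//|wv] := eqVneq w v; have [->//|wu] := eqVneq w u.
  exfalso; move: k'p; rewrite wp => /cell_vertex[h|h]; move/negP: k'B; apply.
    by apply: (innerA w wA wv wu (k', true)); rewrite /org.
  by apply: (innerA w wA wv wu (k', false)); rewrite /org.
pose t0 := sub_offset B a.1 + len a.1 / 2.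
have ht0 : sub_offset B a.1 < t0 < sub_offset B a.1 + len a.1.
  by have := len_gt0 a.1; rewrite /t0; lra.
pose x0 := pt (sub_edge B a.1) t0.
have nVx0 : (~` V) x0 by exact: mid_cell.
have K1x0 : K1 x0.
  by left; exists a.1 => //; exists t0 => //; rewrite !ltW //; case/andP: ht0.
set C := connected_component (~` V) x0.
have Cx0 : C x0 by exact: connected_component_refl.
have CV p : C p -> ~ V p by move/connected_component_sub.
have CK1 : C `<=` K1.
  have : C `&` K1 = C.
    apply: (component_connected (A := ~` V) (x := x0)).
    - by exists x0.
    - exists (~` K2); first exact: closed_openC.
      apply/seteqP; split => p [Cp hp]; split => //.
        by move=> hp2; apply: (CV p Cp); exact: K1K2.
      by have [|/hp] := K12 p.
    - by exists K1.
  by move=> <- p [].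
have clK1 : closure C `<=` K1.
  by rewrite (closure_id K1).1 //; exact: closureS.
rewrite -lB; apply: le_trans (@edge_length_le _ _ _ B (closure C) (fun k => k \in Bk) _ _).
- by apply: model_lmin_le; exists x0.
- exact: closed_closure.
- by move=> p /clK1 [[k kB kp]|[? //]]; exists k.
Qed.

(** In a simple model, [V] has at least two points: otherwise the closure of a
    component of its complement would be a loop. *)
Lemma simple_model_two v : simple_model V -> inV v -> (exists k : edge H, src k = v \/ tgt k = v) ->
  exists2 u, inV u & u != v.
Proof.
move=> [_ noloop _] Vv [k kv]; apply: contrapT => H0.
have Vv1 p : V p -> p = sub_vert B v.
  move=> Vp; have [u up] := VH Vp; rewrite -up; congr sub_vert.
  by apply: contrapT => /eqP uv; apply: H0; exists u => //; rewrite /inV up.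
pose I : set R := `]sub_offset B k, sub_offset B k + len k[%classic.
pose t0 := sub_offset B k + len k / 2.
have It0 : I t0 by rewrite /I /= in_itv /= /t0; have := len_gt0 k; lra.
pose x0 := pt (sub_edge B k) t0.
have Ic : pt (sub_edge B k) @` I `<=` connected_component (~` V) x0.
  apply: connected_component_max; first by exists t0.
    by move=> _ [t + <-]; rewrite /I /= in_itv /=; exact: mid_cell.
  apply: connected_continuous_connected; first by apply/connected_intervalP; exact: interval_is_interval.
  exact/continuous_subspaceT/pt_continuous.
apply: (noloop (closure (connected_component (~` V) x0))).
  exists x0 => //; apply: mid_cell; move: It0; by rewrite /I /= in_itv.
exists (sub_vert B v); apply/seteqP; split=> [p [_ /Vv1]//|_ ->].
split => //.
pose s := if src k == v then sub_offset B k else sub_offset B k + len k.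
have vE : sub_vert B v = pt (sub_edge B k) s.
  rewrite /s; case: eqP => [<-|sv]; first exact: sub_vert_src.
  by case: kv => // <-; exact: sub_vert_tgt.
rewrite vE => U /pt_continuous /nbhs_ballP[r /= r0 hr].
have l0 := len_gt0 k.
pose d := Num.min (r / 2) (len k / 2).
have d0 : 0 < d by rewrite lt_min !divr_gt0.
have dr : d <= r / 2 by rewrite ge_min lexx.
have dl : d <= len k / 2 by rewrite ge_min lexx orbT.
pose t := if src k == v then s + d else s - d.
exists (pt (sub_edge B k) t); split.
  apply: Ic; exists t => //; rewrite /I /= in_itv /= /t /s.
  by case: eqP => _; apply/andP; split; lra.
apply: hr; rewrite /ball /= /t; case: eqP => _.
  by rewrite opprD addrA subrr add0r normrN gtr0_norm //; lra.
by rewrite opprB addrC subrK gtr0_norm //; lra.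
Qed.

End Models.

(** * Test functions and unions of classes *)

Section NearEnergy.
Variables (R : realType) (H : metric_graph R).

Lemma dist_to_vdist (S : pred (vert H)) s u : S s -> dist_to S u <= vdist s u.
Proof.
move=> Ss; apply: dist_to_le; first by exists s.
move=> F [Fl FS]; apply: dist_to_ge; first by exists s; exact: eqxx.
by split => // x /eqP ->; exact: FS.
Qed.

(** The energy of a 1-Lipschitz function is at most the volume of the places where
    it is not constant. *)
Lemma energy_near (S : pred (vert H)) (r eta : R) (f : vert H -> R) :
  (exists s, S s) -> (forall k : edge H, len k <= eta) ->
  (forall k : edge H, `|f (tgt k) - f (src k)| <= len k) ->
  (forall k : edge H, r <= dist_to S (src k) -> r <= dist_to S (tgt k) ->
     f (tgt k) = f (src k)) ->
  \sum_(k : edge H) (f (tgt k) - f (src k)) ^+ 2 / len k <=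
  \sum_(k : edge H | dist_to S (src k) + dist_to S (tgt k) + len k <= 2 * (r + eta))
    len k.
Proof.
move=> S0 leta flip fconst; rewrite [leRHS]big_mkcond; apply: ler_sum => k _.
have l0 := len_gt0 k; have le := leta k.
have D := dist_to_lip S0 k; rewrite ler_norml in D.
case: (leP r (dist_to S (src k))) => rs.
  case: (leP r (dist_to S (tgt k))) => rt.
    rewrite (fconst _ rs rt) subrr expr0n mul0r; case: ifP => // _; exact: ltW.
  rewrite ifT; last by lra.
  rewrite ler_pdivrMr // -expr2 -[leLHS]real_normK ?num_real //.
  by rewrite lerXn2r ?nnegrE // ltW.
rewrite ifT; last by lra.
rewrite ler_pdivrMr // -expr2 -[leLHS]real_normK ?num_real //.
by rewrite lerXn2r ?nnegrE // ltW.
Qed.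

(** The common lower bound [m] of the two masses allows to estimate them separately
    from the energies. *)
Lemma lambda1_le_rayleigh (G : metric_graph R) (B : subdivision G H) (K m : R)
    (f : bool -> vert H -> R) : 0 < K -> 0 < m ->
  (forall k : edge H, K * len k <= 1) ->
  (forall u, f true u * f false u = 0) ->
  (forall k : edge H, f true (src k) * f false (tgt k) = 0 /\
                      f true (tgt k) * f false (src k) = 0) ->
  (forall b, \sum_(k : edge H) (f b (tgt k) - f b (src k)) ^+ 2 / len k <= K ^+ 2 / 16 * m) ->
  (forall b, m <= \sum_(k : edge H) len k * (f b (src k) ^+ 2 + f b (tgt k) ^+ 2)) ->
  lambda1 G <= K ^+ 2.
Proof.
move=> K0 m0 Kl fu fk en ma.
have [//|//|b|b|k /andP[k0 kK] sk] := @sinusoidal_rayleigh _ H K f K0 Kl.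
- apply: contrapT => no; have := ma b; rewrite big1 ?leNgt ?m0 // => k _.
  have z u : f b u = 0 by apply: contrapT => /eqP h; apply: no; exists u.
  by rewrite !z expr0n addr0 mulr0.
- apply: le_trans (en b) _; rewrite ler_wpM2l // divr_ge0 //; exact: sqr_ge0.
apply: le_trans (lambda1_le k0 (sub_sinusoidal B sk)) _.
by rewrite lerXn2r ?nnegrE // ltW.
Qed.

End NearEnergy.

(** Let [A] be a union of classes of weight at least a quarter of the total, with as
    few elements as possible.  If its weight exceeds one half, removing one of its
    classes, of weight at most one half, leaves less than a quarter: the class itself
    is then heavier than a quarter. *)
Lemma balanced_union (R : realType) (I : finType) (w : I -> R) (L : rel I) :
  symmetric L -> transitive L -> (forall i, 0 <= w i) -> 0 < \sum_i w i ->
  (forall i, \sum_(j | L i j) w j <= (\sum_j w j) / 2) ->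
  \sum_(i | ~~ L i i) w i <= (\sum_i w i) / 8 ->
  exists A : {set I}, [/\ forall i j, i \in A -> L i j -> j \in A,
    forall i, i \in A -> L i i,
    (\sum_i w i) / 4 <= \sum_(i in A) w i &
    \sum_(i in A) w i <= (\sum_i w i) / 2].
Proof.
move=> Ls Lt w0; set W := \sum_i w i => W0 half few.
have Lr i j : L i j -> L i i by move=> ij; apply: (Lt _ _ _ ij); rewrite Ls.
pose good (U : {set I}) := [/\ forall i j, i \in U -> L i j -> j \in U,
  forall i, i \in U -> L i i & W / 4 <= \sum_(i in U) w i].
have ind n : forall U : {set I}, (#|U| <= n)%N -> good U ->
    exists A, good A /\ \sum_(i in A) w i <= W / 2.
  elim: n => [|n IH] U cU [Ucl UL Uw].
    move: Uw; rewrite (_ : U = finset.set0); last by apply/eqP; rewrite -cards_eq0 -leqn0.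
    by rewrite big1 => [|i]; [lra|rewrite finset.in_set0].
  case: (leP (\sum_(i in U) w i) (W / 2)) => hU; first by exists U; split.
  have [i iU] : exists i, i \in U.
    apply/set0Pn/eqP => U0; move: Uw; rewrite U0.
    by rewrite big1 => [|i]; [lra|rewrite finset.in_set0].
  pose C := [set j | L i j]%SET.
  have CU : {subset C <= U} by move=> j; rewrite !inE => /(Ucl _ _ iU).
  have wC : \sum_(j in C) w j = \sum_(j | L i j) w j.
    by apply: eq_bigl => j; rewrite inE.
  case: (leP (W / 4) (\sum_(j in C) w j)) => hC.
    exists C; split; last by rewrite wC.
    split => //; first by move=> a b; rewrite !inE => /Lt; apply.
    by move=> a /CU /UL.
  apply: (IH (U :\: C)%SET).
    rewrite -ltnS (leq_trans _ cU) //; apply: proper_card; apply/properP; split.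
      exact: subsetDl.
    by exists i => //; rewrite !inE UL.
  split.
  - move=> a b; rewrite !inE => /andP[nia aU] ab; rewrite (Ucl _ _ aU ab) andbT.
    by apply: contra nia => ib; apply: Lt ib _; rewrite Ls.
  - by move=> a; rewrite !inE => /andP[_ /UL].
  have : \sum_(j in U) w j = \sum_(j in C) w j + \sum_(j in (U :\: C)%SET) w j.
    rewrite (bigID (mem C)) /=; congr (_ + _); apply: eq_bigl => j.
      by rewrite andb_idl // => /CU.
    by rewrite finset.in_setD andbC.
  lra.
have [||A [[Acl AL Aw] Ah]] := ind #|I| [set i | L i i]%SET.
- exact: max_card.
- split.
  + by move=> i j; rewrite !inE => _ /[dup] ij; rewrite Ls => /Lr.
  + by move=> i; rewrite inE.
  + have : W = \sum_(i in [set i | L i i]%SET) w i + \sum_(i | ~~ L i i) w i.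
      rewrite [LHS](bigID (fun i => L i i)) /=; congr (_ + _).
      by apply: eq_bigl => i; rewrite inE.
    lra.
by exists A.
Qed.

(** * Fine subdivisions *)

Section FineSubdivisions.
Variables (R : realType) (G : metric_graph R).

Lemma fine_subdivision (P : seq (gpoint G)) (eta : R) (H : metric_graph R)
    (B : subdivision G H) : 0 < eta ->
  exists (H' : metric_graph R) (B' : subdivision G H') (c : edge H' -> edge H),
    [/\ refines B B' c, forall p, p \in P -> exists u, sub_vert B' u = p &
        forall k : edge H', len k <= eta].
Proof.
move=> eta0; pose L := volume G / eta; pose n := Num.truncn L.
have step (e : edge G) : len e / n.+1%:R <= eta.
  rewrite ler_pdivrMr // mulrC -ler_pdivrMr //.
  apply: (@le_trans _ _ L).
    rewrite /L ler_pM2r ?invr_gt0 //.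
    rewrite /volume (bigD1 e) //= lerDl.
    by apply: sumr_ge0 => k _; rewrite ltW // len_gt0.
  rewrite ltW // /n; apply: truncnS_gt.
(* equidistant points on every edge, at most [eta] apart *)
pose grid := [seq pt e (i%:R * (len e / n.+1%:R)) | e <- enum (edge G), i <- iota 0 n.+2].
have [H' [B' [c [rB PB]]]] := refinement_at (P ++ grid) B.
exists H', B', c; split => // [p hp|k].
  by apply: PB; rewrite mem_cat hp.
case: leP => // lk; exfalso.
set e := sub_edge B' k; set h := len e / n.+1%:R.
have h0 : 0 < h by rewrite divr_gt0 // len_gt0.
have he : h <= eta := step e.
set o := sub_offset B' k; have o0 : 0 <= o := sub_offset_ge0 B' k.
pose i := (Num.truncn (o / h)).+1.
have io : o < i%:R * h by rewrite -ltr_pdivrMr //; exact: truncnS_gt.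
have io' : i%:R * h <= o + h.
  have : (Num.truncn (o / h))%:R <= o / h by rewrite truncn_le // divr_ge0 // ltW.
  by rewrite ler_pdivlMr // /i -natr1 mulrDl mul1r lerD2r.
have il : i%:R * h < o + len k by lra.
have [u uE] : exists u, sub_vert B' u = pt e (i%:R * h).
  apply: PB; rewrite mem_cat; apply/orP; right; apply/allpairsPdep.
  exists e, i; rewrite mem_enum mem_iota /=; split => //.
  rewrite add0n ltnS -(ler_nat R).
  have : i%:R * h <= n.+1%:R * h.
    have -> : n.+1%:R * h = len e by rewrite /h mulrC divfK ?pnatr_eq0.
    by have := sub_offset_le B' k; rewrite -/o -/e; lra.
  by rewrite ler_pM2r.
by apply: (@sub_interior _ _ _ B' k u (i%:R * h)) => //; rewrite io il.
Qed.

Lemma refined_volume (H H' : metric_graph R) (B : subdivision G H)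
    (B' : subdivision G H') (c : edge H' -> edge H) : refines B B' c ->
  \sum_(k : edge H') len k = \sum_(j : edge H) len j.
Proof.
case=> _ _ _ fib; rewrite (partition_big c xpredT) //=.
by apply: eq_bigr => j _; rewrite fib.
Qed.

(** Induction along the edge, from one cell to the next one. *)
Lemma sub_vdist (H : metric_graph R) (B : subdivision G H) (v : vert H) (s : R) (k : edge H) :
  sub_vert B v = pt (sub_edge B k) s -> 0 <= s <= sub_offset B k ->
  vdist v (src k) <= sub_offset B k - s.
Proof.
move=> + /andP[s0 +]; apply: (finite_real_ind (f := sub_offset B)
  (P := fun k => sub_vert B v = pt (sub_edge B k) s -> s <= sub_offset B k ->
    vdist v (src k) <= sub_offset B k - s)) => {}k IH vE so.
have l0 := len_gt0 k; have ol := sub_offset_le B k.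
move: so; rewrite le_eqVlt => /predU1P[sE|so].
  rewrite sE subrr (_ : src k = v) ?vdistxx //.
  by apply: (@sub_vert_inj _ _ _ B); rewrite sub_vert_src vE sE.
set e := sub_edge B k in vE ol *; set o := sub_offset B k in so ol IH *.
(* the previous cell [k'] on the edge is the one of largest offset before [o] *)
have [k1 k1e k1o] : exists2 k1, sub_edge B k1 == e & (sub_offset B k1 < o)%R.
  have [|k1 k1e /andP[h1 _]] := @sub_cover _ _ _ B e s; first by lra.
  by exists k1; rewrite ?k1e //; apply: le_lt_trans so.
pose before : pred (edge H) := fun j => (sub_edge B j == e) && (sub_offset B j < o).
have k1P : before k1 by rewrite /before k1e.
case: (arg_maxP (sub_offset B) k1P) => k'.
move=> /andP[/eqP k'e k'o] k'max; have l0' := len_gt0 k'.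
have end_le : sub_offset B k' + len k' <= o.
  case: leP => // h; exfalso; apply: (@sub_interior _ _ _ B k' (src k) o).
    by rewrite k'o.
  by rewrite sub_vert_src k'e.
have end_eq : sub_offset B k' + len k' = o.
  apply/eqP; rewrite eq_le end_le; case: leP => // h; exfalso.
  pose m := (sub_offset B k' + len k' + o) / 2.
  have [|k2 k2e /andP[m1 m2]] := @sub_cover _ _ _ B e m.
    by have := sub_offset_ge0 B k'; rewrite /m; lra.
  have k2m : sub_offset B k2 <= sub_offset B k'.
    by apply: k'max; rewrite /before k2e eqxx /=; rewrite /m in m1; lra.
  have E : k' = k2.
    apply: (@sub_disjoint _ _ _ B _ _ (sub_offset B k' + len k' / 2)).
    - by rewrite k'e k2e.
    - lra.
    - by rewrite /m in m2; lra.
  by rewrite -E /m in m2; lra.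
have so' : s <= sub_offset B k'.
  case: leP => // h; exfalso; apply: (@sub_interior _ _ _ B k' v s); last by rewrite k'e.
  by rewrite h end_eq.
have tk : tgt k' = src k.
  by apply: (@sub_vert_inj _ _ _ B); rewrite sub_vert_src sub_vert_tgt k'e end_eq.
have := IH k' k'o; rewrite k'e => /(_ vE so').
have := vdist_triangle (src k') v (src k).
have := vdist_dart (k', true); rewrite /dst /org /= tk vdist_sym; lra.
Qed.

End FineSubdivisions.

(** * Bounds on the first eigenvalue *)

Section ModelVertices.
Variables (R : realType) (G H : metric_graph R) (B : subdivision G H).
Variables (V : set (gpoint G)) (dmax : nat).
Hypotheses (Vset : vertex_set V) (VH : forall p, V p -> exists u, sub_vert B u = p).
Hypothesis dmax_max : forall p : gpoint G, (valence p <= dmax)%N.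
Let inV : pred (vert H) := fun u => `[< V (sub_vert B u) >].
Local Notation l := (model_lmin V).

Lemma model_separated u v : V (sub_vert B u) -> V (sub_vert B v) -> u != v ->
  l <= vdist v u.
Proof.
move=> Vu Vv uv.
have uP : inV u && (u != v) by rewrite uv andbT; apply/asboolP.
case: (@arg_minP _ _ _ _ (fun w => inV w && (w != v)) (vdist v) uP) => w /andP[/asboolP Vw wv] wmin.
apply: (@le_trans _ _ (vdist v w)); last exact: wmin.
apply: (model_lmin_geodesic Vset VH Vw Vv wv) => x Vx xv.
by apply: wmin; rewrite xv andbT; apply/asboolP.
Qed.

(** A point of [S] cannot be at distance less than [r] of two points of [V], which
    are at least [2 * r] apart: at most [#|S|] points of [V] are near [S]. *)
Lemma near_model_volume (S : pred (vert H)) (r : R) : (exists s, S s) ->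
  0 <= r -> 2 * r <= l ->
  \sum_(k : edge H | dist_to S (src k) + dist_to S (tgt k) + len k <= 2 * r) len k <=
  r * dmax%:R * (2 * #|S|%:R).
Proof.
move=> S0 r0 rl; apply: le_trans (near_volume S0 (V := inV) (dmax := dmax) r0 _ _) _.
- by move=> u /asboolP; exact: degree2.
- by move=> u _; rewrite (degree_valence B).
rewrite ler_wpM2l ?mulr_ge0 // mulr_natl mulr2n lerD2l ler_nat.
have cl v : exists s, S s && (vdist s v <= dist_to S v).
  by have [s ? ?] := dist_to_attained v S0; exists s; apply/andP.
pose c v := xchoose (cl v).
rewrite -(card_in_image (f := c) (A := [pred v | inV v && (dist_to S v < r)])); last first.
  move=> x y; rewrite !inE => /andP[/asboolP Vx xr] /andP[/asboolP Vy yr] cxy.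
  apply: contrapT => /eqP xy; have := model_separated Vx Vy xy.
  have := vdist_triangle (c x) y x; rewrite (vdist_sym y x) (vdist_sym y (c x)).
  have /andP[_ h1] := xchooseP (cl x); have /andP[_ h2] := xchooseP (cl y).
  by rewrite -/(c x) in h1; rewrite -/(c y) -cxy in h2; lra.
apply: subset_leq_card; apply/fintype.subsetP => s /mapP[v _ ->].
by have /andP[] := xchooseP (cl v).
Qed.

End ModelVertices.

Section MainEstimate.
Variables (R : realType) (G : metric_graph R) (V : set (gpoint G)) (dmax : nat).
Hypotheses (Vset : vertex_set V) (nontrivial : exists p q : gpoint G, p <> q).
Hypotheses (dmax_max : forall p : gpoint G, (valence p <= dmax)%N) (dmax0 : (0 < dmax)%N).
Local Notation l := (model_lmin V).
Local Notation d := ((gonality G)%:R : R).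
Hypothesis l0 : 0 < l.

(** The test functions are the distance to the chips of a balanced divisor, truncated
    at [r = l / 8], on each of two unions of components of the complement.  Their
    energy is at most [4 * r * d * dmax], the volume near the chips.  As long as this
    does not exceed [volume G / 8], each side retains an eighth of the volume at
    distance at least [r], so that the mass is at least [r ^+ 2 * volume G / 4]. *)
Lemma lambda1_le_gonality : 4 * l * d * dmax%:R <= volume G ->
  lambda1 G <= 16 * (128 * d * dmax%:R) / (l * volume G).
Proof.
set mu := volume G => small.
have [E0 [Q [E0i E0d E0Q eff0 [d_gt0 E0m]]]] := gonality_system nontrivial.
have d0 : 0 < d by rewrite ltr0n.
have D0 : 0 < dmax%:R :> R by rewrite ltr0n.
have mu0 : 0 < mu by apply: lt_le_trans small; rewrite !mulr_gt0.
set X2 := 16 * (128 * d * dmax%:R) / (l * mu).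
have X20 : 0 < X2 by rewrite divr_gt0 ?mulr_gt0 ?ltr0n.
pose K := Num.sqrt X2; have K0 : 0 < K by rewrite sqrtr_gt0.
have KX : K ^+ 2 = X2 by rewrite sqr_sqrtr // ltW.
pose r := l / 8; have r0 : 0 < r by rewrite divr_gt0.
pose eta := Num.min (r / 2) K^-1.
have eta0 : 0 < eta by rewrite lt_min divr_gt0 // invr_gt0.
have eta_r : eta <= r / 2 by rewrite ge_min lexx.
have eta_K : eta <= K^-1 by rewrite ge_min lexx orbT.
(* each cell of a subdivision is represented by its source, with its length as
   weight; [S] depends on these weights, so its points need a second subdivision *)
have [H0 [B0 [c0 [rB0 _ len0]]]] := fine_subdivision [::] (trivial_subdivision G) eta0.
pose X (j : edge H0) := sub_vert B0 (src j); pose w (j : edge H0) : R := len j.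
have w0 j : 0 <= w j by rewrite ltW // len_gt0.
have wmu : \sum_j w j = mu by rewrite (refined_volume rB0).
have [||g eg balanced] := balanced_divisor (E0 := E0) X w0.
- by exists (fun=> 0).
- exact: E0m.
have [S [_ SP Sd Sn]] := occupied_finite E0i E0d E0Q eg.
pose occ := occupied E0 g.
have [s Vs] : exists s : seq (gpoint G), forall p, V p <-> p \in s.
  by case: Vset => /finite_seqP[s sE] _ _; exists s => p; rewrite sE.
have [H [B [c [rB PB lenH]]]] := fine_subdivision (S ++ s) B0 eta0.
have VH p : V p -> exists u, sub_vert B u = p.
  by move=> /Vs ps; apply: PB; rewrite mem_cat ps orbT.
have SH p : occ p -> exists u, sub_vert B u = p.
  by move=> /SP ps; apply: PB; rewrite mem_cat ps.
pose SS : pred (vert H) := fun u => sub_vert B u \in S.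
have SSP u : reflect (occ (sub_vert B u)) (SS u) by apply: (iffP idP) => /SP.
have SS0 : exists u, SS u.
  case: S Sn @SS SP {Sd PB SSP} => [/(_ d_gt0)//|p S] _ SS SP.
  have [u up] := SH p ((SP p).2 (mem_head p S)); exists u.
  by rewrite /SS up mem_head.
have SSd : #|SS|%:R <= d.
  rewrite ler_nat; apply: leq_trans Sd; rewrite cardE.
  rewrite -(size_map (sub_vert B) (enum SS)); apply: uniq_leq_size.
    by rewrite map_inj_uniq ?enum_uniq //; exact: sub_vert_inj.
  by move=> _ /mapP[u + ->]; rewrite mem_enum.
pose D := dist_to SS.
pose near k := D (src k) + D (tgt k) + len k <= 2 * (r + eta).
have nearv_sharp : \sum_(k : edge H | near k) len k <= 4 * r * d * dmax%:R.
  have r2 : 2 * (r + eta) <= l by rewrite /r in eta_r *; lra.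
  apply: le_trans (near_model_volume Vset VH dmax_max SS0 _ r2) _; first lra.
  rewrite (_ : 4 * r * d * dmax%:R = (2 * r) * dmax%:R * (2 * d)); last by ring.
  apply: ler_pM; rewrite ?mulr_ge0 //; first by lra.
    by rewrite ler_wpM2r //; lra.
  by rewrite ler_wpM2l.
have nearv : \sum_(k : edge H | near k) len k <= mu / 8.
  apply: le_trans nearv_sharp _; rewrite /r; lra.
have lenr (k : edge H) : len k <= eta := lenH k.
have nearP k : ~~ near k -> r <= D (src k) /\ r <= D (tgt k).
  rewrite /near -ltNge => h; have := dist_to_lip SS0 k; rewrite ler_norml -/D.
  by have := lenr k; split; lra.
have off k : sub_edge B k = sub_edge B0 (c k) /\
    sub_offset B0 (c k) <= sub_offset B k <= sub_offset B0 (c k) + len (c k).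
  case: rB => _ /(_ k)[h1 h2 h3] _ _; split; rewrite ?h2 //=.
  by have := len_gt0 k; lra.
(* a cell of the first subdivision that is cut by [S] is near [S], because it is
   shorter than [eta]; the other cells are linked to their representatives *)
have cutD k t : sub_offset B0 (c k) <= t <= sub_offset B k ->
    occ (pt (sub_edge B k) t) -> D (src k) <= eta.
  move=> /andP[t1 t2] ot; have [v vE] := SH _ ot.
  have Sv : SS v by apply/SSP; rewrite vE.
  apply: le_trans (dist_to_vdist _ Sv) _.
  apply: le_trans (sub_vdist vE _) _.
    by rewrite t2 andbT; apply: le_trans t1; exact: sub_offset_ge0.
  by have [_] := off k; have := len0 (c k); lra.
have link k : ~~ near k -> linked occ (X (c k)) (sub_vert B (src k)).
  move=> /nearP[Dk _]; have [ek /andP[ok1 ok2]] := off k.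
  rewrite /X !sub_vert_src -ek.
  have uncut u : sub_offset B0 (c k) <= u <= sub_offset B k -> ~ occ (pt (sub_edge B k) u).
    by move=> hu /(cutD k u hu); lra.
  have := sub_offset_le B k; have := sub_offset_ge0 B0 (c k); have := len_gt0 k.
  move=> lk0 o0 ol; apply: (@linked_step _ _ _ _ _ (sub_offset B k)).
  - by lra.
  - by lra.
  - by move=> u; rewrite min_l // max_r //; exact: uncut.
  - by apply: linked_refl; apply: uncut; rewrite ok1 lexx.
have edge_link k : ~~ SS (src k) -> ~~ SS (tgt k) ->
    linked occ (sub_vert B (src k)) (sub_vert B (tgt k)).
  move=> /SSP ns /SSP nt; have l0' := len_gt0 k.
  have := sub_offset_le B k; have := sub_offset_ge0 B k => o0 ol.
  rewrite sub_vert_src sub_vert_tgt.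
  apply: (@linked_step _ _ _ _ _ (sub_offset B k + len k)).
  - by lra.
  - by lra.
  - have hl : sub_offset B k <= sub_offset B k + len k by lra.
    move=> t; rewrite (min_l hl) (max_r hl) => /andP[t1 t2] ot.
    have [v vE] := SH _ ot.
    have [e1|n1] := eqVneq t (sub_offset B k); first by apply: ns; rewrite sub_vert_src -e1.
    have [e2|n2] := eqVneq t (sub_offset B k + len k).
      by apply: nt; rewrite sub_vert_tgt -e2.
    by apply: (@sub_interior _ _ _ B k v t); rewrite // !lt_neqAle eq_sym n1 t1 n2.
  - by apply: linked_refl; rewrite -sub_vert_tgt.
pose L i j := `[< linked occ (X i) (X j) >].
have wfib (P : pred (edge H0)) : \sum_(k | P (c k)) len k = \sum_(j | P j) w j.
  case: rB => _ _ _ fib; rewrite (partition_big c P) //=.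
  apply: eq_bigr => j Pj; rewrite /w -[RHS]fib; apply: eq_bigl => k.
  by rewrite andb_idl // => /eqP ->.
have [|||||A [Acl AL Alo Ahi]] := @balanced_union _ _ w L _ _ w0.
- by move=> i j; apply/asboolP/asboolP; exact: linked_sym.
- by move=> j i k /asboolP h1 /asboolP h2; apply/asboolP; exact: linked_trans h2.
- by rewrite wmu.
- by move=> i; exact: balanced.
- rewrite wmu; apply: le_trans nearv; rewrite -wfib.
  rewrite [leLHS]big_mkcond [leRHS]big_mkcond; apply: ler_sum => k _.
  case: ifP => [nL|_]; last by case: ifP => // _; rewrite ltW // len_gt0.
  case: ifP => // /negbT /link /linked_l h; case/negP: nL; apply/asboolP.
  exact: linked_refl.
rewrite wmu in Alo Ahi.
(* [inA] is the side of the vertex [u]; the test functions are supported by the two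
   sides, and vanish on [S], which separates them *)
pose inA u := `[< exists2 i, i \in A & linked occ (X i) (sub_vert B u) >].
have inAc k : ~~ near k -> inA (src k) = (c k \in A).
  move=> /link lk; apply/asboolP/idP => [[i iA li]|cA]; last by exists (c k).
  by apply: (Acl i) => //; apply/asboolP; apply: linked_trans li (linked_sym lk).
have inAe k : ~~ SS (src k) -> ~~ SS (tgt k) -> inA (src k) = inA (tgt k).
  move=> hs ht; have h := edge_link k hs ht.
  apply/asboolP/asboolP => [][i iA li]; exists i => //; first exact: linked_trans li h.
  exact: linked_trans li (linked_sym h).
pose F u := Num.min (D u) r.
have D_ge0 u : 0 <= D u := dist_to_ge0 SS0 u.
have DS u : SS u -> D u = 0 := dist_to0 SS0 (s := u).
have FS u : SS u -> F u = 0 by move=> /DS h; rewrite /F h min_l // ltW.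
pose f b u := if inA u == b then F u else 0.
have same k : [\/ inA (src k) = inA (tgt k), F (src k) = 0 | F (tgt k) = 0].
  case: (boolP (SS (src k))) => [/FS ?|hs]; first by constructor 2.
  case: (boolP (SS (tgt k))) => [/FS ?|ht]; first by constructor 3.
  by constructor 1; exact: inAe.
have Dl k := dist_to_lip SS0 k.
have DF u : r <= D u -> F u = r by move=> h; rewrite /F min_r.
have Flip k : `|F (tgt k) - F (src k)| <= len k.
  by apply: min_lipschitz; [exact: Dl|rewrite subrr normr0 ltW // len_gt0].
have en b : \sum_(k : edge H) (f b (tgt k) - f b (src k)) ^+ 2 / len k <=
    \sum_(k : edge H | near k) len k.
  apply: (energy_near (r := r) SS0 lenr) => k.
    have l0' := len_gt0 k; have := Flip k; rewrite /f.
    case: (same k) => [->|->|->]; first by case: ifP => // _ _; rewrite subrr normr0 ltW.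
      rewrite if_same; case: ifP => // _ _; by rewrite subrr normr0 ltW.
    by rewrite if_same; case: ifP => // _ _; rewrite subrr normr0 ltW.
  move=> rs rt; have nS u : r <= D u -> ~~ SS u.
    by apply: contraTN => /DS ->; rewrite -ltNge.
  by rewrite /f (inAe k (nS _ rs) (nS _ rt)) !DF.
have mass b : r ^+ 2 * mu / 4 <=
    \sum_(k : edge H) len k * (f b (src k) ^+ 2 + f b (tgt k) ^+ 2).
  have rr0 : 0 < 2 * r ^+ 2 by rewrite mulr_gt0 // exprn_gt0.
  have half : mu / 4 <= \sum_(k | (c k \in A) == b) len k.
    rewrite (wfib (fun j => (j \in A) == b)); case: b.
      by rewrite (eq_bigl (mem A)) // => j; rewrite eqb_id.
    have : mu = \sum_(j in A) w j + \sum_(j | (j \in A) == false) w j.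
      rewrite -wmu (bigID (mem A)) /=; congr (_ + _).
      by apply: eq_bigl => j; rewrite eqbF_neg.
    lra.
  apply: (@le_trans _ _ (2 * r ^+ 2 * (\sum_(k | (c k \in A) == b) len k -
                                       \sum_(k | near k) len k))).
    rewrite (_ : r ^+ 2 * mu / 4 = 2 * r ^+ 2 * (mu / 8)); last by field.
    by rewrite (ler_pM2l rr0); lra.
  rewrite big_mkcond [X in _ * (_ - X)]big_mkcond -sumrB mulr_sumr.
  apply: ler_sum => k _; have l0' := len_gt0 k.
  have pos : 0 <= len k * (f b (src k) ^+ 2 + f b (tgt k) ^+ 2).
    by rewrite mulr_ge0 ?addr_ge0 ?sqr_ge0 // ltW.
  case: (boolP (near k)) => nk.
    apply: le_trans pos; apply: mulr_ge0_le0; first exact: ltW rr0.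
    by rewrite subr_le0; case: (_ == b); rewrite // ltW.
  rewrite subr0; case: eqP => [ckb|_]; last by rewrite mulr0.
  have [h1 h2] := nearP _ nk; have nS u : r <= D u -> ~~ SS u.
    by apply: contraTN => /DS ->; rewrite -ltNge.
  have it := inAe k (nS _ h1) (nS _ h2).
  rewrite /f -it (inAc k nk) ckb eqxx !DF //.
  by rewrite le_eqVlt; apply/orP; left; apply/eqP; ring.
rewrite -/mu -/X2 -KX.
apply: (@lambda1_le_rayleigh _ H G B K (r ^+ 2 * mu / 4) f) => //.
- by rewrite divr_gt0 // mulr_gt0 // exprn_gt0.
- by move=> k; rewrite -ler_pdivlMl // mulr1; apply: le_trans (lenr k) _.
- by move=> u; rewrite /f; case: (inA u); rewrite ?mulr0 ?mul0r.
- by move=> k; split; rewrite /f; case: (same k) => ->; rewrite ?if_same ?mulr0 ?mul0r //;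
    case: (inA _); rewrite /= ?mulr0 ?mul0r.
- move=> b; apply: le_trans (en b) _; apply: le_trans nearv_sharp _.
  rewrite KX /X2 /r; set Dm := dmax%:R.
  rewrite [leRHS](_ : _ = 4 * (l / 8) * d * Dm) //.
  by field; rewrite !gt_eqF.
Qed.

(** The ball of radius [r = l / 16] about the point at distance [l / 4] of one of two
    points of [V], on a geodesic to the other one, does not meet [V].
    Its volume is at least [r] and at most a constant times [r], which bounds the
    Rayleigh quotient of the truncated distance to its center by a constant times
    [r ^- 2].  The two points of [V] provide two disjoint balls. *)
Lemma lambda1_le_lmin : simple_model V -> lambda1 G <= (23 / (l / 16)) ^+ 2.
Proof.
move=> Vsimple; pose r := l / 16; have r0 : 0 < r by rewrite divr_gt0.
have lr : l = 16 * r by rewrite /r; field.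
pose eta := r / 24; have eta0 : 0 < eta by rewrite divr_gt0.
have er : r = 24 * eta by rewrite /eta; field.
have [s Vs] : exists s : seq (gpoint G), forall p, V p <-> p \in s.
  by case: Vset => /finite_seqP[s sE] _ _; exists s => p; rewrite sE.
have [H [B [_ [_ PB lenH]]]] := fine_subdivision s (trivial_subdivision G) eta0.
have VH p : V p -> exists u, sub_vert B u = p by move=> /Vs; exact: PB.
have [v Vv] : exists v, V (sub_vert B v).
  by case: Vset => _ [p Vp] _; have [v vp] := VH p Vp; exists v; rewrite vp.
have incv : exists k : edge H, src k = v \/ tgt k = v.
  have /card_gt0P[v0 _] := vert_neq0 G; have [e _] := incident_edge nontrivial v0.
  have [|k0 _ _] := @sub_cover _ _ _ B e 0; first by rewrite lexx ltW // len_gt0.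
  apply: contrapT => noinc.
  have all x : x = v.
    apply: (@graph_ind _ H (fun x => x = v) _ v x) => // e'.
    by split=> h; exfalso; apply: noinc; exists e'; [left|right].
  by apply: noinc; exists k0; left; exact: all.
have [u Vu uv] := simple_model_two VH Vsimple Vv incv.
have vu : v != u by rewrite eq_sym.
have sep := model_separated Vset VH.
have Luv := sep _ _ Vu Vv uv.
have near_end a b : V (sub_vert B a) -> l <= vdist a b -> exists p,
    l / 4 <= vdist a p < l / 4 + eta /\
    forall w, V (sub_vert B w) -> 4 * r <= vdist p w.
  move=> Va ab; have [|p [p1 p2 _]] := @geodesic_point _ H a b (l / 4) _ eta0 lenH.
    by lra.
  exists p; split=> [|w Vw]; first by rewrite p1 p2.
  have [->|wa] := eqVneq w a; first by rewrite vdist_sym; lra.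
  by have := sep _ _ Vw Va wa; have := vdist_triangle p a w; lra.
have [p [/andP[p1 p2] pV]] := near_end v u Vv Luv.
have [|q [/andP[q1 q2] qV]] := near_end u v Vu; first by rewrite vdist_sym.
have pq : 7 * r <= vdist p q.
  have := vdist_triangle p v u; have := vdist_triangle q p u.
  by rewrite (vdist_sym q u); lra.
pose F (c x : vert H) := r - Num.min (vdist c x) r.
have F0 c x : r <= vdist c x -> F c x = 0 by move=> h; rewrite /F min_r // subrr.
have ex1 c : exists x : vert H, pred1 c x by exists c; exact: eqxx.
have energy c : (forall w, V (sub_vert B w) -> 4 * r <= vdist c w) ->
    \sum_(k : edge H) (F c (tgt k) - F c (src k)) ^+ 2 / len k <= 4 * r.
  move=> cV; apply: le_trans (energy_near (r := r) (ex1 c) lenH _ _) _.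
  - move=> k; rewrite /F opprD addrACA subrr add0r opprK addrC distrC.
    apply: min_lipschitz; first exact: (dist_to_lip (ex1 c)).
    by rewrite subrr normr0 ltW // len_gt0.
  - by move=> k h1 h2; rewrite !F0.
  apply: le_trans (near_volume (ex1 c) (V := fun u => `[< V (sub_vert B u) >]) (dmax := 2) _ _ _) _.
  - by lra.
  - by move=> x /asboolP; exact: (degree2 Vset).
  - move=> x xc; rewrite (degree2 Vset (B := B)) // => /cV; rewrite -/(vdist c x) in xc.
    lra.
  rewrite card1 (_ : #|_| = 0%N) ?addr0 ?mulr1; first by lra.
  apply: eq_card0 => x; rewrite !inE; apply/negP => /andP[/asboolP /cV].
  rewrite -/(vdist c x); lra.
have mass c : 4 * r <= vdist c v ->
    r ^+ 3 / 8 <= \sum_(k : edge H) len k * (F c (src k) ^+ 2 + F c (tgt k) ^+ 2).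
  move=> cv; have [|x [x1 x2 _]] := @geodesic_point _ H c v (r / 4) _ eta0 lenH; first by lra.
  have := ball_volume_ge (ex1 c) x; rewrite -/(vdist c x) => vol.
  apply: (@le_trans _ _ (r ^+ 2 / 2 * vdist c x)).
    rewrite (_ : r ^+ 3 / 8 = r ^+ 2 / 2 * (r / 4)); last by field.
    by rewrite ler_wpM2l // divr_ge0 // sqr_ge0.
  apply: (@le_trans _ _ _ _ _ (ler_wpM2l _ vol)); first by rewrite divr_ge0 // sqr_ge0.
  rewrite mulr_sumr big_mkcond; apply: ler_sum => k _; have l0' := len_gt0 k.
  have pos y : 0 <= F c y ^+ 2 := sqr_ge0 _.
  case: ifP => [/andP[h1 h2]|_]; last by rewrite mulr_ge0 ?addr_ge0 ?pos // ltW.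
  have Fy y : vdist c y <= vdist c x -> (r / 2) ^+ 2 <= F c y ^+ 2.
    move=> yx; have yr : vdist c y <= r / 2 by lra.
    have -> : F c y = r - vdist c y by rewrite /F min_l //; apply: le_trans yr _; lra.
    by move: (vdist c y) yr => t tr; rewrite lerXn2r ?nnegrE //; lra.
  rewrite [leLHS]mulrC ler_pM2l //; have := Fy _ h1; have := Fy _ h2.
  rewrite (_ : (r / 2) ^+ 2 = r ^+ 2 / 4); last by field.
  lra.
have disj x y : vdist x y <= eta -> F p x * F q y = 0.
  move=> xy; case: (leP r (vdist p x)) => [/F0 ->|px]; first by rewrite mul0r.
  case: (leP r (vdist q y)) => [/F0 ->|qy]; first by rewrite mulr0.
  exfalso; have := vdist_triangle x p q; have := vdist_triangle y x q.
  by rewrite (vdist_sym y q); lra.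
have edge_eta (k : edge H) : vdist (src k) (tgt k) <= eta.
  exact: le_trans (vdist_dart (k, false)) (lenH k).
rewrite -/r.
(* the energy is at most [4 * r], and 23 ^ 2 >= 16 * 8 * 4 *)
apply: (@lambda1_le_rayleigh _ H G B _ (r ^+ 3 / 8) (fun b => F (if b then p else q))).
- by rewrite divr_gt0.
- by rewrite divr_gt0 // exprn_gt0.
- move=> k; rewrite mulrAC ler_pdivrMr // mul1r; have := lenH k; lra.
- by move=> x; apply: disj; rewrite vdistxx ltW.
- by move=> k; split; apply: disj; rewrite // vdist_sym.
- move=> b; apply: (@le_trans _ _ (4 * r)); first by apply: energy; case: b.
  rewrite (_ : (23 / r) ^+ 2 / 16 * (r ^+ 3 / 8) = 529 / 128 * r); first by lra.
  by field; rewrite gt_eqF.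
- by move=> b; apply: mass; case: b; [exact: pV|exact: qV].
Qed.

(** If the neighbourhoods of [d] points are too large for [lambda1_le_gonality], then
    [volume G] is at most [4 * l * d * dmax], and [lambda1_le_lmin] is enough. *)
Lemma model_gonality : simple_model V ->
  lambda1 G * l * volume G <= 4 * (23 * 16) ^+ 2 * d * dmax%:R.
Proof.
move=> Vsimple; set mu := volume G; set Dm := dmax%:R.
have D0 : 0 < Dm :> R by rewrite ltr0n.
have d0 : 0 <= d by rewrite ler0n.
have mu0 : 0 < mu.
  have /card_gt0P[v0 _] := vert_neq0 G; have [e _] := incident_edge nontrivial v0.
  rewrite /mu /volume (bigD1 e) //= ltr_pwDl ?len_gt0 //.
  by apply: sumr_ge0 => k _; rewrite ltW // len_gt0.
case: (leP (4 * l * d * Dm) mu) => small.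
  have := lambda1_le_gonality small; rewrite ler_pdivlMr ?mulr_gt0 // -/mu -/Dm => h.
  rewrite -mulrA; apply: le_trans h _; rewrite -[leRHS]mulrA -[in leLHS]mulrA.
  have : 0 <= d * Dm by rewrite mulr_ge0 // ltW.
  by move: (d * Dm) => y y0; lra.
have := lambda1_le_lmin Vsimple => h.
apply: (@le_trans _ _ ((23 / (l / 16)) ^+ 2 * l * mu)).
  by rewrite (ler_pM2r mu0) (ler_pM2r l0).
apply: (@le_trans _ _ ((23 / (l / 16)) ^+ 2 * l * (4 * l * d * Dm))).
  by apply: ler_wpM2l; [rewrite mulr_ge0 ?sqr_ge0 // ltW|exact: ltW].
rewrite le_eqVlt; apply/orP; left; apply/eqP; field; rewrite gt_eqF //.
Qed.

End MainEstimate.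

(** * The gonality *)

Lemma valence_max_valence (R : realType) (G : metric_graph R) (p : gpoint G) :
  (valence p)%:R <= max_valence G.
Proof.
apply: ub_le_sup; last by exists p.
exists #|{: edge G * bool}|%:R => _ [q _ <-]; rewrite ler_nat; exact: max_card.
Qed.

Theorem theorem1p1 (R : realType) :
  exists C : R, 0 < C /\
    forall G : metric_graph R, (exists p q : gpoint G, p <> q) ->
      C * (lambda1 G * lmin G * volume G / max_valence G) <= (gonality G)%:R.
Proof.
pose c : R := 4 * (23 * 16) ^+ 2.
have c0 : 0 < c by rewrite mulr_gt0 // exprn_gt0 // mulr_gt0.
exists c^-1; split=> [|G nontrivial]; first by rewrite invr_gt0.
have /card_gt0P[v _] := vert_neq0 G; have [e ev] := incident_edge nontrivial v.
have vol0 : 0 < volume G.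
  rewrite /volume (bigD1 e) //= ltr_pwDl ?len_gt0 //.
  by apply: sumr_ge0 => k _; rewrite ltW // len_gt0.
set M := max_valence G; pose dmax := Num.truncn M.
have M0 : 0 <= M by apply: le_trans (valence_max_valence (inl v)).
have dM : dmax%:R <= M by rewrite truncn_le.
have val_dmax (p : gpoint G) : (valence p <= dmax)%N.
  by rewrite -ltnS -(ltr_nat R); apply: le_lt_trans (truncnS_gt M); exact: valence_max_valence.
have dmax0 : (0 < dmax)%N.
  apply: leq_trans (val_dmax (inl v)); apply/card_gt0P.
  case: ev => <-; first by exists (e, true); rewrite inE.
  by exists (e, false); rewrite inE.
have Mpos : 0 < M by apply: lt_le_trans dM; rewrite ltr0n.
have bound (V : set (gpoint G)) : simple_model V -> lambda1 G * model_lmin V * volume G <=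
    c * (gonality G)%:R * M.
  move=> sV; have Vset : vertex_set V by case: sV.
  have := model_lmin_ge0 V; rewrite le_eqVlt => /predU1P[<-|l0].
    by rewrite mulr0 mul0r !mulr_ge0 // ltW.
  apply: le_trans (model_gonality Vset nontrivial val_dmax dmax0 l0 sV) _.
  by rewrite ler_wpM2l // mulr_ge0 // ltW.
rewrite ler_pdivrMl // ler_pdivrMr //.
case: (leP (lambda1 G) 0) => [lneg|lpos].
  apply: (@le_trans _ _ 0); last by rewrite !mulr_ge0 // ltW.
  apply: mulr_le0_ge0; last exact: ltW.
  apply: mulr_le0_ge0 => //; rewrite /lmin.
  have [hA|/sup_out ->//] := pselect (has_sup [set model_lmin V | V in @simple_model R G]).
  case: (hA) => [[_ [V sV _]] _]; apply: le_trans (model_lmin_ge0 V) _.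
  by apply: ub_le_sup; [case: hA|exists V].
rewrite -ler_pdivlMr // -ler_pdivlMl // /lmin.
have [[x Ax]|A0] := pselect ([set model_lmin V | V in @simple_model R G] !=set0); last first.
  rewrite (_ : [set _ | _ in _] = set0) ?sup0; last first.
    by apply/seteqP; split => // x Ax; apply: A0; exists x.
  by rewrite mulr_ge0 ?invr_ge0 ?divr_ge0 ?mulr_ge0 ?(ltW lpos) ?(ltW vol0) ?(ltW c0).
apply: ge_sup; first by exists x.
by move=> _ [V sV <-]; rewrite ler_pdivlMl // ler_pdivlMr //; exact: bound.
Qed.
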